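(* Let $(\mathbf u,p,C)$ be the solution of $(V_a)$, $(\mathbf u_h,p_h,C_h)$ the solution of $(V_{ah})$, and $(\mathbf u_h^{i},p_h^{i},C_h^{i})$ the iterates defined by $(V_{ahi})$ with parameter $\gamma>0$ and initial guess $(\mathbf u_h^0,C_h^0)\in X_h\times Y_h$. Assume that $\mathbf f_0\in L^2(\Omega)^d$, $C\in H^2(\Omega)$, $\mathbf u\in W^{1,3}(\Omega)^d\cap L^\infty(\Omega)^d$, $p\in H^2(\Omega)$, that $$S_6^0|C|_{W^{1,3}(\Omega)}+\|C\|_{L^\infty(\Omega)}\le\frac{\alpha\mu K_m}{2\sqrt2\,\rho\,c_{\mathbf f_1}S_2^0}\quad\text{and}\quad S_6^0|C|_{W^{1,3}(\Omega)}+\|C\|_{L^\infty(\Omega)}\le\frac{\alpha\mu K_m}{8\rho\,c_{\mathbf f_1}^2S_2^0},$$ that $\|\mathbf u_h^0\|_{L^2(\Omega)^d}\le L_1(\mathbf f,g)$, that $\gamma>\max\{\gamma_*,\gamma_{**}\}$, and that $$h\le\Big(\frac1{2c_Ic_1}\Big(|C|_{W^{1,3}(\Omega)}+\frac{\|C\|_{L^\infty(\Omega)}}{S_6^0}\Big)\Big)^{6/(6-d)}.$$ Then there exists a positive number $i_1$ depending on $h$ such that for all $i\ge i_1$, $$\|\nabla(p-p_h^{i+1})\|_{L^{3/2}(\Omega)^d}\le\tilde c_1\sum_{\kappa\in\mathcal T_h}\Big(\eta_{\kappa,i}^{(D_1)}+\eta_{\kappa,i}^{(D_2)}+\eta_{\kappa,i}^{(D_3)}+\eta_{\kappa,i}^{(L_1)}+\eta_{\kappa,i}^{(L_2)}+h_\kappa\|g-g_h\|_{L^2(\kappa)}+\|\mathbf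 f(\cdot,C)-\mathbf f_h(\cdot,C)\|_{L^2(\kappa)}\Big),$$ where $\tilde c_1$ is a positive constant independent of $h$.
   Context: Setting. $d\in\{2,3\}$ and $\Omega\subset\mathbb R^d$ is a bounded, simply connected open polygon ($d=2$) or polyhedron ($d=3$) with Lipschitz boundary and outer unit normal $\mathbf n$. $|\cdot|$ is the Euclidean norm. $\mu,\rho,\beta,\alpha,r_0$ are strictly positive constants. $K$ is a uniformly positive definite, bounded tensor field with $0<K_m\le\|K^{-1}\|_{L^\infty(\Omega)^{d\times d}}\le K_M$, where $K_m$ is not larger than the smallest eigenvalue of $K^{-1}$ over $\Omega$. The data satisfy $\mathbf f(\mathbf x,C)=\mathbf f_0(\mathbf x)+\mathbf f_1(C)$ with $\mathbf f_0\in L^{3/2}(\Omega)^d$, $\mathbf f_1:\mathbb R\to\mathbb R^d$ Lipschitz with constant $c_{\mathbf f_1}>0$ and $\mathbf f_1(0)=0$, and $g\in L^2(\Omega)$. For a function $C$, $\mathbf f(\cdot,C)$ denotes $\mathbf x\mapsto\mathbf f(\mathbf x,C(\mathbf x))$. $|\cdot|_{W^{1,p}(\Omega)}$ is the seminorm $\|\nabla\cdot\|_{L^p}$. $S_p^0$ is a constant such that $\|v\|_{L^p(\Omega)}\le S_p^0|v|_{H^1(\Omega)}$ for all $v\in H^1_0(\Omega)$. Spaces: $X=L^3(\Omega)^d$, $M=W^{1,3/2}(\Omega)\cap L^2_0(\Omega)$ ($L^2_0$: zero-mean functions of $L^2$), $Y=H^1_0(\Omega)$. Problem $(V_a)$: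 find $(\mathbf u,p,C)\in X\times M\times Y$ such that for all $\mathbf v\in X$, $q\in M$, $S\in Y$: $\frac\mu\rho\int_\Omega K^{-1}\mathbf u\cdot\mathbf v+\frac\beta\rho\int_\Omega|\mathbf u|\mathbf u\cdot\mathbf v+\int_\Omega\nabla p\cdot\mathbf v=\int_\Omega\mathbf f(\cdot,C)\cdot\mathbf v$; $\int_\Omega\nabla q\cdot\mathbf u=0$; $\alpha\int_\Omega\nabla C\cdot\nabla S+\int_\Omega(\mathbf u\cdot\nabla C)S+r_0\int_\Omega CS=\int_\Omega gS$. Meshes: $(\mathcal T_h)_h$ is a family of conforming triangulations of $\overline\Omega$ by closed nondegenerate triangles/tetrahedra $\kappa$, of maximal diameter $h$; $h_\kappa$ is the diameter of $\kappa$, $\rho_\kappa$ that of its inscribed ball, $h_e$ the diameter of an edge ($d=2$) or face ($d=3$) $e$. It is regular ($\max_\kappa h_\kappa/\rho_\kappa\le\sigma$, $\sigma$ independent of $h$) and uniformly regular ($h_\kappa\ge\beta_0h$, $\beta_0>0$ independent of $h$). Discrete spaces: with $b_\kappa=\lambda_1\cdots\lambda_{d+1}$ the product of the barycentric coordinates of $\kappa$ and $\mathcal P(\kappa)=\mathbb P_1(\kappa)\oplus\mathrm{Vect}\{b_\kappa\}$, $X_h=\{\mathbf v_h\in C^0(\overline\Omega)^d:\mathbf v_h|_\kappa\in\mathcal P(\kappa)^d\ \forall\kappa\}$, $M_h=\{q_h\in C^0(\overline\Omega):q_h|_\kappa\in\mathbb P_1(\kappa)\ \forall\kappa\}\cap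 L_0^2(\Omega)$, $Y_h=\{q_h\in C^0(\overline\Omega):q_h|_\kappa\in\mathbb P_1(\kappa)\ \forall\kappa\}\cap H_0^1(\Omega)$. Problem $(V_{ah})$: find $(\mathbf u_h,p_h,C_h)\in X_h\times M_h\times Y_h$ such that for all $\mathbf v_h\in X_h$, $q_h\in M_h$, $S_h\in Y_h$: $\frac\mu\rho\int_\Omega K^{-1}\mathbf u_h\cdot\mathbf v_h+\frac\beta\rho\int_\Omega|\mathbf u_h|\mathbf u_h\cdot\mathbf v_h+\int_\Omega\nabla p_h\cdot\mathbf v_h=\int_\Omega\mathbf f(\cdot,C_h)\cdot\mathbf v_h$; $\int_\Omega\nabla q_h\cdot\mathbf u_h=0$; $\alpha\int_\Omega\nabla C_h\cdot\nabla S_h+\int_\Omega(\mathbf u_h\cdot\nabla C_h)S_h+\frac12\int_\Omega\operatorname{div}(\mathbf u_h)C_hS_h+r_0\int_\Omega C_hS_h=\int_\Omega gS_h$. Iterative problem $(V_{ahi})$: given $(\mathbf u_h^i,C_h^i)\in X_h\times Y_h$, find $(\mathbf u_h^{i+1},p_h^{i+1},C_h^{i+1})\in X_h\times M_h\times Y_h$ such that for all $\mathbf v_h\in X_h$, $q_h\in M_h$, $S_h\in Y_h$: $\gamma\int_\Omega(\mathbf u_h^{i+1}-\mathbf u_h^i)\cdot\mathbf v_h+\frac\mu\rho\int_\Omega K^{-1}\mathbf u_h^{i+1}\cdot\mathbf v_h+\frac\beta\rho\int_\Omega|\mathbf u_h^i|\mathbf u_h^{i+1}\cdot\mathbf v_h+\int_\Omega\nabla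 p_h^{i+1}\cdot\mathbf v_h=\int_\Omega\mathbf f(\cdot,C_h^i)\cdot\mathbf v_h$; $\int_\Omega\nabla q_h\cdot\mathbf u_h^{i+1}=0$; $\alpha\int_\Omega\nabla C_h^{i+1}\cdot\nabla S_h+\int_\Omega(\mathbf u_h^{i+1}\cdot\nabla C_h^{i+1})S_h+\frac12\int_\Omega\operatorname{div}(\mathbf u_h^{i+1})C_h^{i+1}S_h+r_0\int_\Omega C_h^{i+1}S_h=\int_\Omega gS_h$. Constants. $c_I>0$ is the constant (independent of $h$) of the inverse inequality $\|v_h\|_{L^p}\le c_Ih^{d/p-d/2}\|v_h\|_{L^2}$ for discrete functions, $p\in\{3,6\}$. $c_1>0$ is the constant, independent of $h$, of the known a priori error estimate $|C-C_h|_{H^1(\Omega)}+\|\mathbf u-\mathbf u_h\|_{L^2(\Omega)^d}+\|\nabla(p-p_h)\|_{L^{3/2}(\Omega)^d}\le c_1h$. With $F=\|\mathbf f_0\|_{L^2(\Omega)^d}+c_{\mathbf f_1}\frac{(S_2^0)^2}{\alpha}\|g\|_{L^2(\Omega)}$: $L_1(\mathbf f,g)=\frac{\rho}{\mu K_m}F$, $\gamma_*=\frac{32\beta}{27\rho}c_I^3h^{-d/2}\big(\frac{\rho}{\mu K_m}+\frac{\rho K_M}{\mu K_m^2}\big)F+\frac{32\beta^2\rho}{27\mu^3K_m^3}c_I^6h^{-d}F^2$, $\gamma_{**}=2c_I^4h^{-2d/3}\frac{\rho^{1/3}\beta^{4/3}}{\mu^{5/3}K_m^{5/3}}F^{4/3}$.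 Approximations: $g_h$ is an approximation of $g$ that is constant on each $\kappa$; on each $\kappa$, $\mathbf f_h(\cdot,C)=\frac1{|\kappa|}\int_\kappa\mathbf f(\mathbf x,C(\mathbf x))\,d\mathbf x$. $\Gamma_h^i$ is the set of edges/faces not contained in $\partial\Omega$, $\Gamma_h^b$ those contained in $\partial\Omega$; $[\cdot]_e$ is the jump across $e$; $\phi_{h,1}^e=\frac12[\mathbf u_h^{i+1}\cdot\mathbf n]_e$ if $e\in\Gamma_h^i$ and $\phi_{h,1}^e=\mathbf u_h^{i+1}\cdot\mathbf n$ if $e\in\Gamma_h^b$. Indicators for $\kappa\in\mathcal T_h$: $\eta_{\kappa,i}^{(L_1)}=\|\mathbf u_h^{i+1}-\mathbf u_h^i\|_{L^2(\kappa)}$; $\eta_{\kappa,i}^{(L_2)}=\|C_h^i-C_h^{i+1}\|_{H^1(\kappa)}$; $\eta_{\kappa,i}^{(D_1)}=h_\kappa\|\alpha\Delta C_h^{i+1}-\mathbf u_h^{i+1}\cdot\nabla C_h^{i+1}-\frac12\operatorname{div}(\mathbf u_h^{i+1})C_h^{i+1}-r_0C_h^{i+1}+g_h\|_{L^2(\kappa)}+\frac12\sum_{e\in\partial\kappa\cap\Gamma_h^i}h_e^{1/2}\|\alpha[\nabla C_h^{i+1}\cdot\mathbf n]_e\|_{L^2(e)}$; $\eta_{\kappa,i}^{(D_2)}=\|-\nabla p_h^{i+1}-\gamma(\mathbf u_h^{i+1}-\mathbf u_h^i)-\frac\mu\rho K^{-1}\mathbf u_h^{i+1}-\frac\beta\rho|\mathbf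 u_h^i|\mathbf u_h^{i+1}+\mathbf f_h(\cdot,C_h^i)\|_{L^2(\kappa)}$; $\eta_{\kappa,i}^{(D_3)}=h_\kappa\|\operatorname{div}\mathbf u_h^{i+1}\|_{L^3(\kappa)}+\sum_{e\in\partial\kappa}h_e^{1/3}\|\phi_{h,1}^e\|_{L^3(e)}$. *)

(* Defs.v *)
From HB Require Import structures.
From mathcomp Require Import all_boot all_order all_algebra.
From mathcomp Require Import all_classical all_reals all_analysis.
Set Implicit Arguments.
Unset Strict Implicit.
Unset Printing Implicit Defensive.
Import Order.TTheory GRing.Theory Num.Theory.
Import numFieldNormedType.Exports.
Local Open Scope classical_set_scope.
Local Open Scope ring_scope.

Definition rV_display : measure_display. Proof. exact. Qed.

Section measurable_rV.
Context {R : realType} (n : nat).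

Let coors : 'I_n -> 'rV[R]_n -> R := fun i v => v ord0 i.

Let rV_set0 : g_sigma_preimage coors set0.
Proof. exact: sigma_algebra0. Qed.

Let rV_setC A : g_sigma_preimage coors A -> g_sigma_preimage coors (~` A).
Proof. exact: sigma_algebraC. Qed.

Let rV_bigcup (F : _^nat) : (forall i, g_sigma_preimage coors (F i)) ->
  g_sigma_preimage coors (\bigcup_i (F i)).
Proof. exact: sigma_algebra_bigcup. Qed.

HB.instance Definition _ := @isMeasurable.Build rV_display
  'rV[R]_n (g_sigma_preimage coors) rV_set0 rV_setC rV_bigcup.

End measurable_rV.

Lemma measurable_coord (R : realType) n (i : 'I_n) :
  measurable_fun [set: 'rV[R]_n] (fun v => v ord0 i).
Proof.
move=> _ Y mY; rewrite setTI; apply: sub_sigma_algebra => /=.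
rewrite -bigcup_seq/=; exists i => /=; first by rewrite mem_index_enum.
by exists Y => //; rewrite setTI.
Qed.

Lemma measurable_fun_rV d (T : measurableType d) (R : realType) n
    (f : T -> 'rV[R]_n) :
  (forall i, measurable_fun [set: T] (fun t => f t ord0 i)) ->
  measurable_fun [set: T] f.
Proof.
move=> mf _ A; rewrite setTI; move: A.
pose F := image_set_system [set: T] f measurable.
suff : @measurable _ 'rV[R]_n `<=` F.
  by move=> h A /h; rewrite /F /image_set_system /= setTI.
apply: smallest_sub.
  exact: sigma_algebra_image (@sigma_algebra_measurable _ T).
rewrite -bigcup_seq => A [i _ [B mB <-]].
rewrite /F /image_set_system /= !setTI.
by have := mf i measurableT B mB; rewrite setTI.
Qed.

Section cons_rV.
Context {R : realType} (n : nat).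

Definition cons_rV (z : R * 'rV[R]_n) : 'rV[R]_n.+1 :=
  \row_i oapp (z.2 ord0) z.1 (unlift ord0 i).

Definition uncons_rV (v : 'rV[R]_n.+1) : R * 'rV[R]_n :=
  (v ord0 ord0, \row_i v ord0 (lift ord0 i)).

Lemma cons_rVK : cancel cons_rV uncons_rV.
Proof.
case=> x v; rewrite /uncons_rV /cons_rV /= mxE unlift_none /=; congr (_, _).
by apply/rowP => i; rewrite !mxE liftK.
Qed.

Lemma measurable_cons_rV : measurable_fun [set: R * 'rV[R]_n] cons_rV.
Proof.
apply: measurable_fun_rV => i; rewrite /cons_rV.
under eq_fun do rewrite mxE.
case: (unliftP ord0 i) => [j _|_] /=; last exact: measurable_fst.
exact: (measurableT_comp (@measurable_coord R n j) measurable_snd).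
Qed.

Lemma measurable_uncons_rV : measurable_fun [set: 'rV[R]_n.+1] uncons_rV.
Proof.
apply: measurable_fun_pair; first exact: measurable_coord.
apply: measurable_fun_rV => i; under eq_fun do rewrite mxE.
exact: measurable_coord.
Qed.

End cons_rV.

Section leb_step.
Context {R : realType} (n : nat).
Variable m : {sigma_finite_measure set 'rV[R]_n -> \bar R}.

Let leb1 : {sigma_finite_measure set (measurableTypeR R) -> \bar R} :=
  @lebesgue_measure R.

Let prod : {measure set (measurableTypeR R * 'rV[R]_n)%type -> \bar R} :=
  (leb1 \x m)%E.

Definition leb_step : set 'rV[R]_n.+1 -> \bar R :=
  pushforward prod (@cons_rV R n).

Let leb_step0 : leb_step set0 = 0%E.
Proof. by rewrite /leb_step /pushforward preimage_set0 measure0. Qed.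

Let leb_step_ge0 A : (0 <= leb_step A)%E.
Proof. exact: (measure_ge0 prod). Qed.

Let leb_step_sigma_additive : semi_sigma_additive leb_step.
Proof.
pose M := measure_function_pushforward__canonical__measure_function_Measure
  prod (@measurable_cons_rV R n).
exact: (@measure_semi_sigma_additive _ _ _ M).
Qed.

HB.instance Definition _ := isMeasure.Build _ _ _ leb_step
  leb_step0 leb_step_ge0 leb_step_sigma_additive.

Let leb_step_sigma_finite : sigma_finite setT leb_step.
Proof.
have /sigma_finiteP[F [FT ndF Ffin]] := sigma_finiteT leb1.
have /sigma_finiteP[G [GT ndG Gfin]] := sigma_finiteT m.
exists (fun k => @uncons_rV R n @^-1` (F k `*` G k)).
  apply/esym; rewrite -preimage_bigcup predeqE => v; split => // _.
  have [i _ Fi] : (\bigcup_k F k) (uncons_rV v).1 by rewrite -FT.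
  have [j _ Gj] : (\bigcup_k G k) (uncons_rV v).2 by rewrite -GT.
  exists (maxn i j) => //; split.
  - by move: Fi; exact/subsetPset/ndF/leq_maxl.
  - by move: Gj; exact/subsetPset/ndG/leq_maxr.
move=> k; have [mF Fk] := Ffin k; have [mG Gk] := Gfin k.
have mFG : measurable (F k `*` G k) by exact: measurableX.
split; first by rewrite -[X in measurable X]setTI; exact: measurable_uncons_rV.
rewrite /leb_step /pushforward -comp_preimage.
rewrite (_ : _ \o _ = id) ?preimage_id; last first.
  by apply/funext => z; exact: cons_rVK.
by rewrite /prod /= product_measure1E// lte_mul_pinfty// ge0_fin_numE.
Qed.

HB.instance Definition _ := @Measure_isSigmaFinite.Build _ _ _ leb_step
  leb_step_sigma_finite.

End leb_step.

Fixpoint leb (R : realType) (n : nat) :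
    {sigma_finite_measure set 'rV[R]_n -> \bar R} :=
  if n is k.+1 then leb_step (leb R k) else \d_(0 : 'rV[R]_0).

(* The library norm on row vectors is the sup norm; it is only used for the
   topology, and [norm2] is the Euclidean norm. *)

Section euclid.
Context {R : realType} {m : nat}.
Implicit Types (u v x y : 'rV[R]_m) (A : set 'rV[R]_m).

Definition dotv u v : R := \sum_i u ord0 i * v ord0 i.

Definition norm2 u : R := Num.sqrt (dotv u u).

Definition app_mx (M : 'M[R]_m) u : 'rV[R]_m := u *m M^T.

Definition opnorm (M : 'M[R]_m) : R :=
  sup [set norm2 (app_mx M v) | v in [set v | norm2 v <= 1]].

Definition diam A : R := sup [set norm2 (z.1 - z.2) | z in A `*` A].

Definition inball_diam A : R :=
  sup [set 2 * r | r in [set r |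
    0 <= r /\ exists c, forall y, norm2 (y - c) <= r -> A y]].

Definition bdry A : set 'rV[R]_m := closure A `\` A°.

(* locally, up to a rotation sending [e] to the last basis vector, [A] is the
   strict epigraph of a Lipschitz function defined on the hyperplane e^⊥ *)
Definition lipschitz_boundary A := forall x, bdry A x ->
  exists (e : 'rV[R]_m) (phi : 'rV[R]_m -> R) (L r : R),
    [/\ norm2 e = 1, 0 < r,
        forall y z, `|phi y - phi z| <= L * norm2 (y - z) &
        forall y, norm2 (y - x) < r ->
          (A y <-> phi (y - dotv y e *: e) < dotv y e)].

Definition simply_connected A :=
  (forall x y, A x -> A y -> exists c : R -> 'rV[R]_m,
     [/\ {within `[0, 1], continuous c}, c 0 = x, c 1 = y &
         forall t, t \in `[0, 1] -> A (c t)]) /\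
  (forall c : R -> 'rV[R]_m, {within `[0, 1], continuous c} -> c 0 = c 1 ->
     (forall t, t \in `[0, 1] -> A (c t)) ->
     exists H : R * R -> 'rV[R]_m,
       [/\ {within `[0, 1] `*` `[0, 1], continuous H},
           forall s t, s \in `[0, 1] -> t \in `[0, 1] -> A (H (s, t)),
           forall t, t \in `[0, 1] -> H (0, t) = c t,
           forall t, t \in `[0, 1] -> H (1, t) = H (1, 0) &
           forall s, s \in `[0, 1] -> H (s, 0) = H (s, 1)]).

End euclid.

(* The space dimension is d = n.+1. Functions are total on R^d, but only their
   values on [D] matter; elements of L^p are given by Borel representatives. *)

Section spaces.
Context {R : realType} {n : nat}.
Local Notation pt := 'rV[R]_n.+1.
Local Notation vol := (leb R n.+1).
Implicit Types (D : set pt) (f g phi : pt -> R) (v w : pt -> pt) (p : \bar R).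

Definition Lp p D f : \bar R := 'N[vol]_p[EFin \o patch (fun=> 0) D f].

Definition LpV p D v : \bar R := Lp p D (norm2 \o v).

Definition inLp p D f := measurable_fun D f /\ (Lp p D f < +oo)%E.

Definition component v (i : 'I_n.+1) : pt -> R := fun x => v x ord0 i.

Definition inLpV p D v := forall i, inLp p D (component v i).

Definition l2 D f g : R := \int[vol]_(x in D) (f x * g x).

Definition l2V D v w : R := \int[vol]_(x in D) dotv (v x) (w x).

Definition base_vec (i : 'I_n.+1) : pt := delta_mx ord0 i.

Definition pd (i : 'I_n.+1) f : pt -> R := fun x => 'D_(base_vec i) f x.

Definition smooth phi :=
  forall (s : seq 'I_n.+1) x, differentiable (foldr pd phi s) x.

Definition test_fun D phi :=
  let supp := closure [set x | phi x != 0] in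
  [/\ smooth phi, compact supp & supp `<=` D].

Definition loc_integrable D f :=
  forall A, compact A -> A `<=` D -> vol.-integrable A (EFin \o f).

Definition is_wpd D i f g :=
  [/\ loc_integrable D f, loc_integrable D g &
      forall phi, test_fun D phi -> l2 D f (pd i phi) = - l2 D g phi].

(* a representative of the i-th weak partial derivative of [f] in [D], and 0
   if there is none *)
Definition wpd D i f : pt -> R := xget (fun=> 0) [set g | is_wpd D i f g].

Definition wgrad D f : pt -> pt := fun x => \row_i wpd D i f x.

Definition wdiv D v : pt -> R := fun x => \sum_i wpd D i (component v i) x.

(* W^{k,p}(D) *)
Fixpoint sobolev (k : nat) p D f : Prop :=
  inLp p D f /\
  if k is l.+1 then forall i, exists2 g, is_wpd D i f g & sobolev l p D g
  else True.

Definition H1norm D f : \bar R :=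
  ((Lp 2%:E D f `^ 2 + LpV 2%:E D (wgrad D f) `^ 2) `^ (2^-1))%E.

Definition H10 D f := sobolev 1 2%:E D f /\
  forall e : R, 0 < e ->
    exists2 phi, test_fun D phi & (H1norm D (f \- phi)%R < e%:E)%E.

Definition L20 D f := inLp 2%:E D f /\ \int[vol]_(x in D) f x = 0.

Definition spX D v := inLpV 3%:E D v.
Definition spM D f := sobolev 1 (3 / 2)%:E D f /\ L20 D f.
Definition spY D f := H10 D f.

(* classical differential operators, applied below only to functions that are
   polynomial near the point *)
Definition cgrad f : pt -> pt := fun x => \row_i pd i f x.
Definition clap f : pt -> R := fun x => \sum_i pd i (pd i f) x.
Definition cdiv v : pt -> R := fun x => \sum_i pd i (component v i) x.

End spaces.

(* A simplex is the matrix whose rows are its vertices. *)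

Section meshes.
Context {R : realType} {n : nat}.
Local Notation pt := 'rV[R]_n.+1.
Local Notation vol := (leb R n.+1).

Definition simplex := 'M[R]_(n.+2, n.+1).
Definition mesh := seq simplex.
Implicit Types (k : simplex) (T : mesh) (j : 'I_n.+2) (I : {set 'I_n.+2}).

(* rows (1, a_j): the inverse of this matrix maps (1, x) to the barycentric
   coordinates of x *)
Definition homog k : 'M[R]_n.+2 :=
  (row_mx (const_mx 1 : 'M[R]_(n.+2, 1)) k : 'M[R]_(n.+2, 1 + n.+1)).

Definition nondegenerate_simplex k := homog k \in unitmx.

Definition bary k (x : pt) : 'rV[R]_n.+2 :=
  (row_mx (1%:M : 'M[R]_1) x : 'rV[R]_(1 + n.+1)) *m invmx (homog k).

Definition bubble k (x : pt) : R := \prod_j bary k x ord0 j.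

Definition face k I : set pt := [set x | exists l : 'rV[R]_n.+2,
  [/\ forall j, 0 <= l ord0 j, forall j, j \notin I -> l ord0 j = 0,
      \sum_j l ord0 j = 1 & x = l *m k]].

Definition cell k := face k [set: 'I_n.+2]%SET.

(* the edge (d = 2) or face (d = 3) opposite to the j-th vertex *)
Definition facet k j := face k [set~ j]%SET.

Definition triangulates (D : set pt) T :=
  [/\ uniq T, forall k, k \in T -> nondegenerate_simplex k,
      closure D = [set x | exists2 k, k \in T & cell k x] &
      forall k k', k \in T -> k' \in T -> k != k' ->
        exists I I' : {set 'I_n.+2},
          [/\ I != [set: 'I_n.+2]%SET, cell k `&` cell k' = face k I &
              cell k `&` cell k' = face k' I']].

Definition hmesh T : R := \big[Num.max/0]_(k <- T) diam (cell k).

Definition regular_mesh (sigma : R) T :=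
  forall k, k \in T -> diam (cell k) / inball_diam (cell k) <= sigma.

Definition uniformly_regular (beta0 : R) T :=
  forall k, k \in T -> beta0 * hmesh T <= diam (cell k).

Definition polyhedron (D : set pt) := exists s : seq simplex,
  (forall k, k \in s -> nondegenerate_simplex k) /\
  closure D = [set x | exists2 k, k \in s & cell k x].

Definition P1_on k (q : pt -> R) :=
  exists (a : R) (w : pt), forall x, cell k x -> q x = a + dotv w x.

Definition P1b_on k (q : pt -> R) := exists (a : R) (w : pt) (c : R),
  forall x, cell k x -> q x = a + dotv w x + c * bubble k x.

Definition spXh (D : set pt) T (v : pt -> pt) :=
  {within closure D, continuous v} /\
  forall k, k \in T -> forall i, P1b_on k (component v i).

Definition P1h (D : set pt) T (q : pt -> R) :=
  {within closure D, continuous q} /\ forall k, k \in T -> P1_on k q.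

Definition spMh D T q := P1h D T q /\ L20 D q.
Definition spYh D T q := P1h D T q /\ H10 D q.

Definition piecewise_cst T (q : pt -> R) :=
  forall k, k \in T -> exists c, forall x, (cell k)° x -> q x = c.

(* unit normal to the j-th facet, outward to [k]: the gradient of the j-th
   barycentric coordinate, reversed and normalized *)
Definition unit_normal k j : pt :=
  let grd : pt := \row_i invmx (homog k) (lift ord0 i) j in
  - (norm2 grd)^-1 *: grd.

Definition facet_trace k (F : pt -> R) (x : pt) : R :=
  lim (F y @[y --> within (cell k)° (nbhs x)]).

Definition on_bdry (D : set pt) k j := `[< facet k j `<=` bdry D >].

(* jump across the j-th facet of [k] when it is not on the boundary; the sum
   then consists of exactly one term, for the neighbour of [k] *)
Definition jump T k j (F : pt -> R) (x : pt) : R :=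
  facet_trace k F x -
  \sum_(k' <- T | (k' != k) && `[< facet k j `<=` cell k' >]) facet_trace k' F x.

Definition facet_vertex k j (l : 'I_n.+1) : pt := row (lift j l) k.

Definition facet_edges k j : 'M[R]_(n, n.+1) :=
  \matrix_(l < n, i < n.+1)
    (facet_vertex k j (lift ord0 l) ord0 i - facet_vertex k j ord0 ord0 i).

Definition facet_param k j (t : 'rV[R]_n) : pt :=
  facet_vertex k j ord0 + t *m facet_edges k j.

Definition ref_simplex : set 'rV[R]_n :=
  [set t | (forall l, 0 <= t ord0 l) /\ \sum_l t ord0 l <= 1].

(* surface element of the affine parametrization: square root of the Gram
   determinant *)
Definition facet_jac k j : R :=
  Num.sqrt (\det (facet_edges k j *m (facet_edges k j)^T)).

Definition Lp_facet (p : R) k j (F : pt -> R) : \bar R :=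
  (((facet_jac k j)%:E *
    \int[leb R n]_(t in ref_simplex)
      (`|F (facet_param k j t)| `^ p)%:E) `^ p^-1)%E.

Definition mean_on k (v : pt -> pt) : pt :=
  (fine (vol (cell k)))^-1 *: \row_i \int[vol]_(x in cell k) component v i x.

End meshes.
Arguments simplex : clear implicits.
Arguments mesh : clear implicits.

Record problem (R : realType) (n : nat) := Problem {
  Omega : set 'rV[R]_n.+1;
  mu : R;
  rho : R;
  beta : R;
  alpha : R;
  r0 : R;
  Kperm : 'rV[R]_n.+1 -> 'M[R]_n.+1;
  Km : R;
  KM : R;
  f0 : 'rV[R]_n.+1 -> 'rV[R]_n.+1;
  f1 : R -> 'rV[R]_n.+1;
  cf1 : R;
  g : 'rV[R]_n.+1 -> R
}.

Section problem.
Context {R : realType} {n : nat} (P : problem R n).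
Local Notation pt := 'rV[R]_n.+1.
Local Notation vol := (leb R n.+1).
Local Notation D := (Omega P).
Local Notation d := (n.+1%:R : R).
Implicit Types (u v : pt -> pt) (p q C S : pt -> R) (T : mesh R n) (h : R).

Definition fC C : pt -> pt := fun x => f0 P x + f1 P (C x).

Definition Kinv : pt -> 'M[R]_n.+1 := fun x => invmx (Kperm P x).

Definition domain_ok :=
  [/\ D !=set0, open D /\ bounded_set D, polyhedron D,
      lipschitz_boundary D & simply_connected D].

Definition constants_ok :=
  [/\ 0 < mu P, 0 < rho P, 0 < beta P, 0 < alpha P & 0 < r0 P].

Definition tensor_ok :=
  [/\ forall i j, measurable_fun D (fun x => Kperm P x i j),
      exists2 k0 : R, 0 < k0 & {ae vol, forall x, D x ->
        (Kperm P x)^T = Kperm P x /\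
        forall w : pt, k0 * norm2 w ^+ 2 <= dotv (app_mx (Kperm P x) w) w},
      exists k1 : R, {ae vol, forall x, D x ->
        forall i j, `|Kperm P x i j| <= k1},
      0 < Km P /\ ((Km P)%:E <= Lp +oo D (opnorm \o Kinv) <= (KM P)%:E)%E &
      {ae vol, forall x, D x ->
        forall a : R, eigenvalue (Kinv x) a -> Km P <= a}].

Definition data_ok :=
  [/\ inLpV (3 / 2)%:E D (f0 P), 0 < cf1 P, f1 P 0 = 0,
      forall a b : R, norm2 (f1 P a - f1 P b) <= cf1 P * `|a - b| &
      inLp 2%:E D (g P)].

Definition standing_assumptions :=
  [/\ domain_ok, constants_ok, tensor_ok & data_ok].

Definition solves_Va u p C :=
  [/\ spX D u, spM D p, spY D C &
   forall v q S, spX D v -> spM D q -> spY D S ->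
   [/\ mu P / rho P * l2V D (fun x => app_mx (Kinv x) (u x)) v
       + beta P / rho P * l2V D (fun x => norm2 (u x) *: u x) v
       + l2V D (wgrad D p) v = l2V D (fC C) v,
       l2V D (wgrad D q) u = 0 &
       alpha P * l2V D (wgrad D C) (wgrad D S)
       + l2 D (fun x => dotv (u x) (wgrad D C x)) S
       + r0 P * l2 D C S = l2 D (g P) S]].

Definition conc_h u C S : R :=
  alpha P * l2V D (wgrad D C) (wgrad D S)
  + l2 D (fun x => dotv (u x) (wgrad D C x)) S
  + 2^-1 * l2 D (fun x => wdiv D u x * C x) S
  + r0 P * l2 D C S.

Definition solves_Vah T u p C :=
  [/\ spXh D T u, spMh D T p, spYh D T C &
   forall v q S, spXh D T v -> spMh D T q -> spYh D T S ->
   [/\ mu P / rho P * l2V D (fun x => app_mx (Kinv x) (u x)) v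
       + beta P / rho P * l2V D (fun x => norm2 (u x) *: u x) v
       + l2V D (wgrad D p) v = l2V D (fC C) v,
       l2V D (wgrad D q) u = 0 &
       conc_h u C S = l2 D (g P) S]].

(* (u, p, C) is the iterate following (u0, C0) *)
Definition solves_Vahi T (gamma : R) u0 C0 u p C :=
  [/\ spXh D T u, spMh D T p, spYh D T C &
   forall v q S, spXh D T v -> spMh D T q -> spYh D T S ->
   [/\ gamma * l2V D (fun x => u x - u0 x) v
       + mu P / rho P * l2V D (fun x => app_mx (Kinv x) (u x)) v
       + beta P / rho P * l2V D (fun x => norm2 (u0 x) *: u x) v
       + l2V D (wgrad D p) v = l2V D (fC C0) v,
       l2V D (wgrad D q) u = 0 &
       conc_h u C S = l2 D (g P) S]].

Definition iterates T (gamma : R) (us : nat -> pt -> pt)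
    (ps Cs : nat -> pt -> R) :=
  [/\ spXh D T (us 0%N), spYh D T (Cs 0%N) &
   forall i, solves_Vahi T gamma (us i) (Cs i) (us i.+1) (ps i.+1) (Cs i.+1)].

Definition sobolev_cst (s S : R) := 0 < S /\
  forall q, H10 D q -> (Lp s%:E D q <= S%:E * LpV 2%:E D (wgrad D q))%E.

(* scalar discrete functions are covered, as vector fields with one nonzero
   component *)
Definition inverse_cst (fam : set (mesh R n)) (cI : R) := 0 < cI /\
  forall T v (s : R), fam T -> spXh D T v -> s = 3 \/ s = 6 ->
    (LpV s%:E D v <= (cI * hmesh T `^ (d / s - d / 2))%:E * LpV 2%:E D v)%E.

Definition apriori_cst (fam : set (mesh R n)) u p C (c1 : R) := 0 < c1 /\
  forall T uh ph Ch, fam T -> solves_Vah T uh ph Ch ->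
    (LpV 2%:E D (wgrad D (C \- Ch)%R)
     + LpV 2%:E D (fun x => u x - uh x)%R
     + LpV (3 / 2)%:E D (wgrad D (p \- ph)%R) <= (c1 * hmesh T)%:E)%E.

Definition Fcst (S2 : R) : R := fine (LpV 2%:E D (f0 P))
  + cf1 P * (S2 ^+ 2 / alpha P) * fine (Lp 2%:E D (g P)).

Definition L1cst (S2 : R) : R := rho P / (mu P * Km P) * Fcst S2.

Definition gamma_star (cI S2 h : R) : R :=
  32 * beta P / (27 * rho P) * cI ^+ 3 * h `^ (- d / 2)
    * (rho P / (mu P * Km P) + rho P * KM P / (mu P * Km P ^+ 2)) * Fcst S2
  + 32 * beta P ^+ 2 * rho P / (27 * mu P ^+ 3 * Km P ^+ 3)
    * cI ^+ 6 * h `^ (- d) * Fcst S2 ^+ 2.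

Definition gamma_sstar (cI S2 h : R) : R :=
  2 * cI ^+ 4 * h `^ (- (2 * d / 3))
    * (rho P `^ (1 / 3) * beta P `^ (4 / 3)
       / (mu P `^ (5 / 3) * Km P `^ (5 / 3)))
    * Fcst S2 `^ (4 / 3).

(* In the indicators, [u0], [C0] stand for the iterates of rank i and [u], [p],
   [C] for those of rank i+1. Element norms are taken on the interior of the
   simplex, where discrete functions are smooth. *)

Definition eta_L1 (k : simplex R n) u0 u : \bar R :=
  LpV 2%:E (cell k)° (fun x => u x - u0 x).

Definition eta_L2 (k : simplex R n) C0 C : \bar R := H1norm (cell k)° (C0 \- C).

Definition eta_D1 T (gh : pt -> R) (k : simplex R n) u C : \bar R :=
  ((diam (cell k))%:E *
     Lp 2%:E (cell k)° (fun x =>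
       alpha P * clap C x - dotv (u x) (cgrad C x) - 2^-1 * cdiv u x * C x
       - r0 P * C x + gh x)%R
   + (2^-1)%:E * \sum_(j < n.+2 | ~~ on_bdry D k j)
       (diam (facet k j) `^ (1 / 2))%:E *
       Lp_facet 2 k j (fun x =>
         alpha P * jump T k j (fun y => dotv (cgrad C y) (unit_normal k j)) x)%R)%E.

Definition eta_D2 (gamma : R) (k : simplex R n) u0 C0 u p : \bar R :=
  LpV 2%:E (cell k)° (fun x =>
    - cgrad p x - gamma *: (u x - u0 x)
    - (mu P / rho P) *: app_mx (Kinv x) (u x)
    - (beta P / rho P * norm2 (u0 x)) *: u x
    + mean_on k (fC C0)).

Definition phi_h1 T u (k : simplex R n) (j : 'I_n.+2) : pt -> R :=
  let un y := dotv (u y) (unit_normal k j) in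
  if on_bdry D k j then facet_trace k un else fun x => 2^-1 * jump T k j un x.

Definition eta_D3 T (k : simplex R n) u : \bar R :=
  ((diam (cell k))%:E * Lp 3%:E (cell k)° (cdiv u)
   + \sum_(j < n.+2) (diam (facet k j) `^ (1 / 3))%:E *
       Lp_facet 3 k j (phi_h1 T u k j))%E.

End problem.

(* Main.v *)
(** The left-hand side is at most [(c1 + 1) h] for large [i], by the a priori
    estimate and the convergence of the iterates on the fixed mesh. The
    right-hand side is at least a constant times [h]: on each cell the volume
    part of [eta_D1] and [h_k |g - g_h|] together dominate [h_k |r|], where
    [r = g - u.grad C - (div u) C / 2 - r0 C] for the current iterate, and
    [h_k >= beta0 h]. Testing the discrete concentration equation against a
    fixed test function [phi] bounds [|r|] from below by a multiple of
    [|(g, phi)|], since the velocities are bounded uniformly in [h] and [i].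
    If [(g, phi) = 0] for every [phi], then [g = 0], so [C = 0], and the
    condition on the mesh size forces [h <= 0], which is absurd.

    The convergence of the iterates is a contraction argument in [L^2]. The
    inverse inequality and the condition on [gamma] absorb the explicit
    Forchheimer term, and the smallness of [C], together with the a priori
    estimate [|C - C_h| <= c1 h] and the condition on [h], controls the coupling
    through the concentration. *)
Require Import Defs.
From mathcomp Require Import all_boot all_order all_algebra.
From mathcomp Require Import all_classical all_reals all_analysis.
From mathcomp Require Import measurable_realfun ess_sup_inf.
From mathcomp Require Import ring lra.
Set Implicit Arguments.
Unset Strict Implicit.
Unset Printing Implicit Defensive.
Import Order.TTheory GRing.Theory Num.Theory.
Import numFieldNormedType.Exports.
Local Open Scope classical_set_scope.
Local Open Scope ring_scope.

(** * Lebesgue measure on row vectors *)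

(** Independence of the mesh is decided by the order of the choices. The test function [phi], and
    with it the pairing of [g] with [phi] and the constant of [residual_test], are fixed before the
    mesh, and the velocity bound entering there, 8/7 of [L1cst], contains neither [h] nor [gamma].
    What depends on the mesh, such as the contraction factor or the passage from the momentum
    residual to the discrete pressure gradient, influences only the rank from which the estimate
    holds.

    The discrete pressure gradient is constant on each cell, so it is recovered on a fixed mesh by
    testing with a bubble times a constant vector.

    The technical obstacle is that the discrete equations contain weak derivatives, which are chosen
    representatives, whereas the indicators contain classical derivatives inside the cells. Weak
    differentiability of continuous piecewise polynomials therefore has to be established. It comes
    from a Lipschitz bound along coordinate lines and from dominated convergence of difference
    quotients, translation invariance of the measure playing the role of integration by parts. *)

Section measure_preserving.
Context {R : realType}.
Local Open Scope ereal_scope.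

(** The image of the product measure under the product map agrees with it on rectangles, and these
    determine a product of sigma-finite measures. *)
Lemma product_measure_preserving d1 d2 (T1 : measurableType d1)
    (T2 : measurableType d2)
    (m1 : {sigma_finite_measure set T1 -> \bar R})
    (m2 : {sigma_finite_measure set T2 -> \bar R})
    (f1 : T1 -> T1) (f2 : T2 -> T2) :
  measurable_fun setT f1 -> measurable_fun setT f2 ->
  (forall A, measurable A -> m1 (f1 @^-1` A) = m1 A) ->
  (forall A, measurable A -> m2 (f2 @^-1` A) = m2 A) ->
  forall A, measurable A ->
  (m1 \x m2) ((fun z => (f1 z.1, f2 z.2)) @^-1` A) = (m1 \x m2) A.
Proof.
move=> mf1 mf2 f1P f2P A mA; set f := (fun z => _).
have mf : measurable_fun [set: T1 * T2] f.
  apply: measurable_fun_pair => /=.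
    exact: measurableT_comp mf1 measurable_fst.
  exact: measurableT_comp mf2 measurable_snd.
pose M := measure_function_pushforward__canonical__measure_function_Measure
  (m1 \x m2)%E mf.
transitivity (M A) => //; apply/esym/product_measure_unique => // X Y mX mY.
rewrite /M /= /pushforward (_ : f @^-1` _ = (f1 @^-1` X) `*` (f2 @^-1` Y)) //.
have mX' : measurable (f1 @^-1` X) by rewrite -[X in measurable X]setTI; exact: mf1.
have mY' : measurable (f2 @^-1` Y) by rewrite -[X in measurable X]setTI; exact: mf2.
by rewrite product_measure1E //; congr (_ * _)%E; [exact: f1P|exact: f2P].
Qed.

(** Checked on half-open intervals, which determine Lebesgue measure. *)
Lemma lebesgue_measure_shift (t : R) (A : set (measurableTypeR R)) :
  measurable A -> lebesgue_measure ((fun x : measurableTypeR R => x + t)%R @^-1` A)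
                  = lebesgue_measure A.
Proof.
move=> mA.
have mf : measurable_fun [set: measurableTypeR R] (fun x : measurableTypeR R => x + t : measurableTypeR R)%R.
  by apply: measurable_funD => //.
pose M := measure_function_pushforward__canonical__measure_function_Measure
  (@lebesgue_measure R) mf.
transitivity (M A) => //; apply/esym/lebesgue_measure_unique => // X [[a b] _ <-] /=.
rewrite /pushforward (_ : _ @^-1` _ = ([set` `]a - t, b - t]%R]%classic : set R)); last first.
  by apply/seteqP; split => x /=; rewrite !in_itv /= => /andP[? ?]; apply/andP; split; lra.
rewrite !lebesgue_measure_itv /= !lte_fin; case: ltP => h; case: ltP => h' //; try by exfalso; lra.
by rewrite -!EFinB; congr EFin; ring.
Qed.

End measure_preserving.

Section rV_measure.
Context {R : realType}.

Definition shift_rV n (i : 'I_n) (t : R) (v : 'rV[R]_n) : 'rV[R]_n :=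
  v + t *: delta_mx ord0 i.

Lemma measurable_shift_rV n (i : 'I_n) t : measurable_fun setT (shift_rV i t).
Proof.
apply: measurable_fun_rV => j.
under eq_fun do rewrite !mxE.
by apply: measurable_funD => //; exact: measurable_coord.
Qed.

Lemma lebS n (A : set 'rV[R]_n.+1) :
  leb R n.+1 A = (lebesgue_measure \x leb R n)%E (@cons_rV R n @^-1` A).
Proof. by []. Qed.

Lemma measurable_cons_preimage n (A : set 'rV[R]_n.+1) : measurable A ->
  measurable (@cons_rV R n @^-1` A).
Proof. by move=> mA; rewrite -[X in measurable X]setTI; exact: measurable_cons_rV. Qed.

(** Induction along the recursive definition of [leb]: a shift in a coordinate direction moves
    either the real factor or the remaining coordinates, never both. *)
Lemma leb_shift n (i : 'I_n) t (A : set 'rV[R]_n) : measurable A ->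
  leb R n (shift_rV i t @^-1` A) = leb R n A.
Proof.
elim: n i A => [[]//|n IHn] i A mA; rewrite !lebS.
have mB := measurable_cons_preimage mA.
case: (unliftP ord0 i) => [j|] ->.
  rewrite -(@product_measure_preserving _ _ _ _ _ lebesgue_measure (leb R n) id (shift_rV j t) _ _ _ _ _ mB) //.
  - congr (_ _); apply/seteqP; split=> -[x v] /=.
      suff -> : shift_rV (lift ord0 j) t (cons_rV (x, v)) = cons_rV (x, shift_rV j t v) by [].
      apply/rowP => k; rewrite !mxE; case: (unliftP ord0 k) => [l|] -> /=.
        by rewrite ?liftK ?unlift_none /= !mxE (inj_eq lift_inj).
      by rewrite ?liftK ?unlift_none /= ?(negbTE (neq_lift _ _)) ?andbF ?mulr0 ?addr0.
    suff -> : shift_rV (lift ord0 j) t (cons_rV (x, v)) = cons_rV (x, shift_rV j t v) by [].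
    apply/rowP => k; rewrite !mxE; case: (unliftP ord0 k) => [l|] -> /=.
      by rewrite ?liftK ?unlift_none /= !mxE (inj_eq lift_inj).
    by rewrite ?liftK ?unlift_none /= ?(negbTE (neq_lift _ _)) ?andbF ?mulr0 ?addr0.
  - exact: measurable_shift_rV.
  - by move=> B mB'; exact: IHn.
have E x v : shift_rV ord0 t (cons_rV (x, v)) = cons_rV (x + t, v) :> 'rV[R]_n.+1.
  apply/rowP => k; rewrite !mxE; case: (unliftP ord0 k) => [l|] -> /=.
    by rewrite ?liftK ?unlift_none /= ?(eq_sym _ ord0) ?(negbTE (neq_lift _ _)) ?andbF ?mulr0 ?addr0.
  by rewrite ?liftK ?unlift_none /= ?eqxx ?mulr1.
rewrite -(@product_measure_preserving _ _ _ _ _ lebesgue_measure (leb R n) (fun x : measurableTypeR R => x + t : measurableTypeR R) id _ _ _ _ _ mB) //.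
- by congr (_ _); apply/seteqP; split=> -[x v] /=; rewrite E.
- by apply: measurable_funD.
- by move=> B; exact: lebesgue_measure_shift.
Qed.

Lemma integrable_shift n (i : 'I_n) t (f : 'rV[R]_n -> R) :
  (leb R n).-integrable setT (EFin \o f) ->
  (leb R n).-integrable setT (EFin \o (f \o shift_rV i t)).
Proof.
move=> fi; have mf := measurable_int _ fi.
have ms := measurable_shift_rV i t.
pose M := measure_function_pushforward__canonical__measure_function_Measure
  (leb R n) ms.
apply/integrableP; split; first exact: measurableT_comp mf ms.
have /integrableP[_] := fi.
suff <- : (\int[M]_x `|(f x)%:E| = \int[leb R n]_x `|(f x)%:E|)%E.
  by rewrite /M /= ge0_integral_pushforward ?preimage_setT //=;
    apply/measurable_EFinP; apply: measurableT_comp => //; exact/measurable_EFinP.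
by apply: eq_measure_integral => A mA _; rewrite /M /= /pushforward leb_shift.
Qed.

(** This moves a difference quotient from one factor of a product to the other, the discrete form of
    integration by parts. *)
Lemma integral_shift n (i : 'I_n) t (f : 'rV[R]_n -> R) :
  (leb R n).-integrable setT (EFin \o f) ->
  (\int[leb R n]_x (f (shift_rV i t x))%:E = \int[leb R n]_x (f x)%:E)%E.
Proof.
move=> fi; have mf := measurable_int _ fi.
have ms := measurable_shift_rV i t.
pose M := measure_function_pushforward__canonical__measure_function_Measure
  (leb R n) ms.
have EM : (\int[M]_x (f x)%:E = \int[leb R n]_x (f x)%:E)%E.
  by apply: eq_measure_integral => A mA _; rewrite /M /= /pushforward leb_shift.
by rewrite -EM /M /= integral_pushforward//=; exact: integrable_shift.
Qed.

End rV_measure.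

(** * Boxes and Borel sets *)

Section boxes.
Context {R : realType}.

Definition box n (c d : 'rV[R]_n) : set 'rV[R]_n :=
  [set x | forall i, c ord0 i < x ord0 i < d ord0 i].

Lemma measurable_coord_lt n (i : 'I_n) (a b : R) :
  measurable [set x : 'rV[R]_n | a < x ord0 i < b].
Proof.
have := @measurable_coord R n i measurableT `]a, b[%classic.
rewrite setTI; apply.
exact: measurable_itv.
Qed.

Lemma measurable_box n (c d : 'rV[R]_n) : measurable (box c d).
Proof.
rewrite (_ : box c d = \bigcap_(i : 'I_n) [set x | c ord0 i < x ord0 i < d ord0 i]).
  by apply: fin_bigcap_measurable => // i _; exact: measurable_coord_lt.
by apply/seteqP; split => x /= h; [move=> i _ /=; exact: h|move=> i; exact: (h i)].
Qed.

Lemma leb_box n (c d : 'rV[R]_n) : (forall i, c ord0 i < d ord0 i) ->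
  leb R n (box c d) = (\prod_i (d ord0 i - c ord0 i))%:E.
Proof.
elim: n c d => [|n IHn] c d cd.
  rewrite big_ord0 /= diracE mem_set // => i; by case: i.
rewrite lebS big_ord_recl.
rewrite (_ : _ @^-1` _ = `]c ord0 ord0, d ord0 ord0[%classic `*`
    box (\row_i c ord0 (lift ord0 i)) (\row_i d ord0 (lift ord0 i))).
  rewrite product_measure1E //; last exact: measurable_box.
  have E : lebesgue_measure (`]c ord0 ord0, d ord0 ord0[%classic : set R) =
    (d ord0 ord0 - c ord0 ord0)%:E.
    by rewrite lebesgue_measure_itv /= lte_fin cd -EFinB.
  have := IHn (\row_i c ord0 (lift ord0 i)) (\row_i d ord0 (lift ord0 i)).
  have -> : \prod_i ((\row_i d ord0 (lift ord0 i)) ord0 i - (\row_i c ord0 (lift ord0 i)) ord0 i) =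
     \prod_i (d ord0 (lift ord0 i) - c ord0 (lift ord0 i)).
     by apply: eq_bigr => i _; rewrite !mxE.
  move=> E2; rewrite EFinM -[in RHS]E -E2 // => i; rewrite !mxE; exact: cd.
apply/seteqP; split => -[x v] /=.
  move=> h; split => /=; first by have := h ord0; rewrite mxE unlift_none /= in_itv.
  by move=> i; have := h (lift ord0 i); rewrite !mxE liftK.
move=> [/=]; rewrite in_itv /= => h1 h2 i.
rewrite mxE; case: (unliftP ord0 i) => [j|] -> /=; last exact: h1.
by have := h2 j; rewrite !mxE.
Qed.

Lemma rV_ballE n (x y : 'rV[R]_n) (e : R) : 0 < e ->
  ball x e y <-> (forall i, `|x ord0 i - y ord0 i| < e).
Proof.
move=> e0; split => [[_ h] i|h].
  by have := h ord0 i.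
split => // i j; rewrite (ord1 i); exact: h.
Qed.

Lemma nbhs_rV n (x : 'rV[R]_n) (A : set 'rV[R]_n) : nbhs x A ->
  exists2 e : R, 0 < e & forall y : 'rV[R]_n, (forall i, `|x ord0 i - y ord0 i| < e) -> A y.
Proof.
rewrite -nbhs_ballE => -[e /= e0 h]; exists e => // y hy.
by apply: h; apply/rV_ballE.
Qed.

Definition cbox n (a b : 'rV[R]_n) : set 'rV[R]_n :=
  [set x | forall i, a ord0 i <= x ord0 i <= b ord0 i].

Lemma box_cbox n (a b : 'rV[R]_n) : box a b `<=` cbox a b.
Proof. by move=> x h i; have /andP[/ltW -> /ltW ->] := h i. Qed.

(** Rational corners make the boxes countable. The closed box is kept inside [A] so that it can
    serve as a compact subset or contain the support of a test function. *)
Lemma box_nbhs n (A : set 'rV[R]_n) x : nbhs x A -> exists c d : 'rV[rat]_n,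
  box (map_mx ratr c) (map_mx ratr d) x /\
  cbox (map_mx ratr c) (map_mx ratr d) `<=` A.
Proof.
move=> /nbhs_rV[e e0 hA].
have hc i : exists q : rat, x ord0 i - e < ratr q < x ord0 i.
  have /rat_in_itvoo[q] : x ord0 i - e < x ord0 i by lra.
  by rewrite in_itv /= => ?; exists q.
have hd i : exists q : rat, x ord0 i < ratr q < x ord0 i + e.
  have /rat_in_itvoo[q] : x ord0 i < x ord0 i + e by lra.
  by rewrite in_itv /= => ?; exists q.
exists (\row_i sval (cid (hc i))), (\row_i sval (cid (hd i))); split.
  move=> i; rewrite !mxE; case: cid => q /= /andP[_ ->] /=.
  by case: cid => q' /= /andP[-> _].
move=> y hy; apply: hA => i; have := hy i; rewrite !mxE.
case: cid => q /= /andP[q1 q2]; case: cid => q' /= /andP[q1' q2'] /andP[y1 y2].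
by rewrite ltr_norml; apply/andP; split; lra.
Qed.

(** The sigma-algebra is generated by the coordinates, not by the topology; an open set belongs to
    it as a countable union of rational boxes. *)
Lemma open_measurable_rV n (A : set 'rV[R]_n) : open A -> measurable A.
Proof.
move=> oA.
pose F (cd : 'rV[rat]_n * 'rV[rat]_n) : set 'rV[R]_n :=
  if `[< box (map_mx ratr cd.1) (map_mx ratr cd.2) `<=` A >]
  then box (map_mx ratr cd.1) (map_mx ratr cd.2) else set0.
rewrite (_ : A = \bigcup_cd F cd).
  apply: countable_bigcupT_measurable => // cd; rewrite /F.
  by case: ifP => // _; exact: measurable_box.
apply/seteqP; split=> x.
  move=> Ax; have /box_nbhs[c [d [h1 h2]]] : nbhs x A by apply: open_nbhs_nbhs.
  exists (c, d) => //; rewrite /F /=; case: asboolP => // h; exfalso; apply: h.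
  by apply: subset_trans h2; exact: box_cbox.
move=> [[c d] _]; rewrite /F /=; case: asboolP => // h /h; done.
Qed.

Lemma closed_measurable_rV n (A : set 'rV[R]_n) : closed A -> measurable A.
Proof.
move=> cA; rewrite -[A]setCK; apply: measurableC.
by apply: open_measurable_rV; exact: closed_openC.
Qed.

Lemma compact_measurable_rV n (A : set 'rV[R]_n) : compact A -> measurable A.
Proof. by move=> cA; apply: closed_measurable_rV; exact: compact_closed. Qed.

Lemma continuous_measurable_rV n (A : set 'rV[R]_n) (f : 'rV[R]_n -> R) :
  measurable A -> {within A, continuous f} -> measurable_fun A f.
Proof.
move=> mA cf; apply: (measurability _ (RGenOInfty.measurableE R)) => //.
move=> _ [_ [a ->] <-].
have /continuousP/(_ `]a, +oo[%classic) /= := cf.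
have oa : open (`]a, +oo[%classic : set R) by exact: itv_open_ends_open.
move=> h; have /open_subspaceP[U oU] := h oa.
move=> UE; rewrite (_ : _ `&` _ = U `&` A); last by rewrite UE setIC.
by apply: measurableI => //; exact: open_measurable_rV.
Qed.

(** Boxes are stable under intersection, so they are the starting class of the Dynkin argument in
    [ae_eq0_test]. *)
Lemma measurable_box_generated n (A : set 'rV[R]_n) : measurable A ->
  <<s [set B | exists c d, B = box c d] >> A.
Proof.
set G := [set B | _].
have H (i : 'I_n) (B : set R) : measurable B ->
    <<s G >> ((fun x : 'rV[R]_n => x ord0 i) @^-1` B).
  pose T : measurableType _ := g_sigma_algebraType G.
  suff /(_ measurableT B) : measurable_fun [set: T] (fun x : 'rV[R]_n => x ord0 i).
    by rewrite setTI.
  apply: (measurability _ (RGenOInfty.measurableE R)) => //.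
  move=> _ [_ [a ->] <-]; rewrite setTI.
  (* An open half-space is the union of boxes with one fixed lower bound [a], all other bounds
     growing with [k]. *)
  rewrite (_ : _ @^-1` _ = \bigcup_k box (\row_j if j == i then a else - k%:R) (const_mx k%:R)).
    apply: (@bigcupT_measurable _ T) => k; apply: sub_sigma_algebra.
    by exists (\row_j if j == i then a else - k%:R), (const_mx k%:R).
  apply/seteqP; split => x /=; rewrite in_itv /= andbT; last first.
    by move=> [k _] /(_ i); rewrite mxE eqxx => /andP[].
  move=> ax; have [N hN] : exists N : nat, forall j, `|x ord0 j| < N%:R.
    exists (\max_j (Num.truncn `|x ord0 j|).+1)%N => j.
    have := truncnS_gt `|x ord0 j|; move/lt_le_trans; apply.
    by rewrite ler_nat (leq_bigmax j).
  exists N => // j; rewrite !mxE; have := hN j; rewrite ltr_norml => /andP[h1 h2].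
  by case: eqP => [->|_]; rewrite ?h1 ?h2 ?ax //; have := hN i; rewrite ltr_norml => /andP[].
apply: smallest_sub; first exact: smallest_sigma_algebra.
by rewrite -bigcup_seq => B [i _ [C mC <-]]; rewrite setTI; exact: H.
Qed.

End boxes.

(** * Hyperplanes and bounded sets *)

Section hyperplanes.
Context {R : realType}.

Lemma measurable_dotv n (w : 'rV[R]_n) : measurable_fun setT (dotv w).
Proof.
apply: measurable_sum => i.
by apply: measurable_funM => //; exact: measurable_coord.
Qed.

Lemma measurable_hyperplane n (a : R) (w : 'rV[R]_n) :
  measurable [set x | a + dotv w x = 0].
Proof.
have := @measurable_funD _ _ R _ (cst a) _ (measurable_cst _) (measurable_dotv w) measurableT [set 0].
by rewrite setTI; apply; exact: measurable_set1.
Qed.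

(** Slicing along the first coordinate: if [w] has another nonzero component, every slice is a null
    hyperplane by induction; otherwise the set is one point times the whole remaining space. *)
Lemma hyperplane_null n (a : R) (w : 'rV[R]_n) : w != 0 ->
  leb R n [set x | a + dotv w x = 0] = 0%E.
Proof.
elim: n a w => [|n IHn] a w w0.
  by move/eqP: w0; case; apply/rowP => -[].
have E x v : dotv w (cons_rV (x, v)) = w ord0 ord0 * x + dotv (\row_i w ord0 (lift ord0 i)) v.
  rewrite /dotv big_ord_recl; congr (_ + _); first by rewrite mxE unlift_none.
  by apply: eq_bigr => i _; rewrite !mxE liftK.
rewrite lebS; set w' := (\row_i _) in E.
have [w'0|w'0] := eqVneq w' 0; last first.
  rewrite /product_measure1; apply: integral0_eq => x _ /=.
  rewrite -(IHn (a + w ord0 ord0 * x) w' w'0); congr (leb R n _).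
  by apply/seteqP; split => v; rewrite /xsection /= ?inE /= E addrA.
have w00 : w ord0 ord0 != 0.
  apply: contraNneq w0 => w00; apply/eqP/rowP => i; rewrite mxE.
  case: (unliftP ord0 i) => [j|] -> //.
  by have /rowP/(_ j) := w'0; rewrite !mxE.
rewrite (_ : _ @^-1` _ = [set - a / w ord0 ord0] `*` setT).
  rewrite product_measure1E //; set z := - a / _.
  (* The second factor may have infinite measure; the product is 0 all the same by the convention on
     extended reals. *)
  by transitivity (0 * leb R n setT)%E; [congr (_ * _)%E; exact: lebesgue_measure_set1|rewrite mul0e].
apply/seteqP; split => -[x v] /=; rewrite E w'0 /dotv big1 ?addr0; try by move=> i _; rewrite mxE mul0r.
  by move=> h; split => //; apply: (mulfI w00); rewrite mulrCA divff// mulr1; lra.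
by move=> [-> _]; rewrite mulrCA divff // mulr1; lra.
Qed.

Lemma bounded_box n (A : set 'rV[R]_n) : bounded_set A ->
  exists2 M : R, 0 < M & A `<=` box (const_mx (- M)) (const_mx M).
Proof.
move=> [M0 [_ hM]]; pose M := Num.max M0 0 + 1.
have M1 : 0 < M by rewrite ltr_wpDl // le_max lexx orbT.
have M2 : M0 < M by rewrite ltr_pwDr // le_max lexx.
exists (M + 1) => [|x Ax i]; first by rewrite addr_gt0.
have h := hM _ M2 _ Ax; have {}h : `|x| < M + 1 by rewrite (le_lt_trans h) // ltrDl.
have : ball (0 : 'rV[R]_n) (M + 1) x by rewrite mx_norm_ball /ball_ /= sub0r normrN.
move=> /rV_ballE; rewrite addr_gt0 // => /(_ isT) /(_ i).
by rewrite !mxE sub0r normrN ltr_norml.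
Qed.

Lemma bounded_leb_fin n (A : set 'rV[R]_n) : measurable A -> bounded_set A ->
  (leb R n A < +oo)%E.
Proof.
move=> mA /bounded_box[M M0 AM].
apply: (@le_lt_trans _ _ (leb R n (box (const_mx (- M)) (const_mx M)))).
  by apply: le_measure; rewrite ?inE //; exact: measurable_box.
by rewrite leb_box ?ltry // => i; rewrite !mxE; lra.
Qed.

Lemma integrable_cst_fin n (A : set 'rV[R]_n) (c : R) : measurable A ->
  (leb R n A < +oo)%E -> (leb R n).-integrable A (fun=> c%:E).
Proof.
move=> mA fA; apply/integrableP; split; first exact: measurable_cst.
by rewrite /= integral_cst // lte_mul_pinfty.
Qed.

End hyperplanes.

(** * Test functions *)

Section flat_function.
Context {R : realType}.
Implicit Types (c t : R) (m : nat).

Lemma is_derive_cvg (V W : normedModType R) (f : V -> W) (x v : V) (l : W) :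
  (fun h : R => h^-1 *: ((f \o shift x) (h *: v) - f x)) @ 0^' --> l ->
  is_derive x v f l.
Proof. by move=> h; apply: DeriveDef; [exact: cvgP h|exact: cvg_lim h]. Qed.

Lemma is_derive_affine (a b t : R) : is_derive t 1 (fun s : R => a + b * s) b.
Proof.
apply: is_derive_cvg; apply: cvg_near_cst; near=> h.
have h0 : h != 0 by near: h; exact: nbhs_dnbhs_neq.
by rewrite /= /GRing.scale /= mulr1; field.
Unshelve. all: by end_near. Qed.

(** For positive t this is t^-m exp(-c/t). The family is closed under differentiation up to linear
    combinations, which yields smoothness by induction; the parameter [c] is there to be sent to
    0. *)
Definition flat c m t : R :=
  if 0 < t then expR (- c * t^-1 - m%:R * ln t) else 0.

Lemma flat_ge0 c m t : 0 <= flat c m t.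
Proof. by rewrite /flat; case: ifP => // _; exact: expR_ge0. Qed.

Lemma flatN c m t : t <= 0 -> flat c m t = 0.
Proof. by rewrite /flat leNgt => /negbTE ->. Qed.

Lemma flat_pos c m t : 0 < t -> flat c m t = t^-1 ^+ m * (expR (c / t))^-1.
Proof.
move=> t0; rewrite /flat t0 expRD mulrC; congr (_ * _).
  by rewrite expRN expRM_natl lnK // exprVn.
by rewrite mulNr expRN.
Qed.

Lemma flat_le1 c t : 0 < c -> flat c 0 t <= 1.
Proof.
move=> c0; have [t0|t0] := ltP 0 t; last by rewrite flatN.
by rewrite flat_pos // expr0 mul1r invf_le1 ?expR_gt0// -expR0 ler_expR divr_ge0 // ltW.
Qed.

(** The term of degree m+2 in the series of exp(c/t) beats t^-m with a factor t^2 to spare. A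
    quadratic bound is what makes the derivative at 0 vanish. *)
Lemma flat_le_sqr c m t : 0 < c -> 
  flat c m t <= (m.+2)`!%:R / c ^+ m.+2 * t ^+ 2.
Proof.
move=> c0; have [t0|t0] := ltP 0 t; last first.
  by rewrite flatN // mulr_ge0 ?sqr_ge0 // divr_ge0 // exprn_ge0 // ltW.
rewrite flat_pos // ler_pdivrMr ?expR_gt0 //.
have h := @expR_ge1Dxn R (c / t) m.+1 (ltW (divr_gt0 c0 t0)).
have {}h : (c / t) ^+ m.+2 / (m.+2)`!%:R <= expR (c / t) by apply: le_trans h; rewrite lerDr.
apply: le_trans (ler_wpM2l _ h); last first.
  by rewrite mulr_ge0 ?sqr_ge0 // divr_ge0 // exprn_ge0 // ltW.
rewrite le_eqVlt; apply/orP; left; apply/eqP.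
have F : (m.+2)`!%:R != 0 :> R by rewrite pnatr_eq0 -lt0n fact_gt0.
rewrite expr_div_n.
transitivity (t ^+ 2 * t^-1 ^+ m.+2); last first.
  rewrite exprVn; field; rewrite F /= !expf_neq0 ?gt_eqF //.
by rewrite [t^-1 ^+ m.+2]exprS [t^-1 ^+ m.+1]exprS expr2 -mulrA !mulVKf ?gt_eqF.
Qed.

Lemma is_derive_flat c m t : 0 < c ->
  is_derive t 1 (flat c m) (c * flat c m.+2 t - m%:R * flat c m.+1 t).
Proof.
move=> c0; have [t0|t0|t0] := ltgtP t 0.
- rewrite !flatN ?ltW // !mulr0 subrr.
  apply: (near_eq_is_derive (f := cst (0 : R))).
  by near=> x; rewrite flatN // ltW //; near: x; (exact: lt_nbhsl || exact: lt_nbhsr).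
- have E : c * flat c m.+2 t - m%:R * flat c m.+1 t =
      (c * t^-1 ^+ 2 - m%:R * t^-1) * expR (- c * t^-1 - m%:R * ln t).
    have -> : expR (- c * t^-1 - m%:R * ln t) = flat c m t by rewrite /flat t0.
    by rewrite !flat_pos // !exprSr expr0; ring.
  rewrite E.
  have t1 : t != 0 by rewrite gt_eqF.
  have h1 : is_derive t 1 (fun s : R => - c * s^-1 - m%:R * ln s) 
     (c * t^-1 ^+ 2 - m%:R * t^-1).
    have := @is_deriveB R R R (fun s : R => - c * s^-1) (fun s => m%:R * ln s) t 1
      (c * t^-1 ^+ 2) (m%:R * t^-1).
    apply.
      have := @is_deriveZ R R R (fun s : R => s^-1) (- c) t 1 (- t ^- 2 *: 1).
      rewrite /= => /(_ _) h; apply: is_derive_eq.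
        by apply: h; exact: is_deriveV.
      by rewrite /GRing.scale /= mulr1 mulrNN exprVn.
    have := @is_deriveZ R R R (@ln R) m%:R t 1 t^-1.
    by apply; exact: is_derive1_ln.
  have := @is_derive1_comp R expR _ t _ _ (is_derive_expR _) h1.
  rewrite [_ * expR _]mulrC => h2.
  apply: near_eq_is_derive h2.
  by near=> x; rewrite /flat ifT //; near: x; (exact: lt_nbhsl || exact: gt_nbhsl || exact: lt_nbhsr).
rewrite t0 !flatN // !mulr0 subrr; apply: is_derive_cvg.
rewrite flatN // ; apply/cvgr0Pnorm_le => e e0.
set K := (m.+2)`!%:R / c ^+ m.+2.
have K0 : 0 <= K by rewrite divr_ge0 // exprn_ge0 // ltW.
near=> h; rewrite /= subr0 addr0 /GRing.scale /= mulr1 normrM normfV.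
have h0 : h != 0 by near: h; exact: nbhs_dnbhs_neq.
rewrite ger0_norm ?flat_ge0 // mulrC ler_pdivrMr ?normr_gt0 //.
apply: le_trans (flat_le_sqr _ _ c0) _; rewrite -/K -real_normK ?num_real // expr2 mulrA.
rewrite ler_wpM2r // .
apply: (@le_trans _ _ ((K + 1) * `|h|)); first by rewrite ler_wpM2r // lerDl.
rewrite -ler_pdivlMl; last by lra.
apply: ltW; near: h; apply: dnbhs0_lt; apply: mulr_gt0 => //; rewrite invr_gt0; lra.
Unshelve. all: by end_near. Qed.

Lemma cvg_flat c t : 0 < c -> 0 < t -> flat (c / k.+1%:R) 0 t @[k --> \oo] --> (1 : R).
Proof.
move=> c0 t0; rewrite (_ : (fun k => _) = fun k => expR (- (c / t) * k.+1%:R^-1)).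
  have E : expR (- (c / t) * 0) = 1 :> R by rewrite mulr0 expR0.
  rewrite -[X in _ --> X]E.
  apply: continuous_cvg; first exact: continuous_expR.
  apply: cvgMr; exact: cvg_harmonic.
by apply/funext => k; rewrite /flat t0 mul0r subr0; congr expR; rewrite !mulNr mulrAC.
Qed.

End flat_function.

Section smooth_functions.
Context {R : realType} {n : nat}.
Local Notation pt := 'rV[R]_n.+1.
Implicit Types (f g : pt -> R) (k : nat).

(** [smooth] quantifies over lists of directions; this recursive form supports induction on the
    order of differentiation, in particular for products. *)
Fixpoint diffk k f : Prop := (forall x, differentiable f x) /\
  if k is k'.+1 then forall i, diffk k' (pd i f) else True.

Lemma diffk_diff k f x : diffk k f -> differentiable f x.
Proof. by case: k => [|k] [h _]; exact: h. Qed.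

Lemma diffk_pd k f i : diffk k.+1 f -> diffk k (pd i f).
Proof. by case=> _; exact. Qed.

Lemma diffkW k f : diffk k.+1 f -> diffk k f.
Proof.
elim: k f => [|k IH] f [df h]; split => //.
by move=> i; apply: IH; exact: h.
Qed.

(** In a list of directions the last one acts first on the function, hence the induction peels the
    list from its end. *)
Lemma smoothP f : smooth f <-> forall k, diffk k f.
Proof.
split=> [sf k|h s x].
  elim: k f sf => [|k IH] f sf; first by split=> // x; exact: (sf [::] x).
  split=> [x|i]; first exact: (sf [::] x).
  by apply: IH => s x; have := sf (rcons s i) x; rewrite foldr_rcons.
suff : forall k f, (forall j, diffk j f) -> forall s, size s = k -> 
   differentiable (foldr (@pd R n) f s) x by apply; [exact: h|reflexivity].
elim=> [|k IH] {h s} f h s; first by move/size0nil => ->; exact: (h 0%N).1.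
case/lastP: s => // s i; rewrite size_rcons foldr_rcons => -[sk].
by apply: IH => // j; exact: (diffk_pd i (h j.+1)).
Qed.

Lemma pdD i f g : (forall x, differentiable f x) -> (forall x, differentiable g x) ->
  pd i (f \+ g) = pd i f \+ pd i g.
Proof.
by move=> df dg; apply/funext => x; rewrite /pd /= deriveD //; exact: diff_derivable.
Qed.

Lemma pdM i f g : (forall x, differentiable f x) -> (forall x, differentiable g x) ->
  pd i (f \* g) = (f \* pd i g) \+ (g \* pd i f).
Proof.
by move=> df dg; apply/funext => x; rewrite /pd /= deriveM //; exact: diff_derivable.
Qed.

Lemma pd_cst i (a : R) : pd i (cst a : pt -> R) = cst 0.
Proof. by apply/funext => x; rewrite /pd derive_cst. Qed.

Lemma diffk_cst k a : diffk k (cst a).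
Proof.
elim: k a => [|k IH] a; (split; first by move=> x; exact: differentiable_cst) => // i.
by rewrite pd_cst.
Qed.

Lemma diffkD k f g : diffk k f -> diffk k g -> diffk k (f \+ g).
Proof.
elim: k f g => [|k IH] f g df dg;
  (split; first by move=> x; apply: differentiableD; [exact: diffk_diff df|exact: diffk_diff dg]) => // i.
rewrite pdD => [|x|x]; [|exact: diffk_diff df|exact: diffk_diff dg].
by apply: IH; exact: diffk_pd.
Qed.

Lemma diffkM k f g : diffk k f -> diffk k g -> diffk k (f \* g).
Proof.
elim: k f g => [|k IH] f g df dg;
  (split; first by move=> x; apply: differentiableM; [exact: diffk_diff df|exact: diffk_diff dg]) => // i.
rewrite pdM => [|x|x]; [|exact: diffk_diff df|exact: diffk_diff dg].
by apply: diffkD; apply: IH; (exact: diffkW || exact: diffk_pd).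
Qed.

Lemma diffk_prod k (I : Type) (s : seq I) (F : I -> pt -> R) :
  (forall i, diffk k (F i)) -> diffk k (fun x => \prod_(i <- s) F i x).
Proof.
move=> h; elim: s => [|i s IH].
  by under eq_fun do rewrite big_nil; exact: diffk_cst.
by under eq_fun do rewrite big_cons; exact: diffkM.
Qed.

Lemma pd_coord i j (g dg : R -> R) (a b : R) :
  (forall t : R, is_derive t 1 g (dg t)) ->
  pd j (fun x : pt => g (a + b * x ord0 i)) =
  fun x => (i == j)%:R * b * dg (a + b * x ord0 i).
Proof.
move=> hg; apply/funext => x; rewrite /pd.
have hx : is_derive (0 : R) 1 (fun s : R => g (a + b * (x ord0 i + s * (i == j)%:R))) 
    ((i == j)%:R * b * dg (a + b * x ord0 i)).
  have h1 : is_derive (0 : R) 1 (fun s : R => a + b * (x ord0 i + s * (i == j)%:R)) (b * (i == j)%:R).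
    rewrite (_ : (fun s : R => _) = (fun s : R => (a + b * x ord0 i) + (b * (i == j)%:R) * s)); last first.
      by apply/funext => s; ring.
    exact: is_derive_affine.
  have := @is_derive1_comp R g _ 0 _ _ (hg _) h1.
  by move=> h; apply: is_derive_eq; rewrite mul0r addr0; ring.
case: hx => hd hv.
suff H : is_derive x (base_vec j : pt) (fun x : pt => g (a + b * x ord0 i))
   ((i == j)%:R * b * dg (a + b * x ord0 i)) by exact: derive_val.
apply: is_derive_cvg; rewrite -hv; move: hd; rewrite /derivable /derive.
set q2 := (fun h : R => h^-1 *: (_ ((h : R) *: base_vec j) - _)); set q1 := (fun h : R => h^-1 *: (_ - _)).
suff -> : q2 = q1 by [].
apply/funext => h; rewrite /q1 /q2 /= !mxE.
by rewrite eqxx /= [_ *: 1]mulr1 addr0 mul0r addr0 [x ord0 i + _]addrC.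
Qed.

Lemma diffk_flat k i m c (a b : R) : 0 < c ->
  diffk k (fun x : pt => flat c m (a + b * x ord0 i)).
Proof.
move=> c0.
have D m' x : differentiable (fun x : pt => flat c m' (a + b * x ord0 i)) x.
  apply: (differentiable_comp (f := fun x : pt => a + b * x ord0 i) (g := flat c m')).
    apply: differentiableD; first exact: differentiable_cst.
    apply: differentiableM; first exact: differentiable_cst.
    exact: differentiable_coord.
  by apply/derivable1_diffP; have [] := is_derive_flat m' (a + b * x ord0 i) c0.
elim: k m => [|k IH] m; split => // j.
have -> := @pd_coord i j _ _ a b (fun t => is_derive_flat m t c0).
rewrite (_ : (fun x => _) = (cst ((i == j)%:R * b) \*
  ((cst c \* (fun x : pt => flat c m.+2 (a + b * x ord0 i))) \+ 
   (cst (- m%:R) \* (fun x : pt => flat c m.+1 (a + b * x ord0 i)))))); last first.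
  by apply/funext => x /=; rewrite mulNr.
by apply: diffkM; [exact: diffk_cst|apply: diffkD; apply: diffkM; (exact: diffk_cst || exact: IH)].
Qed.

(** A smooth function, positive exactly on the open box. As [c] tends to 0 it converges to the
    indicator of the box while staying below 1, as dominated convergence requires. *)
Definition box_bump (c : R) (a b : pt) (x : pt) : R :=
  \prod_i (flat c 0 (x ord0 i - a ord0 i) * flat c 0 (b ord0 i - x ord0 i)).

Lemma smooth_bump c a b : 0 < c -> smooth (box_bump c a b).
Proof.
move=> c0; apply/smoothP => k; apply: diffk_prod => i; apply: diffkM.
  have := @diffk_flat k i 0%N c (- a ord0 i) 1 c0.
  by under eq_fun do rewrite mul1r addrC.
have := @diffk_flat k i 0%N c (b ord0 i) (-1) c0.
by under eq_fun do rewrite mulN1r.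
Qed.

Lemma compact_cbox (a b : pt) : compact (cbox a b).
Proof.
have := @rV_compact _ n.+1 (fun i => `[a ord0 i, b ord0 i]%classic).
rewrite (_ : [set v | _] = cbox a b).
  by apply => i; exact: segment_compact.
by apply/seteqP; split => x h i; have := h i; rewrite /= in_itv.
Qed.

Lemma closed_cbox (a b : pt) : closed (cbox a b).
Proof. by apply: compact_closed; [exact: norm_hausdorff|exact: compact_cbox]. Qed.

Lemma bump_out c a b x : ~ box a b x -> box_bump c a b x = 0.
Proof.
move=> h; have [i hi] : exists i, ~ (a ord0 i < x ord0 i < b ord0 i).
  by apply/not_existsP => h'; apply: h => i; apply: contrapT; exact: h'.
rewrite /box_bump (bigD1 i) //= [X in X * _](_ : _ = 0) ?mul0r //.
move/negP: hi; rewrite negb_and -!leNgt => /orP[h1|h1].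
  by rewrite flatN ?mul0r // subr_le0.
by rewrite [X in _ * X]flatN ?mulr0 // subr_le0.
Qed.

Lemma test_bump c a b (D : set pt) : 0 < c -> cbox a b `<=` D ->
  test_fun D (box_bump c a b).
Proof.
move=> c0 abD; have H : closure [set x | box_bump c a b x != 0] `<=` cbox a b.
  rewrite [X in _ `<=` X](closure_id (cbox a b)).1; last exact: closed_cbox.
  apply: closure_subset => x /= /eqP hx i.
  have : box a b x by apply: contrapT => /(bump_out c) /hx.
  by move=> /(_ i) /andP[/ltW -> /ltW ->].
split; [exact: smooth_bump| |exact: subset_trans abD].
by apply: subclosed_compact H; [exact: closed_closure|exact: compact_cbox].
Qed.

Lemma bump_ge0 c a b x : 0 <= box_bump c a b x.
Proof. by apply: prodr_ge0 => i _; rewrite mulr_ge0 // flat_ge0. Qed.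

Lemma bump_le1 c a b x : 0 < c -> box_bump c a b x <= 1.
Proof.
move=> c0; apply: prodr_ile1 => i _.
by rewrite mulr_ge0 ?flat_ge0 //= mulr_ile1 ?flat_ge0 ?flat_le1.
Qed.

Lemma cvg_bump a b x : box_bump k.+1%:R^-1 a b x @[k --> \oo] --> (\1_(box a b) x : R).
Proof.
rewrite indicE; case: (pselect (box a b x)) => h.
  rewrite mem_set // /box_bump.
  have -> : (true%:R : R) = \prod_(i < n.+1) (1 * 1) by rewrite big1 // => i _; rewrite mulr1.
  apply: cvg_big => [|i _]; first exact: mul_continuous.
  have /andP[h1 h2] := h i.
  apply: cvgM.
    have := @cvg_flat R 1 (x ord0 i - a ord0 i) ltr01.
    by rewrite subr_gt0 => /(_ h1); under eq_cvg do rewrite mul1r.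
  have := @cvg_flat R 1 (b ord0 i - x ord0 i) ltr01.
  by rewrite subr_gt0 => /(_ h2); under eq_cvg do rewrite mul1r.
rewrite memNset //; under eq_cvg do rewrite bump_out //.
exact: cvg_cst.
Qed.

End smooth_functions.

Section test_functions.
Context {R : realType} {n : nat}.
Local Notation pt := 'rV[R]_n.+1.
Implicit Types (f g : pt -> R) (D : set pt).

Lemma smooth_cts f : smooth f -> continuous f.
Proof. by move=> sf x; apply: differentiable_continuous; exact: (sf [::] x). Qed.

Lemma smooth_pd f i : smooth f -> smooth (pd i f).
Proof. by move=> sf s x; have := sf (rcons s i) x; rewrite foldr_rcons. Qed.

Lemma smoothD f g : smooth f -> smooth g -> smooth (f \+ g).
Proof. by move=> /smoothP sf /smoothP sg; apply/smoothP => k; exact: diffkD. Qed.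

Lemma smoothM f g : smooth f -> smooth g -> smooth (f \* g).
Proof. by move=> /smoothP sf /smoothP sg; apply/smoothP => k; exact: diffkM. Qed.

Lemma smooth_cst a : smooth (cst a : pt -> R).
Proof. by apply/smoothP => k; exact: diffk_cst. Qed.

Lemma smooth_measurable f : smooth f -> measurable_fun setT f.
Proof.
move=> /smooth_cts cf; apply: continuous_measurable_rV => //.
exact: continuous_subspaceT.
Qed.

Lemma test_fun_supp D f g : test_fun D f -> smooth g ->
  [set x | g x != 0] `<=` closure [set x | f x != 0] -> test_fun D g.
Proof.
move=> [sf cf fD] sg gf; have H : closure [set x | g x != 0] `<=` closure [set x | f x != 0].
  by rewrite [X in _ `<=` X](closure_id _).1; [exact: closure_subset|exact: closed_closure].
split => //; last exact: subset_trans H fD.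
by apply: subclosed_compact H => //; exact: closed_closure.
Qed.

Lemma test_funM D f g : test_fun D f -> smooth g -> test_fun D (f \* g).
Proof.
move=> tf sg; apply: (test_fun_supp tf); first by apply: smoothM => //; case: tf.
move=> x /=; rewrite mulf_eq0 negb_or => /andP[h _].
exact: subset_closure.
Qed.

Lemma test_fun_pd D f i : test_fun D f -> test_fun D (pd i f).
Proof.
move=> tf; have [sf cf _] := tf; apply: (test_fun_supp tf); first exact: smooth_pd.
move=> x /= hx; apply: contrapT => hN.
have oC : open (~` closure [set x | f x != 0]) by apply: closed_openC; exact: closed_closure.
have : \forall y \near x, f y = cst 0 y.
  have : nbhs x (~` closure [set x | f x != 0]) by apply: open_nbhs_nbhs.
  apply: filterS => y hy; apply: contrapT => /eqP fy; apply: hy; exact: subset_closure.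
move=> /near_eq_derive => /(_ (base_vec i)) h.
by move: hx; rewrite /pd h derive_cst eqxx.
Qed.

Lemma test_funD D f g : test_fun D f -> test_fun D g -> test_fun D (f \+ g).
Proof.
move=> [sf cf fD] [sg cg gD].
have H : closure [set x | (f \+ g) x != 0] `<=`
    closure [set x | f x != 0] `|` closure [set x | g x != 0].
  rewrite -closureU; apply: closure_subset => x /=.
  have [->|h] := eqVneq (f x) 0; first by rewrite add0r; right.
  by left.
split; first exact: smoothD.
  by apply: subclosed_compact H; [exact: closed_closure|exact: compactU].
by apply: subset_trans H _ => x []; [exact: fD|exact: gD].
Qed.

Lemma test_funZ D f (a : R) : test_fun D f -> test_fun D (fun x => a * f x).
Proof.
move=> tf; have := test_funM tf (smooth_cst a).
by congr (test_fun _ _); apply/funext => x /=; rewrite mulrC.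
Qed.

Lemma test_fun_bounded D f : test_fun D f -> exists2 M : R, 0 < M & forall x, `|f x| <= M.
Proof.
move=> [sf cf _]; set K := closure _ in cf.
have [[x0 Kx0]|K0] := pselect (exists x, K x); last first.
  exists 1 => // x; have -> : f x = 0; last by rewrite normr0.
  by apply: contrapT => /eqP fx; apply: K0; exists x; exact: subset_closure.
have cn : {within K, continuous (fun x => `|f x|)}.
  apply: continuous_subspaceT => x; apply: continuous_comp; [exact: smooth_cts|exact: norm_continuous].
have [c Kc hc] := @EVT_max_rV R n.+1 (fun x => `|f x|) K (ex_intro _ x0 Kx0) cf cn.
exists (`|f c| + 1) => [|x]; first by rewrite ltr_wpDl.
have [fx|fx] := eqVneq (f x) 0; first by rewrite fx normr0 addr_ge0.
apply: (@le_trans _ _ `|f c|); last by rewrite lerDl.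
by apply: hc; rewrite inE; exact: subset_closure.
Qed.

End test_functions.

(** * Weak derivatives *)

Section weak_derivative_uniqueness.
Context {R : realType} {n : nat}.
Local Notation pt := 'rV[R]_n.+1.
Local Notation vol := (leb R n.+1).
Implicit Types (f g G : pt -> R) (D : set pt).

(** An open set is covered by countably many rational boxes whose closed versions it contains, so
    the exceptional sets add up to a null set. Natural numbers that do not encode such a box
    contribute the empty set. *)
Lemma open_ae_cover D (Q : set pt) : open D ->
  (forall a b, cbox a b `<=` D -> {ae vol, forall x, box a b x -> Q x}) ->
  {ae vol, forall x, D x -> Q x}.
Proof.
move=> oD h.
pose F (k : nat) : set pt := if unpickle k is Some cd then
   (if `[< cbox (map_mx ratr cd.1 : pt) (map_mx ratr cd.2) `<=` D >]
    then box (map_mx ratr cd.1 : pt) (map_mx ratr cd.2) `&` ~` Q else set0) else set0.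
apply: (negligibleS (A := \bigcup_k F k)).
  move=> x /= /not_implyP[Dx Qx].
  have /box_nbhs[c [d [h1 h2]]] : nbhs x D by apply: open_nbhs_nbhs.
  exists (pickle (c, d)) => //; rewrite /F pickleK /=.
  by case: asboolP.
apply: negligible_bigcup => k; rewrite /F.
case: unpickle => [[c d]|]; last exact: negligible_set0.
case: asboolP => /= H; last exact: negligible_set0.
apply: negligibleS (h _ _ H) => x /= [h1 h2]; exact/not_implyP.
Qed.

(** Local integrability speaks of compact subsets; measurability on all of [D] follows through a
    countable cover by closed rational boxes. *)
Lemma loc_integrable_measurable D f : open D -> loc_integrable D f -> measurable_fun D f.
Proof.
move=> oD lf.
have mD : measurable D by exact: open_measurable_rV.
pose F (k : nat) : set pt := if unpickle k is Some cd then
   (if `[< cbox (map_mx ratr cd.1 : pt) (map_mx ratr cd.2) `<=` D >]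
    then cbox (map_mx ratr cd.1 : pt) (map_mx ratr cd.2) else set0) else set0.
have FD k : F k `<=` D.
  by rewrite /F; case: unpickle => [[c d]|]; [case: ifPn => [/asboolP|_ ?]|] => //.
have cF k : compact (F k).
  rewrite /F; case: unpickle => [[c d]|]; last exact: compact0.
  by case: asboolP => // _; [exact: compact_cbox|exact: compact0].
have DE : D = \bigcup_k F k.
  apply/seteqP; split; last by move=> x [k _ /FD].
  move=> x Dx.
  have /box_nbhs[c [d [h1 h2]]] : nbhs x D by apply: open_nbhs_nbhs.
  exists (pickle (c, d)) => //; rewrite /F pickleK /=.
  by case: asboolP => // _; exact: box_cbox.
rewrite DE; apply/measurable_fun_bigcup => [k|k].
  by apply: compact_measurable_rV; exact: cF.
by apply/measurable_EFinP; exact: measurable_int (lf _ (cF k) (FD k)).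
Qed.

(** The pairings of [G] with bumps of decreasing parameter converge to the integral over the box,
    dominated by |G| on the closed box. *)
Lemma integral_box_eq0 D G a b : open D -> loc_integrable D G ->
  (forall phi, test_fun D phi -> l2 D G phi = 0) -> cbox a b `<=` D ->
  (\int[vol]_(x in box a b) (G x)%:E = 0)%E.
Proof.
move=> oD lG hG abD.
have mC : measurable (cbox a b) by apply: compact_measurable_rV; exact: compact_cbox.
have iG : vol.-integrable (cbox a b) (EFin \o G) by apply: lG => //; exact: compact_cbox.
have mG : measurable_fun (cbox a b) G by apply/measurable_EFinP; exact: measurable_int iG.
pose psi k := box_bump (k.+1%:R^-1 : R) a b.
have k0 k : 0 < k.+1%:R^-1 :> R by rewrite invr_gt0.
have tpsi k : test_fun D (psi k) by apply: test_bump.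
have mpsi k : measurable_fun (cbox a b) (psi k).
  by apply: measurable_funTS; apply: smooth_measurable; case: (tpsi k).
have ipsi k : vol.-integrable (cbox a b) (fun x => (G x * psi k x)%:E).
  apply: le_integrable iG => //.
    by apply/measurable_EFinP; apply: measurable_funM.
  move=> x _ /=; rewrite lee_fin normrM ler_piMr // ger0_norm ?bump_ge0 //.
  exact: bump_le1.
have E k : (\int[vol]_(x in cbox a b) (G x * psi k x)%:E = 0)%E.
  have := hG _ (tpsi k); rewrite /l2 /Rintegral.
  rewrite (_ : (\int[vol]_(x in D) _)%E = (\int[vol]_(x in cbox a b) (G x * psi k x)%:E)%E).
    move=> h; apply/eqP; rewrite -[X in X == _]fineK ?h //; exact: integrable_fin_num.
  rewrite integral_mkcond [RHS]integral_mkcond; congr integral.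
  apply/funext => x; rewrite /patch.
  case: ifPn => [|/negP xD]; case: ifPn => // /negP.
    move=> hx _; rewrite /psi bump_out ?mulr0 // => /box_cbox xab.
    by apply: hx; rewrite inE.
  by move=> /contrapT xab; exfalso; apply: xD; rewrite inE; apply: abD; move: xab; rewrite inE.
have [k| | | | |_ _ H] := @dominated_convergence _ pt R vol (cbox a b) mC
   (fun k x => (G x * psi k x)%:E) (fun x => (G x * \1_(box a b) x)%:E) (fun x => `|(G x)%:E|%E).
- by apply/measurable_EFinP; apply: measurable_funM.
- apply/measurable_EFinP; apply: measurable_funM => //.
  by apply: measurable_indic; exact: measurable_box.
- apply: aeW => x _; apply: cvg_EFin; first exact: nearW.
  by apply: cvgMr; exact: cvg_bump.
- exact: integrable_abse.
- apply: aeW => x k _ /=; rewrite lee_fin normrM ler_piMr // ger0_norm ?bump_ge0 //.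
  exact: bump_le1.
rewrite (_ : (\int[vol]_(x in box a b) _)%E = (\int[vol]_(x in cbox a b) (G x * \1_(box a b) x)%:E)%E); last first.
  rewrite integral_mkcond [RHS]integral_mkcond; congr integral.
  apply/funext => x; rewrite /patch indicE.
  case: ifPn => /= [h|h]; last by rewrite mulr0; case: ifP.
  rewrite mulr1 ifT //; move: h; rewrite !inE; exact: box_cbox.
have {}H := cvg_lim (@ereal_hausdorff R) H; rewrite -H.
by under eq_fun do rewrite E; exact: lim_cst.
Qed.

Lemma box_setI (a b c d : pt) : exists e f' : pt, box a b `&` box c d = box e f' /\
  cbox e f' `<=` cbox a b.
Proof.
exists (\row_i Num.max (a ord0 i) (c ord0 i)), (\row_i Num.min (b ord0 i) (d ord0 i)).
split; last first.
  by move=> x h i; have := h i; rewrite !mxE ge_max le_min => /andP[/andP[-> _] /andP[-> _]].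
apply/seteqP; split => x /=.
  move=> [h1 h2] i; rewrite !mxE gt_max lt_min.
  by have /andP[-> ->] := h1 i; have /andP[-> ->] := h2 i.
move=> h; split => i; have := h i; rewrite !mxE gt_max lt_min.
  by move=> /andP[/andP[-> _] /andP[-> _]].
by move=> /andP[/andP[_ ->] /andP[_ ->]].
Qed.

(** The fundamental lemma of the calculus of variations. The integral of [G] vanishes on boxes,
    hence by a Dynkin argument on all Borel subsets of a box, hence [G] is 0 almost everywhere
    there. *)
Lemma ae_eq0_test D G : open D -> loc_integrable D G ->
  (forall phi, test_fun D phi -> l2 D G phi = 0) ->
  {ae vol, forall x, D x -> G x = 0}.
Proof.
move=> oD lG hG; apply: (open_ae_cover oD) => a b abD.
have mB : measurable (box a b) by exact: measurable_box.
have iG : vol.-integrable (box a b) (EFin \o G).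
  apply: (@integrableS _ _ _ vol (cbox a b)) => //.
  - by apply: compact_measurable_rV; exact: compact_cbox.
  - exact: box_cbox.
  - by apply: lG => //; exact: compact_cbox.
have H : forall S, measurable S -> (\int[vol]_(x in box a b `&` S) (G x)%:E = 0)%E.
  move=> S /measurable_box_generated.
  pose T := 'rV[R]_n.+1.
  apply: (@dynkin_induction _ T [set B | exists c d, B = box c d]
    (fun S => (\int[vol]_(x in box a b `&` S) (G x)%:E = 0)%E)).
  - apply/seteqP; split; first exact: measurable_box_generated.
    by apply: smallest_sub; [exact: sigma_algebra_measurable|move=> _ [c [d ->]]; exact: measurable_box].
  - by move=> _ _ [c [d ->]] [e [f ->]]; have [g [h [-> _]]] := box_setI c d e f; exists g, h.
  - by rewrite setIT; exact: (integral_box_eq0 oD lG hG).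
  - move=> _ [c [d ->]]; have [e [f [-> ef]]] := box_setI a b c d.
    by apply: (integral_box_eq0 oD lG hG); exact: subset_trans ef abD.
  - move=> {}S mS hS.
    have := integral_box_eq0 oD lG hG abD.
    rewrite -{1}(setIT (box a b)) -(setUv S) setIUr integral_setU //; last 4 first.
    + exact: measurableI.
    + by apply: measurableI => //; exact: measurableC.
    + by rewrite -setIUr setUv setIT; exact: measurable_int iG.
    + by apply/disj_setPS => x [[_ h1] [_ h2]]; exact: h2.
    by rewrite hS add0e.
  - move=> F mF tF hF; rewrite setI_bigcupr integral_bigcup.
    + by rewrite eseries0 // => i _ _; exact: hF.
    + exact: trivIset_setIl.
    + by move=> k; exact: measurableI.
    + apply: integrableS iG => //.
        by apply: bigcupT_measurable => k; exact: measurableI.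
      by apply: bigcup_sub => k _; exact: subIsetl.
have : ae_eq vol (box a b) (EFin \o G) (cst 0%E).
  apply: integral_ae_eq => // E EB mE; rewrite integral0.
  by rewrite -(H _ mE); congr integral; rewrite setIidr.
by apply: filterS => x h /h /= [].
Qed.

Lemma loc_integrableM D f phi : open D -> loc_integrable D f -> test_fun D phi ->
  vol.-integrable D (fun x => (f x * phi x)%:E).
Proof.
move=> oD lf tphi; have [sphi cK KD] := tphi.
set K := closure _ in cK KD.
have mK : measurable K by exact: compact_measurable_rV.
have mD : measurable D by exact: open_measurable_rV.
have [M M0 hM] := test_fun_bounded tphi.
have mphi : measurable_fun setT phi by exact: smooth_measurable.
have iK : vol.-integrable K (fun x => (f x * phi x)%:E).
  have iM := integrableZl mK M (lf _ cK KD).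
  apply: le_integrable iM => //.
    apply/measurable_EFinP; apply: measurable_funM; last exact: measurable_funTS.
    by apply/measurable_EFinP; exact: measurable_int (lf _ cK KD).
  move=> x _ /=; rewrite lee_fin !normrM mulrC ler_wpM2r // (gtr0_norm M0).
  exact: hM.
rewrite -(setIidr KD) in iK.
have [/(_ iK) + _] := @integrable_restrict _ _ _ vol K mK D mD (fun x => (f x * phi x)%:E).
apply: eq_integrable => // x _; rewrite /patch; case: ifPn => // /negP xK.
have -> : phi x = 0; last by rewrite mulr0.
by apply: contrapT => /eqP h; apply: xK; rewrite inE; exact: subset_closure.
Qed.

Lemma l2B D f g phi : loc_integrable D f -> loc_integrable D g -> test_fun D phi ->
  open D -> l2 D (f \- g) phi = l2 D f phi - l2 D g phi.
Proof.
move=> lf lg tphi oD; rewrite /l2 -RintegralB.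
- by apply: eq_Rintegral => x _ /=; rewrite mulrBl.
- exact: open_measurable_rV.
- exact: loc_integrableM.
- exact: loc_integrableM.
Qed.

Lemma loc_integrableB D f g : loc_integrable D f -> loc_integrable D g ->
  loc_integrable D (f \- g).
Proof.
move=> lf lg A cA AD.
have mA := compact_measurable_rV cA.
have := integrableB mA (lf A cA AD) (lg A cA AD).
by apply: eq_integrable.
Qed.

Lemma wpd_unique D i f g1 g2 : open D -> is_wpd D i f g1 -> is_wpd D i f g2 ->
  {ae vol, forall x, D x -> g1 x = g2 x}.
Proof.
move=> oD [lf lg1 h1] [_ lg2 h2].
have : {ae vol, forall x, D x -> (g1 \- g2) x = 0}.
  apply: (ae_eq0_test oD); first exact: loc_integrableB.
  move=> phi tphi; rewrite l2B //.
  by have := h1 _ tphi; rewrite (h2 _ tphi); lra.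
by apply: filterS => x h /h /= /eqP; rewrite subr_eq0 => /eqP.
Qed.

(** Since [wpd] is a choice among the weak derivatives, one witness is enough to make the chosen
    function a weak derivative. *)
Lemma wpdP D i f g : is_wpd D i f g -> is_wpd D i f (wpd D i f).
Proof. by move=> h; rewrite /wpd; case: xgetP => [y _ //|/(_ g)]. Qed.

Lemma wpdE D i f g : open D -> is_wpd D i f g ->
  {ae vol, forall x, D x -> wpd D i f x = g x}.
Proof. by move=> oD h; apply: (wpd_unique oD _ h); exact: wpdP h. Qed.

Lemma is_wpdB D i f1 f2 g1 g2 : open D -> is_wpd D i f1 g1 -> is_wpd D i f2 g2 ->
  is_wpd D i (f1 \- f2) (g1 \- g2).
Proof.
move=> oD [lf1 lg1 h1] [lf2 lg2 h2]; split; [exact: loc_integrableB..|].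
move=> phi tphi; rewrite !l2B ?h1 ?h2 //; first by ring.
exact: test_fun_pd.
Qed.

End weak_derivative_uniqueness.

(** * Existence of weak derivatives from difference quotients *)

Section weak_derivative_existence.
Context {R : realType} {n : nat}.
Local Notation pt := 'rV[R]_n.+1.
Local Notation vol := (leb R n.+1).
Implicit Types (f g G phi : pt -> R) (D K : set pt) (x v : pt).

Lemma line_derive f x v (s : R) : differentiable f (x + s *: v) ->
  is_derive s 1 (fun s : R => f (x + s *: v)) ('D_v f (x + s *: v)).
Proof.
move=> dfx; have df : derivable f (x + s *: v) v by exact: diff_derivable.
apply: is_derive_cvg.
rewrite (_ : (fun h : R => _) =
  (fun h : R => h^-1 *: ((f \o shift (x + s *: v)) (h *: v) - f (x + s *: v)))); last first.
  apply/funext => h /=; congr (_ *: (f _ - _)).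
  by rewrite [_ *: 1]mulr1 scalerDl addrCA.
exact: df.
Qed.

Lemma smooth_line_lipschitz f (L : R) x v (t : R) : smooth f ->
  (forall y, `|'D_v f y| <= L) -> 0 <= t ->
  `|f (x + t *: v) - f x| <= L * t.
Proof.
move=> sf hL t0.
have hd (s : R) : is_derive s 1 (fun s : R => f (x + s *: v)) ('D_v f (x + s *: v)).
  by apply: line_derive; exact: (sf [::]).
have [|s st] := @MVT_segment R _ _ 0 t t0 (fun s _ => hd s).
  apply: continuous_subspaceT => s; apply: differentiable_continuous.
  by apply/derivable1_diffP; have [] := hd s.
rewrite scale0r addr0 subr0 => ->.
by rewrite normrM (ger0_norm t0) ler_wpM2r.
Qed.

(** A compact subset keeps a positive distance from the complement, so short segments starting in it
    stay inside, uniformly in the starting point. The uniformity comes from the near-covering form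
    of compactness. *)
Lemma compact_shift_in D K v : open D -> compact K -> K `<=` D ->
  \forall k \near \oo, forall x, K x -> forall s : R, 0 <= s <= k.+1%:R^-1 ->
    D (x - s *: v).
Proof.
move=> oD cK KD.
have h : forall x, K x -> \forall y \near x & k \near \oo,
   forall s : R, 0 <= s <= k.+1%:R^-1 -> D (y - s *: v).
  move=> x Kx; have : nbhs x D by apply: open_nbhs_nbhs; split => //; exact: KD.
  move=> /nbhs_ballP[e /= e0 xeD].
  near=> y k => s /andP[s0 sk]; apply: xeD; rewrite -ball_normE /=.
  have -> : x - (y - s *: v) = (x - y) + s *: v by rewrite opprB addrA addrAC.
  rewrite (le_lt_trans (ler_normD _ _)) // normrZ (ger0_norm s0).
  have -> : e = e / 2 + e / 2 by field.
  apply: ltr_leD.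
    near: y; have /= := @nbhsx_ballx _ _ x (e / 2); rewrite -ball_normE /=; apply.
    by rewrite divr_gt0.
  apply: le_trans (ler_wpM2r (normr_ge0 _) sk) _.
  rewrite mulrC ler_pdivrMr ?ltr0n //.
  apply: (@le_trans _ _ (e / 2 * k%:R)); last by rewrite ler_wpM2l ?ler_nat // ltW // divr_gt0.
  rewrite -ler_pdivrMl ?divr_gt0 //.
  near: k; exact: nbhs_infty_ger.
have /compact_near_coveringP/(_ _ \oo (fun k x => forall s : R, 0 <= s <= k.+1%:R^-1 -> D (x - s *: v))) := cK.
move=> /(_ _); apply => x Kx.
have := h x Kx; move=> [[A B] /= [nA nB] AB]; exists (A, B) => //.
Unshelve. all: by end_near. Qed.

Lemma integrable_patch D f : measurable D -> vol.-integrable D (EFin \o f) ->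
  vol.-integrable setT (EFin \o patch (fun=> 0) D f).
Proof.
move=> mD fi.
have := integrable_mkcond (mu := vol) (EFin \o f) mD.
rewrite (_ : (EFin \o f) \_ D = EFin \o patch (fun=> 0) D f); first by move=> <-.
by apply/funext => x; rewrite /patch /=; case: ifP.
Qed.

Lemma pd_bounded D phi i : test_fun D phi ->
  exists2 L : R, 0 < L & forall x, `|pd i phi x| <= L.
Proof. by move=> /(test_fun_pd i); exact: test_fun_bounded. Qed.

Lemma integral_suppE D phi f : test_fun D phi -> (forall x, phi x = 0%R -> f x = 0%R) ->
  (\int[vol]_(x in D) (f x)%:E =
   \int[vol]_(x in closure [set x | phi x != 0%R]) (f x)%:E)%E.
Proof.
move=> [_ _ KD] h0; rewrite integral_mkcond [RHS]integral_mkcond; congr integral.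
apply/funext => x; rewrite /patch.
have [xK|xK] := boolP (x \in closure _).
  by rewrite ifT //; move: xK; rewrite !inE; exact: KD.
suff -> : f x = 0 by case: ifP.
apply: h0; apply: contrapT => /eqP h; move/negP: xK; apply; rewrite inE.
exact: subset_closure.
Qed.

Lemma shift_rVN (i : 'I_n.+1) (t : R) x : shift_rV i (- t) x = x - t *: base_vec i.
Proof. by rewrite /shift_rV scaleNr. Qed.

(** Difference quotients satisfy summation by parts exactly, by translation invariance, and both
    sides pass to the limit by dominated convergence. The Lipschitz bound is asked along segments
    inside [D], because [D] need not be convex. *)
Theorem lipschitz_is_wpd D i f G (L : R) : open D ->
  vol.-integrable D (EFin \o f) -> loc_integrable D G ->
  (forall x t, 0 < t -> (forall s, 0 <= s <= t -> D (x - s *: base_vec i)) ->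
     `|f (x - t *: base_vec i) - f x| <= L * t) ->
  {ae vol, forall x, D x ->
     k.+1%:R * (f x - f (x - k.+1%:R^-1 *: base_vec i)) @[k --> \oo] --> G x} ->
  is_wpd D i f G.
Proof.
move=> oD fi lG hL hG.
have mD : measurable D by exact: open_measurable_rV.
have lf : loc_integrable D f.
  move=> A cA AD; apply: integrableS fi => //; exact: compact_measurable_rV.
split => // phi tphi; have [sphi cK KD] := tphi.
set K := closure _ in cK KD.
have mK : measurable K by exact: compact_measurable_rV.
have [M M0 hM] := test_fun_bounded tphi.
have [Lp Lp0 hLp] := pd_bounded i tphi.
have mphi : measurable_fun setT phi by exact: smooth_measurable.
have mdphi : measurable_fun setT (pd i phi) by apply: smooth_measurable; exact: smooth_pd.
pose e : pt := base_vec i.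
pose t k : R := k.+1%:R^-1.
have t0 k : 0 < t k by rewrite invr_gt0.
(* Extension by 0 lets the translations act on the whole space. *)
pose f' := patch (fun=> 0) D f.
have f'i : vol.-integrable setT (EFin \o f') by exact: integrable_patch.
have mf' : measurable_fun setT f' by apply/measurable_EFinP; exact: measurable_int f'i.
have f'E x : D x -> f' x = f x by move=> Dx; rewrite /f' /patch mem_set.
have mshift s : measurable_fun setT (shift_rV i s : pt -> pt) by exact: measurable_shift_rV.
have bnd (g : pt -> R) (B : R) : measurable_fun setT g -> (forall x, `|g x| <= B) ->
    vol.-integrable setT (fun x => (f' x * g x)%:E).
  move=> mg hB; apply: le_integrable (integrableZl measurableT B f'i) => //.
    by apply/measurable_EFinP; apply: measurable_funM.
  move=> x _ /=; rewrite lee_fin !normrM mulrC ler_wpM2r //.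
  by apply: le_trans (hB x) _; exact: ler_norm.
(* [a k] and [b k] put the difference quotient on [phi] and on [f]. *)
pose a k x := f' x * (k.+1%:R * (phi (shift_rV i (t k) x) - phi x)).
pose b k x := k.+1%:R * (f' (shift_rV i (- t k) x) - f' x) * phi x.
have ab k : (\int[vol]_x (a k x)%:E = \int[vol]_x (b k x)%:E)%E.
  have i1 : vol.-integrable setT (fun x => (f' x * (k.+1%:R * phi (shift_rV i (t k) x)))%:E).
    apply: (bnd (fun x => k.+1%:R * phi (shift_rV i (t k) x)) (k.+1%:R * M)).
      by apply: measurable_funM => //; exact: measurableT_comp.
    by move=> x; rewrite normrM ger0_norm // ler_wpM2l.
  have i2 : vol.-integrable setT (fun x => (f' x * (k.+1%:R * phi x))%:E).
    apply: (bnd (fun x => k.+1%:R * phi x) (k.+1%:R * M)).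
      exact: measurable_funM.
    by move=> x; rewrite normrM ger0_norm // ler_wpM2l.
  have E1 : (\int[vol]_x (a k x)%:E = \int[vol]_x (f' x * (k.+1%:R * phi (shift_rV i (t k) x)))%:E
      - \int[vol]_x (f' x * (k.+1%:R * phi x))%:E)%E.
    rewrite -integralB_EFin //; apply: eq_integral => x _.
    by rewrite -EFinB /a; congr EFin; ring.
  pose q (y : pt) := f' (shift_rV i (- t k) y) * (k.+1%:R * phi y).
  have sK (x : pt) : shift_rV i (- t k) (shift_rV i (t k) x) = x.
    by rewrite /shift_rV scaleNr addrK.
  have sK' (x : pt) : shift_rV i (t k) (shift_rV i (- t k) x) = x.
    by rewrite /shift_rV scaleNr addrNK.
  have mq : measurable_fun setT q.
    apply: measurable_funM; first exact: measurableT_comp.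
    exact: measurable_funM.
  have qi : vol.-integrable setT (EFin \o q).
    have := integrable_shift i (- t k) i1.
    by apply: eq_integrable => // x _; rewrite /= sK'.
  have E2 : (\int[vol]_x (f' x * (k.+1%:R * phi (shift_rV i (t k) x)))%:E = \int[vol]_x (q x)%:E)%E.
    by rewrite -(integral_shift i (t k) qi); apply: eq_integral => x _; rewrite /q sK.
  rewrite E1 E2 -integralB_EFin //; apply: eq_integral => x _.
  by rewrite -EFinB /b /q; congr EFin; ring.
have aL : (\int[vol]_x (a k x)%:E)%E @[k --> \oo] --> (\int[vol]_x (f' x * pd i phi x)%:E)%E.
  have [k| | | | |_ _ H] := @dominated_convergence _ pt R vol setT measurableT
     (fun k x => (a k x)%:E) (fun x => (f' x * pd i phi x)%:E) (fun x => Lp%:E * `|(f' x)%:E|)%E; last exact: H.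
  - apply/measurable_EFinP; apply: measurable_funM => //.
    apply: measurable_funM => //; apply: measurable_funB => //; exact: measurableT_comp.
  - by apply/measurable_EFinP; apply: measurable_funM.
  - apply: aeW => x _; apply: cvg_EFin; first exact: nearW.
    apply: cvgMr.
    have dphi : differentiable phi x by exact: (sphi [::]).
    have hd : (fun h : R => h^-1 *: ((phi \o shift x) (h *: e) - phi x)) @ 0^' --> pd i phi x.
      by have : derivable phi x e by exact: diff_derivable.
    have ht : t @ \oo --> (0 : R)^'.
      move=> A hA.
      have : \forall k \near \oo, t k != 0 -> A (t k).
        have /= := @cvg_harmonic R _ hA; exact.
      by apply: filterS => k; apply; rewrite gt_eqF.
    have := cvg_comp _ _ ht hd.
    apply: cvg_trans; apply: near_eq_cvg; near=> k.
    by rewrite /= /t invrK /GRing.scale /= [shift_rV _ _ _]addrC.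
  - by apply: integrableZl => //; exact: integrable_abse.
  - apply: aeW => x k _; rewrite /a /= lee_fin !normrM mulrC ler_wpM2r //.
    rewrite ger0_norm // -ler_pdivlMl // mulrC.
    exact: smooth_line_lipschitz sphi hLp (ltW (t0 k)).
(* From rank [k0] on, the shifted support of [phi] stays in [D], where the extension agrees with [f]
   and the Lipschitz bound applies. Hence the index [k + k0] below. *)
have [k0 _ hk0] := compact_shift_in e oD cK KD.
have bE k : (\int[vol]_x (b k x)%:E = \int[vol]_(x in K) (b k x)%:E)%E.
  have := @integral_suppE setT phi (b k).
  rewrite -/K; apply; first by split.
  by move=> x h; rewrite /b h mulr0.
have iK1 : vol.-integrable K (cst (L * M)%:E).
  apply: integrable_cst_fin => //.
  by apply: bounded_leb_fin => //; exact: compact_bounded.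
have bL : (\int[vol]_x (b k x)%:E)%E @[k --> \oo] --> (\int[vol]_(x in K) (- (G x * phi x))%:E)%E.
  rewrite (_ : (fun k => _) = (fun k => \int[vol]_(x in K) (b k x)%:E)%E); last exact/funext.
  rewrite -(cvg_shiftn k0).
  have [k| | | | |_ _ H] := @dominated_convergence _ pt R vol K mK
     (fun k x => (b (k + k0)%N x)%:E) (fun x => (- (G x * phi x))%:E) (cst (L * M)%:E); last exact: H.
  - apply/measurable_EFinP; apply: measurable_funTS; apply: measurable_funM => //.
    apply: measurable_funM => //; apply: measurable_funB => //; exact: measurableT_comp.
  - apply/measurable_EFinP; apply: measurableT_comp => //; apply: measurable_funM; last exact: measurable_funTS.
    by apply/measurable_EFinP; exact: measurable_int (lG _ cK KD).
  - apply: filterS hG => x hx Kx; apply: cvg_EFin; first exact: nearW.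
    rewrite -mulNr; apply: cvgMl.
    have := hx (KD _ Kx); rewrite -(cvg_shiftn k0) => /cvgN.
    apply: cvg_trans; apply: near_eq_cvg; near=> k.
    rewrite shift_rVN !f'E; [|exact: KD|].
      transitivity (- ((k + k0).+1%:R * (f x - f (x - t (k + k0)%N *: e)))); first by [].
      by rewrite -mulrN opprB.
    apply: (hk0 (k + k0)%N) => //=; first exact: leq_addl.
    by rewrite lexx ltW.
  - exact: iK1.
  - apply: aeW => x k Kx /=; rewrite lee_fin /b shift_rVN.
    have hs s : 0 <= s <= t (k + k0)%N -> D (x - s *: e).
      by apply: (hk0 (k + k0)%N) => //=; exact: leq_addl.
    rewrite !f'E; [|exact: KD|by apply: hs; rewrite lexx ltW].
    rewrite normrM; apply: ler_pM => //.
    rewrite normrM ger0_norm // -ler_pdivlMl // mulrC.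
    by apply: hL.
have HE : (\int[vol]_x (f' x * pd i phi x)%:E = \int[vol]_(x in K) (- (G x * phi x))%:E)%E.
  apply: (cvg_unique (@ereal_hausdorff R) aL).
  by rewrite (_ : (fun k => _) = (fun k => \int[vol]_x (b k x)%:E)%E) //; exact/funext.
rewrite /l2 /Rintegral.
have -> : (\int[vol]_(x in D) (f x * pd i phi x)%:E = \int[vol]_x (f' x * pd i phi x)%:E)%E.
  rewrite integral_mkcond; congr integral; apply/funext => x; rewrite /patch /f' /patch.
  by case: ifP => // _; rewrite mul0r.
rewrite HE -(integral_suppE (f := fun x => - (G x * phi x)) tphi); last by move=> x ->; rewrite mulr0 oppr0.
rewrite (_ : (fun x => _) = fun x => ((-1)%:E * (G x * phi x)%:E)%E); last first.
  by apply/funext => x; rewrite -EFinM mulN1r.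
have iGp := loc_integrableM oD lG tphi.
rewrite integralZl // fineM ?mulN1r //; exact: integrable_fin_num.
Unshelve. all: by end_near. Qed.

End weak_derivative_existence.

(** * Simplices and barycentric coordinates *)

Section simplex_geometry.
Context {R : realType} {n : nat}.
Local Notation pt := 'rV[R]_n.+1.
Local Notation vol := (leb R n.+1).
Implicit Types (k : simplex R n) (x y w : pt) (j : 'I_n.+2) (I : {set 'I_n.+2}).

Lemma dotvC m (u v : 'rV[R]_m) : dotv u v = dotv v u.
Proof. by apply: eq_bigr => i _; rewrite mulrC. Qed.

Lemma dotvDr m (u v w : 'rV[R]_m) : dotv u (v + w) = dotv u v + dotv u w.
Proof. by rewrite /dotv -big_split; apply: eq_bigr => i _; rewrite mxE mulrDr. Qed.

Lemma dotvZr m (u v : 'rV[R]_m) (a : R) : dotv u (a *: v) = a * dotv u v.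
Proof. by rewrite /dotv mulr_sumr; apply: eq_bigr => i _; rewrite mxE mulrCA. Qed.

Lemma dotvDl m (u v w : 'rV[R]_m) : dotv (u + v) w = dotv u w + dotv v w.
Proof. by rewrite dotvC dotvDr !(dotvC w). Qed.

Lemma dotvZl m (u v : 'rV[R]_m) (a : R) : dotv (a *: u) v = a * dotv u v.
Proof. by rewrite dotvC dotvZr dotvC. Qed.

Lemma dotvNr m (u v : 'rV[R]_m) : dotv u (- v) = - dotv u v.
Proof. by rewrite -scaleN1r dotvZr mulN1r. Qed.

Lemma dotvBr m (u v w : 'rV[R]_m) : dotv u (v - w) = dotv u v - dotv u w.
Proof. by rewrite dotvDr dotvNr. Qed.

Lemma dotvBl m (u v w : 'rV[R]_m) : dotv (u - v) w = dotv u w - dotv v w.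
Proof. by rewrite dotvC dotvBr !(dotvC w). Qed.

Lemma dotv0l m (u : 'rV[R]_m) : dotv 0 u = 0.
Proof. by rewrite /dotv big1 // => i _; rewrite mxE mul0r. Qed.

Lemma dotv_ge0 m (u : 'rV[R]_m) : 0 <= dotv u u.
Proof. by apply: sumr_ge0 => i _; exact: sqr_ge0. Qed.

Lemma dotv_eq0 m (u : 'rV[R]_m) : dotv u u = 0 -> u = 0.
Proof.
move=> h; apply/rowP => i; rewrite mxE; apply/eqP; rewrite -sqrf_eq0 expr2.
have /eqP := h; rewrite psumr_eq0 => [/allP/(_ i)|j _]; last exact: sqr_ge0.
by apply; exact: mem_index_enum.
Qed.

Lemma dotv_gt0 m (u : 'rV[R]_m) : u != 0 -> 0 < dotv u u.
Proof. by move=> u0; rewrite lt_def dotv_ge0 andbT; apply: contra_neq u0; exact: dotv_eq0. Qed.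

Lemma dotv_base (w : pt) i : dotv w (base_vec i) = w ord0 i.
Proof.
rewrite /dotv (bigD1 i) //= big1 ?addr0 => [|j ji]; rewrite mxE eqxx /=.
  by rewrite eqxx mulr1.
by rewrite (negbTE ji) mulr0.
Qed.

(** Value at the origin and gradient of the j-th barycentric coordinate, an affine function:
    together they form the j-th column of the inverse of [homog k]. *)
Definition bary_cst k j : R := invmx (homog k) ord0 j.
Definition bary_grad k j : pt := \row_i invmx (homog k) (lift ord0 i) j.

Lemma baryE k x j : bary k x ord0 j = bary_cst k j + dotv (bary_grad k j) x.
Proof.
rewrite /bary mxE big_ord_recl; congr (_ + _).
  rewrite mxE; case: splitP => [i _|i /= /eqP]; last by [].
  by rewrite mxE (ord1 i) eqxx mul1r.
apply: eq_bigr => i _; rewrite mxE [in RHS]mxE; case: splitP => [l|l /= /eqP].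
  by rewrite (ord1 l).
by rewrite /bump /= eqSS => /eqP/val_inj ->; rewrite mulrC.
Qed.

Lemma bary_sub k x (t : R) w j :
  bary k (x - t *: w) ord0 j = bary k x ord0 j - t * dotv (bary_grad k j) w.
Proof. by rewrite !baryE dotvBr dotvZr addrA. Qed.

Lemma bary_homog k x : nondegenerate_simplex k ->
  bary k x *m homog k = row_mx (1%:M : 'M[R]_1) x :> 'rV_(1 + n.+1).
Proof. by move=> nk; rewrite /bary mulmxKV. Qed.

Lemma bary_unique k x (l : 'rV[R]_n.+2) : nondegenerate_simplex k ->
  \sum_j l ord0 j = 1 -> x = l *m k -> l = bary k x.
Proof.
move=> nk l1 xl; rewrite /bary (_ : row_mx _ x = l *m homog k :> 'rV_(1 + n.+1)); first by rewrite mulmxK.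
apply/esym; transitivity (row_mx (l *m const_mx 1 : 'M[R]_1) (l *m k)).
  exact: mul_mx_row.
rewrite -xl; congr row_mx; apply/matrixP => i j.
rewrite (ord1 i) (ord1 j) mxE [RHS]mxE eqxx; transitivity (\sum_j l ord0 j); last exact: l1.
by apply: eq_bigr => s _; rewrite mxE mulr1.
Qed.

Lemma bary_row_mx k x : nondegenerate_simplex k ->
  row_mx (bary k x *m const_mx 1 : 'M[R]_1) (bary k x *m k) = row_mx 1%:M x.
Proof.
move=> nk; rewrite -(bary_homog x nk); apply/esym; exact: mul_mx_row.
Qed.

Lemma bary_sum k x : nondegenerate_simplex k -> \sum_j bary k x ord0 j = 1.
Proof.
move=> /(bary_row_mx x) /eq_row_mx[/matrixP/(_ ord0 ord0) + _].
move=> h; transitivity ((bary k x *m const_mx 1 : 'M[R]_1) ord0 ord0); last by rewrite h mxE eqxx.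
by rewrite mxE; apply: eq_bigr => s _; rewrite [X in _ = _ * X]mxE mulr1.
Qed.

Lemma bary_comb k x : nondegenerate_simplex k -> x = bary k x *m k.
Proof. by move=> /(bary_row_mx x) /eq_row_mx[_ ->]. Qed.

Lemma faceP k I x : nondegenerate_simplex k ->
  face k I x <-> (forall j, 0 <= bary k x ord0 j) /\
                 (forall j, j \notin I -> bary k x ord0 j = 0).
Proof.
move=> nk; split.
  by move=> [l [l0 lI l1 xl]]; rewrite -(bary_unique nk l1 xl).
by move=> [h1 h2]; exists (bary k x); split => //; [exact: bary_sum|exact: bary_comb].
Qed.

Lemma cellP k x : nondegenerate_simplex k ->
  cell k x <-> (forall j, 0 <= bary k x ord0 j).
Proof.
by move=> nk; rewrite /cell faceP //; split => [[]//|h]; split => // j; rewrite inE.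
Qed.

Lemma bary_differentiable k j x : differentiable (fun x : pt => bary k x ord0 j) x.
Proof.
rewrite (_ : (fun x => _) = fun x => bary_cst k j + dotv (bary_grad k j) x); last first.
  by apply/funext => y; exact: baryE.
apply: differentiableD; first exact: differentiable_cst.
rewrite /dotv (_ : (fun x0 => _) = \sum_i (fun y : pt => bary_grad k j ord0 i * y ord0 i)); last first.
  by apply/funext => y; rewrite fct_sumE.
apply: differentiable_sum => i.
apply: differentiableM; first exact: differentiable_cst.
exact: differentiable_coord.
Qed.

Lemma bary_cts k j : continuous (fun x : pt => bary k x ord0 j).
Proof. by move=> x; apply: differentiable_continuous; exact: bary_differentiable. Qed.

(** The open simplex, given by strict inequalities so that its openness and the nullity of the
    remaining boundary are read off the barycentric coordinates. *)
Definition bary_pos k : set pt := [set x | forall j, 0 < bary k x ord0 j].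

Lemma open_bary_pos k : open (bary_pos k).
Proof.
rewrite openE => x hx.
have /= := @filter_forall pt 'I_n.+2 (fun j => [set y : pt | 0 < bary k y ord0 j]) (nbhs x) _; apply => j.
have H : nbhs (bary k x ord0 j) [set t : R | 0 < t] by exact: lt_nbhsr (hx j).
exact: (@bary_cts k j x _ H).
Qed.

Lemma bary_pos_cell k : nondegenerate_simplex k -> bary_pos k `<=` cell k.
Proof. by move=> nk x hx; apply/cellP => // j; exact: ltW. Qed.

Lemma bary_pos_interior k : nondegenerate_simplex k -> bary_pos k `<=` (cell k)°.
Proof.
move=> nk; rewrite -open_subsetE; first exact: bary_pos_cell.
exact: open_bary_pos.
Qed.

Lemma closed_cell k : nondegenerate_simplex k -> closed (cell k).
Proof.
move=> nk; rewrite (_ : cell k = \bigcap_(j in [set: 'I_n.+2])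
    ((fun x : pt => bary k x ord0 j) @^-1` `[0, +oo[%classic)).
  apply: closed_bigI => j _; apply: preimage_closed => [x _|]; last exact: interval_closed.
  exact: bary_cts.
apply/seteqP; split => x.
  by move=> /(cellP _ nk) h j _; rewrite /= in_itv /= andbT.
move=> h; apply/cellP => // j; by have := h j I; rewrite /= in_itv /= andbT.
Qed.

(** A barycentric coordinate with zero gradient would be constant, yet it is 1 at its own vertex and
    0 at another. *)
Lemma bary_grad_neq0 k j : nondegenerate_simplex k -> bary_grad k j != 0.
Proof.
move=> nk; apply/eqP => g0.
have E x : bary k x ord0 j = bary_cst k j by rewrite baryE g0 dotv0l addr0.
have V j' : bary k (row j' k) ord0 j = (j' == j)%:R.
  have <- : (delta_mx ord0 j' : 'rV[R]_n.+2) = bary k (row j' k).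
    apply: bary_unique => //; last by rewrite -rowE.
    rewrite (bigD1 j') //= big1 => [|s sj]; rewrite mxE eqxx /=.
      by rewrite eqxx addr0.
    by rewrite (negbTE sj).
  by rewrite mxE eqxx eq_sym.
have [j' jj'] : exists j', j' != j.
  by exists (lift j ord0); rewrite eq_sym neq_lift.
have := V j; rewrite E eqxx => h1; have := V j'; rewrite E h1 (negbTE jj') => /eqP.
by rewrite oner_eq0.
Qed.

(** The difference lies in the hyperplanes carrying the facets. *)
Lemma cell_bary_pos_null k : nondegenerate_simplex k ->
  vol.-negligible (cell k `\` bary_pos k).
Proof.
move=> nk.
apply: (@negligibleS _ _ _ _ (\big[setU/set0]_(j < n.+2)
   [set x | bary_cst k j + dotv (bary_grad k j) x = 0])).
  move=> x [/(cellP _ nk) h /existsNP[j hj]]; rewrite -bigcup_mkord_ord.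
  exists j => //=; have := h j; rewrite inord_val -baryE le_eqVlt => /orP[/eqP //|].
  by move=> /hj.
elim/big_ind : _ => [||j _]; [exact: negligible_set0|by move=> *; exact: negligibleU|].
apply/negligibleP; first exact: measurable_hyperplane.
by apply: hyperplane_null; exact: bary_grad_neq0.
Qed.

End simplex_geometry.

(** * Weak derivatives of finite element functions *)

Section lipschitz_gluing.
Context {R : realType}.

(* A curve that is Lipschitz on each of finitely many closed sets covering an
   interval is Lipschitz on the interval: move to the last point of the set
   containing the left end, discard this set and recurse. *)
Lemma lipschitz_cover (I : eqType) (s : seq I) (A : I -> set R) (G : R -> R) (a b L : R) :
  a <= b -> 0 <= L ->
  (forall x, a <= x <= b -> forall e, 0 < e -> exists2 d, 0 < d &
     forall y, a <= y <= b -> `|x - y| < d -> `|G x - G y| < e) ->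
  (forall i, i \in s -> closed (A i)) ->
  (forall x, a <= x <= b -> exists2 i, i \in s & A i x) ->
  (forall i x y, i \in s -> a <= x <= b -> a <= y <= b -> A i x -> A i y ->
     `|G x - G y| <= L * `|x - y|) ->
  `|G b - G a| <= L * (b - a).
Proof.
elim: {s}_.+1 {-2}s (ltnSn (size s)) a => // N IH s sN a ab L0 cG cA covA lA.
have aab : a <= a <= b by rewrite lexx.
have [i si Aia] := covA a aab.
pose S := A i `&` `[a, b]%classic.
have cS : closed S by apply: closedI; [exact: cA|exact: interval_closed].
have Sa : S a by split => //=; rewrite in_itv /= lexx.
have hS : has_sup S.
  by split; [exists a|exists b => x [_ /=]; rewrite in_itv /= => /andP[]].
pose c := sup S.
have Sc : S c.
  by rewrite [X in X c](closure_id S).1 //; apply: closure_sup; [exists a|exact: hS.2].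
have [Aic] := Sc; rewrite /= in_itv /= => /andP[ac cb].
have acb : a <= c <= b by rewrite ac cb.
have h1 : `|G c - G a| <= L * (c - a).
  by rewrite -[in X in _ <= X](ger0_norm (x := c - a)) ?subr_ge0 //; exact: lA si _ _ _ _.
suff h2 : `|G b - G c| <= L * (b - c).
  have -> : G b - G a = (G b - G c) + (G c - G a) by ring.
  by apply: le_trans (ler_normD _ _) _; apply: le_trans (lerD h2 h1) _; rewrite le_eqVlt; apply/orP; left; apply/eqP; ring.
have h3 c' : c < c' <= b -> `|G b - G c'| <= L * (b - c').
  move=> /andP[cc' c'b]; apply: (IH [seq x <- s | predC1 i x]) => //.
  - rewrite size_filter -ltnS; apply: leq_trans _ sN; rewrite ltnS.
    by rewrite -(count_predC (pred1 i) s) -[X in (X < _)%N]add0n ltn_add2r -has_count has_pred1.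
  - move=> x /andP[c'x xb] e e0.
    have [|d d0 hd] := cG x _ e e0; first by rewrite xb (le_trans ac) // ltW // (lt_le_trans cc').
    by exists d => // y /andP[c'y yb]; apply: hd; rewrite yb (le_trans ac) // ltW // (lt_le_trans cc').
  - by move=> j; rewrite mem_filter => /andP[_]; exact: cA.
  - move=> x /andP[c'x xb].
    have ax : a <= x <= b by rewrite xb (le_trans ac) // ltW // (lt_le_trans cc').
    have [j sj Ajx] := covA x ax; exists j => //; rewrite mem_filter sj andbT /=.
    apply/eqP => ji; have Sx : S x by split; [rewrite -ji|rewrite /= in_itv].
    by have := ub_le_sup hS.2 Sx; rewrite -/c leNgt (lt_le_trans cc').
  - move=> j x y; rewrite mem_filter => /andP[_ sj] /andP[c'x xb] /andP[c'y yb].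
    apply: lA => //.
      by rewrite xb (le_trans ac) // ltW // (lt_le_trans cc').
    by rewrite yb (le_trans ac) // ltW // (lt_le_trans cc').
have [cb'|bc] := ltP c b; last first.
  have -> : c = b by apply/eqP; rewrite eq_le cb.
  by rewrite !subrr normr0 mulr0.
(* The bound is known from every [c'] beyond [c]; continuity of [G] at [c] carries it to [c]
   itself. *)
rewrite leNgt; apply/negP => H.
pose e := `|G b - G c| - L * (b - c).
have e0 : 0 < e by rewrite subr_gt0.
have [d d0 hd] := cG c acb e e0.
pose c' := Num.min b (c + d / 2).
have c'1 : c < c' <= b by rewrite /c' lt_min cb' ltrDl divr_gt0 //= ge_min lexx.
have c'2 : `|c - c'| < d.
  rewrite ltr0_norm ?subr_lt0; last by case/andP: c'1.
  rewrite opprB ltrBlDl /c' gt_min; apply/orP; right; rewrite ltrD2l; lra.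
have c'3 : a <= c' <= b by case/andP: c'1 => h ->; rewrite (le_trans ac) // ltW.
have := hd c' c'3 c'2; have := h3 c' c'1.
have : L * (b - c') <= L * (b - c).
  by apply: ler_wpM2l => //; case/andP: c'1 => h _; lra.
have : `|G b - G c| <= `|G b - G c'| + `|G c - G c'|.
  have -> : G b - G c = (G b - G c') + (G c' - G c) by ring.
  by rewrite [`|G c - _|]distrC; exact: ler_normD.
by rewrite /e; lra.
Qed.

(** The factors are exchanged one at a time, the others having absolute value at most 1. Meant for
    the bubble, whose factors lie in [0, 1] on the cell. *)
Lemma prod_lipschitz (I : Type) (s : seq I) (a b : I -> R) :
  (forall i, 0 <= a i <= 1) -> (forall i, 0 <= b i <= 1) ->
  `|\prod_(i <- s) a i - \prod_(i <- s) b i| <= \sum_(i <- s) `|a i - b i|.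
Proof.
move=> ha hb; elim: s => [|i s IH]; first by rewrite !big_nil subrr normr0.
rewrite !big_cons; set p := \prod_(_ <- _) a _; set q := \prod_(_ <- _) b _.
have -> : a i * p - b i * q = (a i - b i) * p + b i * (p - q) by ring.
apply: le_trans (ler_normD _ _) _; rewrite !normrM; apply: lerD.
  rewrite ler_piMr // ger0_norm; first by apply: prodr_ile1.
  by apply: prodr_ge0 => j _; case/andP: (ha j).
apply: le_trans IH; rewrite ler_piMl // ger0_norm; case/andP: (hb i) => //.
Qed.

End lipschitz_gluing.

(** * Euclidean norm *)

Section norm2_theory.
Context {R : realType}.
Implicit Types m : nat.

Lemma norm2_ge0 m (u : 'rV[R]_m) : 0 <= norm2 u.
Proof. exact: sqrtr_ge0. Qed.

Lemma norm2_sqr m (u : 'rV[R]_m) : norm2 u ^+ 2 = dotv u u.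
Proof. by rewrite sqr_sqrtr // dotv_ge0. Qed.

Lemma norm20 m : norm2 (0 : 'rV[R]_m) = 0.
Proof. by rewrite /norm2 dotv0l sqrtr0. Qed.

Lemma norm2_eq0 m (u : 'rV[R]_m) : norm2 u = 0 -> u = 0.
Proof. by move=> h; apply: dotv_eq0; rewrite -norm2_sqr h expr0n. Qed.

Lemma dotv_le m (u v : 'rV[R]_m) : `|dotv u v| <= norm2 u * norm2 v.
Proof.
have [v0|v0] := eqVneq v 0.
  by rewrite v0 dotvC dotv0l normr0 norm20 mulr0.
have dv := dotv_gt0 v0.
rewrite -(@ler_pXn2r _ 2) // ?nnegrE ?mulr_ge0 ?norm2_ge0 //.
rewrite exprMn !norm2_sqr real_normK ?num_real //.
have := dotv_ge0 (dotv v v *: u - dotv u v *: v).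
rewrite dotvBl !dotvBr !dotvZl !dotvZr (dotvC v u).
set a := dotv v v in dv *; set b := dotv u v; set c := dotv u u => h.
have {h} : 0 <= a * (a * c - b ^+ 2) by apply: le_trans h _; rewrite le_eqVlt; apply/orP; left; apply/eqP; ring.
by rewrite pmulr_rge0 // subr_ge0 mulrC.
Qed.

Lemma norm2D m (u v : 'rV[R]_m) : norm2 (u + v) <= norm2 u + norm2 v.
Proof.
rewrite -(@ler_pXn2r _ 2) // ?nnegrE ?addr_ge0 ?norm2_ge0 //.
rewrite sqrrD !norm2_sqr dotvDl !dotvDr (dotvC v u).
by have := le_trans (ler_norm _) (dotv_le u v); lra.
Qed.

Lemma norm2Z m (u : 'rV[R]_m) (a : R) : norm2 (a *: u) = `|a| * norm2 u.
Proof. by rewrite /norm2 dotvZl dotvZr mulrA -expr2 sqrtrM ?sqr_ge0 // sqrtr_sqr. Qed.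

Lemma norm2N m (u : 'rV[R]_m) : norm2 (- u) = norm2 u.
Proof. by rewrite -scaleN1r norm2Z normrN1 mul1r. Qed.

Lemma norm2B m (u v : 'rV[R]_m) : norm2 (u - v) <= norm2 u + norm2 v.
Proof. by rewrite -(norm2N v); exact: norm2D. Qed.

Lemma norm2_dist m (u v : 'rV[R]_m) : `|norm2 u - norm2 v| <= norm2 (u - v).
Proof.
have h1 := norm2D (u - v) v; have h2 := norm2D (v - u) u.
rewrite -(norm2N (v - u)) opprB in h2; rewrite !subrK in h1 h2.
by rewrite ler_norml; apply/andP; split; lra.
Qed.

Lemma coord_le_norm2 m (u : 'rV[R]_m) i : `|u ord0 i| <= norm2 u.
Proof.
rewrite -(@ler_pXn2r _ 2) // ?nnegrE ?norm2_ge0 // norm2_sqr real_normK ?num_real //.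
by rewrite /dotv (bigD1 i) //= expr2 lerDl; apply: sumr_ge0 => j _; exact: sqr_ge0.
Qed.

Lemma norm2_le_sum m (u : 'rV[R]_m) : norm2 u <= \sum_i `|u ord0 i|.
Proof.
have {1}-> : u = \sum_i u ord0 i *: delta_mx ord0 i by exact: row_sum_delta.
apply: (@le_trans _ _ (\sum_i norm2 (u ord0 i *: (delta_mx ord0 i : 'rV[R]_m)))).
  elim/big_ind2: _ => [|x1 x2 y1 y2 h1 h2|//]; first by rewrite norm20.
  by apply: le_trans (norm2D _ _) _; exact: lerD.
apply: ler_sum => i _; rewrite norm2Z (_ : norm2 _ = 1) ?mulr1 //.
rewrite /norm2 /dotv (bigD1 i) //= big1 ?addr0 => [|j ji]; rewrite !mxE eqxx /=.
  by rewrite eqxx mulr1 sqrtr1.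
by rewrite (negbTE ji) mul0r.
Qed.

End norm2_theory.

Section discrete_functions.
Context {R : realType} {n : nat}.
Local Notation pt := 'rV[R]_n.+1.
Local Notation vol := (leb R n.+1).
Implicit Types (D : set pt) (T : mesh R n) (k : simplex R n) (f q : pt -> R).

(** A Lipschitz boundary excludes slits and punctures. If a point [x] outside [D] were interior to
    the closure, moving from [x] against the direction [e] would lead strictly below the graph, to a
    point of the closure with a neighbourhood that misses [D]. *)
Lemma interior_closure D : open D -> lipschitz_boundary D -> (closure D)° `<=` D.
Proof.
move=> oD lD x hx; apply: contrapT => Dx.
have xD : closure D x by exact: interior_subset hx.
have [|e [phi [L [r [e1 r0 hphi hD]]]]] := lD x.
  by split => // h; apply: Dx; exact: interior_subset h.
have ee : dotv e e = 1 by rewrite -norm2_sqr e1 expr1n.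
set z := x - dotv x e *: e.
have hz : dotv x e <= phi z.
  rewrite leNgt; apply/negP => h; apply: Dx; apply/hD => //.
  by rewrite subrr norm20.
have [d d0 hd] := nbhs_rV hx.
pose s := Num.min (r / 2) (d / 2).
have s0 : 0 < s by rewrite lt_min !divr_gt0.
have sr : s <= r / 2 by rewrite ge_min lexx.
have sd : s <= d / 2 by rewrite ge_min lexx orbT.
pose y := x - s *: e.
have yD : closure D y.
  apply: hd => i; rewrite /y !mxE opprB addrCA subrr addr0 normrM (gtr0_norm s0).
  have : `|e ord0 i| <= 1 by rewrite -e1; exact: coord_le_norm2.
  move=> h; apply: (@le_lt_trans _ _ s); first by rewrite ler_piMr // ltW.
  lra.
(* A perturbation [v] moves the projection to the hyperplane by at most 2|v| and the height by at
   most |v|, so the gap to the graph changes by at most [L'] |v|. The choice of [eta] keeps this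
   below s/2. *)
pose L' := 2 * `|L| + 1.
have L'0 : 0 < L' by rewrite /L' ltr_wpDl // mulr_ge0.
pose eta := Num.min (s / (2 * L')) (r / 4).
have eta0 : 0 < eta by rewrite lt_min !divr_gt0 // mulr_gt0.
have eta1 : L' * eta <= s / 2.
  have : eta <= s / (2 * L') by rewrite ge_min lexx.
  by rewrite ler_pdivlMr ?mulr_gt0 // => h; lra.
have eta2 : eta <= r / 4 by rewrite ge_min lexx orbT.
have nB : nbhs y [set w : pt | norm2 (w - y) < eta].
  have e' : 0 < eta / n.+2%:R by rewrite divr_gt0.
  apply/nbhs_ballP; exists (eta / n.+2%:R) => // w /(rV_ballE _ _ e') hw /=.
  apply: le_lt_trans (norm2_le_sum _) _.
  apply: (@le_lt_trans _ _ (\sum_(i < n.+1) eta / n.+2%:R)).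
    apply: ler_sum => i _; have -> : (w - y) ord0 i = w ord0 i - y ord0 i.
      by rewrite mxE [(- y) _ _]mxE.
    by rewrite distrC; apply: ltW; exact: hw.
  rewrite sumr_const card_ord -[X in X < _]mulr_natr -mulrA gtr_pMr //.
  by rewrite mulrC ltr_pdivrMr // mul1r ltr_nat.
have [w [Dw hw]] := yD _ nB; move: hw => /= hw.
pose v := w - y.
have wE : w = x - s *: e + v by rewrite /v addrC subrK.
have dv : `|dotv v e| <= norm2 v by rewrite -[X in _ <= X]mulr1 -e1; exact: dotv_le.
have hv : norm2 v < eta by [].
have dw : dotv w e = dotv x e - s + dotv v e.
  by rewrite wE dotvDl dotvBl dotvZl ee mulr1.
have pw : w - dotv w e *: e - z = v - dotv v e *: e.
  rewrite dw wE /z !scalerDl !scaleNr; apply/rowP => i; rewrite !mxE; ring.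
have wr : norm2 (w - x) < r.
  have -> : w - x = v - s *: e by rewrite wE; apply/rowP => i; rewrite !mxE; ring.
  apply: le_lt_trans (norm2B _ _) _; rewrite norm2Z e1 mulr1 gtr0_norm //; lra.
have /(hD _ wr) := Dw; apply/negP; rewrite -leNgt.
have h1 : `|phi (w - dotv w e *: e) - phi z| <= `|L| * (2 * norm2 v).
  apply: le_trans (hphi _ _) _; rewrite pw.
  apply: (@le_trans _ _ (`|L| * norm2 (v - dotv v e *: e))).
    by rewrite ler_wpM2r ?norm2_ge0 // ler_norm.
  rewrite ler_wpM2l //; apply: le_trans (norm2B _ _) _; rewrite norm2Z e1 mulr1; lra.
have h2 : `|L| * (2 * norm2 v) <= 2 * `|L| * eta.
  by rewrite mulrA [`|L| * 2]mulrC ler_wpM2l ?mulr_ge0 // ltW.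
move: eta1; rewrite /L' mulrDl mul1r => eta1.
have h3 := ler_norm (dotv v e).
have := h1; rewrite ler_norml => /andP[h4 _].
lra.
Qed.

Lemma cell_interior_sub D T k : open D -> lipschitz_boundary D ->
  triangulates D T -> k \in T -> (cell k)° `<=` D.
Proof.
move=> oD lD [_ _ cT _] kT; apply: subset_trans (interior_closure oD lD).
by apply: interiorS; rewrite cT => x kx; exists k.
Qed.

(** An open set of full measure in the domain, on which discrete functions are polynomial near every
    point. *)
Definition mesh_interior T : set pt := [set x | exists2 k, k \in T & bary_pos k x].

Lemma open_mesh_interior T : open (mesh_interior T).
Proof.
rewrite (_ : mesh_interior T = \bigcup_(k in [set` T]) bary_pos k).
  by apply: bigcup_open => k _; exact: open_bary_pos.
by apply/seteqP; split => x [k ? ?]; exists k.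
Qed.

Lemma mesh_interior_sub D T : open D -> lipschitz_boundary D ->
  triangulates D T -> mesh_interior T `<=` D.
Proof.
move=> oD lD tT x [k kT kx]; have [_ nT _ _] := tT.
apply: (cell_interior_sub oD lD tT kT); exact: (bary_pos_interior (nT _ kT)).
Qed.

Lemma mesh_interior_ae D T : triangulates D T ->
  {ae vol, forall x, closure D x -> mesh_interior T x}.
Proof.
move=> [_ nT cT _].
apply: (@negligibleS _ _ _ _ (\big[setU/set0]_(k <- T | k \in T) (cell k `\` bary_pos k))).
  move=> x /= /not_implyP[]; rewrite cT => -[k kT kx] nx.
  rewrite -bigcup_seq_cond; exists k; first by rewrite /= kT.
  by split => // h; apply: nx; exists k.
elim/big_ind : _ => [||k kT]; [exact: negligible_set0|by move=> *; exact: negligibleU|].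
by apply: cell_bary_pos_null; exact: nT.
Qed.

Lemma bary01 k x j : nondegenerate_simplex k -> cell k x -> 0 <= bary k x ord0 j <= 1.
Proof.
move=> nk /(cellP _ nk) h; rewrite h -(bary_sum x nk) (bigD1 j) //= lerDl.
by apply: sumr_ge0 => i _.
Qed.

(** The barycentric coordinates lie in [0, 1] on the cell, so the bubble is Lipschitz there with the
    sum of the norms of their gradients. *)
Lemma P1b_line_lipschitz k q : nondegenerate_simplex k -> P1b_on k q ->
  exists2 L : R, 0 <= L & forall i x (s t : R),
    cell k (x - s *: base_vec i) -> cell k (x - t *: base_vec i) ->
    `|q (x - s *: base_vec i) - q (x - t *: base_vec i)| <= L * `|s - t|.
Proof.
move=> nk [a [w [c hq]]].
pose L := norm2 w + `|c| * \sum_j norm2 (bary_grad k j).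
exists L => [|i x s t ks kt].
  by rewrite addr_ge0 ?norm2_ge0 // mulr_ge0 // sumr_ge0 // => j _; exact: norm2_ge0.
rewrite !hq // !dotvBr !dotvZr !dotv_base.
set b1 := bubble _ _; set b2 := bubble _ _; set wx := dotv w x.
have -> : a + (wx - s * w ord0 i) + c * b1 - (a + (wx - t * w ord0 i) + c * b2) =
  (t - s) * w ord0 i + c * (b1 - b2) by ring.
apply: le_trans (ler_normD _ _) _; rewrite /L [X in _ <= X]mulrDl !normrM; apply: lerD.
  by rewrite mulrC distrC ler_wpM2r //; exact: coord_le_norm2.
rewrite -mulrA ler_wpM2l // mulr_suml.
apply: (@le_trans _ _ (\sum_j `|bary k (x - s *: base_vec i) ord0 j - bary k (x - t *: base_vec i) ord0 j|)).
  by apply: prod_lipschitz => j; exact: bary01.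
apply: ler_sum => j _; rewrite !bary_sub dotv_base.
have -> (B g : R) : B - s * g - (B - t * g) = g * (t - s) by ring.
by rewrite normrM distrC ler_wpM2r //; exact: coord_le_norm2.
Qed.

Lemma within_continuous_eps D f x e : {within D, continuous f} -> D x -> 0 < e ->
  exists2 d : R, 0 < d & forall y, D y -> (forall i, `|x ord0 i - y ord0 i| < d) ->
    `|f x - f y| < e.
Proof.
move=> /subspace_continuousP cf Dx e0.
have /cvgrPdist_lt/(_ e e0) := cf x Dx.
rewrite near_withinE => /nbhs_rV[d d0 hd]; exists d => // y Dy hy.
exact: hd.
Qed.

(** A line meets each cell in a closed set, on which the function is Lipschitz with a bound common
    to all cells; [lipschitz_cover] glues the pieces by continuity. *)
Lemma discrete_line_lipschitz D T f : triangulates D T ->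
  {within closure D, continuous f} -> (forall k, k \in T -> P1b_on k f) ->
  exists2 L : R, 0 <= L & forall i x t, 0 < t ->
    (forall s, 0 <= s <= t -> D (x - s *: base_vec i)) ->
    `|f (x - t *: base_vec i) - f x| <= L * t.
Proof.
move=> [_ nT cT _] cf hf.
have [L L0 hL] : exists2 L : R, 0 <= L & forall k, k \in T ->
  forall i x (s t : R),
    cell k (x - s *: base_vec i) -> cell k (x - t *: base_vec i) ->
    `|f (x - s *: base_vec i) - f (x - t *: base_vec i)| <= L * `|s - t|.
  elim: T nT hf {cT} => [|k T IH] nT hf; first by exists 0.
  have [||L1 L10 h1] := IH; first by move=> k' k'T; apply: nT; rewrite inE k'T orbT.
    by move=> k' k'T; apply: hf; rewrite inE k'T orbT.
  have [||L2 L20 h2] := @P1b_line_lipschitz k f; first by apply: nT; rewrite inE eqxx.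
    by apply: hf; rewrite inE eqxx.
  exists (L1 + L2); first exact: addr_ge0.
  move=> k'; rewrite inE => /orP[/eqP ->|k'T] i x s t hs ht; rewrite mulrDl.
    by apply: le_trans (h2 i x s t hs ht) _; rewrite lerDr mulr_ge0.
  by apply: le_trans (h1 _ k'T i x s t hs ht) _; rewrite lerDl mulr_ge0.
exists L => // i x t t0 hD.
pose G (s : R) := f (x - s *: base_vec i).
have := @lipschitz_cover R _ T (fun k => [set s : R | cell k (x - s *: base_vec i)]) G 0 t L (ltW t0) L0.
rewrite /G scale0r !subr0; apply.
- move=> s st e e0.
  have [d d0 hd] := within_continuous_eps cf (subset_closure (hD s st)) e0.
  exists d => // s' st' ss'; apply: hd; first by apply: subset_closure; exact: hD.
  move=> j; rewrite !mxE.
  have -> (X b : R) : X - s * b - (X - s' * b) = (s' - s) * b by ring.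
  rewrite normrM distrC; apply: le_lt_trans ss'; rewrite ler_piMr //.
  by case: (_ && _); rewrite ?normr1 ?normr0.
- move=> k kT; rewrite (_ : [set s | _] = (fun s : R => x - s *: base_vec i) @^-1` cell k) //.
  apply: preimage_closed => [s _|]; last by apply: closed_cell; exact: nT.
  apply: cvgB; first exact: cvg_cst.
  by apply: cvgZr_tmp.
- move=> s st; have : closure D (x - s *: base_vec i) by apply: subset_closure; exact: hD.
  by rewrite cT => -[k kT kx]; exists k.
- by move=> k s s' kT _ _ hs hs'; exact: (hL k kT i x s s' hs hs').
Qed.

Lemma bubble_differentiable k x : differentiable (bubble k) x.
Proof.
rewrite /bubble.
elim: (index_enum _) => [|j s IH].
  by under eq_fun do rewrite big_nil; exact: differentiable_cst.
under eq_fun do rewrite big_cons.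
apply: differentiableM => //; exact: bary_differentiable.
Qed.

Lemma dotv_differentiable (w x : pt) : differentiable (dotv w) x.
Proof.
rewrite /dotv; elim: (index_enum _) => [|j s IH].
  by under eq_fun do rewrite big_nil; exact: differentiable_cst.
under eq_fun do rewrite big_cons.
apply: differentiableD => //; apply: differentiableM; first exact: differentiable_cst.
exact: differentiable_coord.
Qed.

Lemma P1b_derivable k q x v : P1b_on k q -> (cell k)° x -> derivable q x v.
Proof.
move=> [a [w [c hq]]] kx.
pose Q := fun x => a + dotv w x + c * bubble k x.
have dQ : differentiable Q x.
  apply: differentiableD.
    by apply: differentiableD; [exact: differentiable_cst|exact: dotv_differentiable].
  by apply: differentiableM; [exact: differentiable_cst|exact: bubble_differentiable].
apply: (@near_eq_derivable _ _ _ Q q x v); last exact: diff_derivable.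
have : nbhs x (cell k) by [].
by apply: filterS => y ky; rewrite hq.
Qed.

Lemma derivable_quotient f x v : derivable f x v ->
  k.+1%:R * (f x - f (x - k.+1%:R^-1 *: v)) @[k --> \oo] --> 'D_v f x.
Proof.
move=> df; pose t (k : nat) : R := - k.+1%:R^-1.
have ht : t @ \oo --> (0 : R)^'.
  move=> A hA; have h0 : t @ \oo --> (0 : R).
    by rewrite -[X in _ --> X]oppr0; apply: cvgN; exact: cvg_harmonic.
  have : \forall k \near \oo, t k != 0 -> A (t k) by exact: h0 hA.
  by apply: filterS => k; apply; rewrite oppr_eq0 gt_eqF // invr_gt0.
have := cvg_comp _ _ ht df.
apply: cvg_trans; apply: near_eq_cvg; near=> k.
change ((- k.+1%:R^-1 : R)^-1 * (f (- k.+1%:R^-1 *: v + x) - f x) =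
  k.+1%:R * (f x - f (x - k.+1%:R^-1 *: v))).
by rewrite invrN invrK scaleNr [- _ + x]addrC mulNr -mulrN opprB.
Unshelve. all: by end_near. Qed.

(** A pointwise limit of measurable difference quotients. Around a fixed point of [O] the shifted
    points are eventually inside, where the extension by 0 agrees with [f]. *)
Lemma measurable_pd D (O : set pt) f i : measurable D -> open O -> O `<=` D ->
  measurable_fun D f -> (forall x, O x -> derivable f x (base_vec i)) ->
  measurable_fun O (pd i f).
Proof.
move=> mD oO OD mf df; pose f' := patch (fun=> 0) D f.
have mf' : measurable_fun setT f'.
  have := (measurable_restrictT f mD).1 mf; congr measurable_fun.
have mO := open_measurable_rV oO.
apply: (@measurable_fun_cvg _ _ R O (fun (k : nat) x => k.+1%:R * (f' x - f' (shift_rV i (- k.+1%:R^-1) x)))).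
  move=> k; apply: measurable_funTS; apply: measurable_funM => //.
  apply: measurable_funB => //; apply: measurableT_comp => //; exact: measurable_shift_rV.
move=> x Ox; have := derivable_quotient (df x Ox).
apply: cvg_trans; apply: near_eq_cvg.
have sO : [set x] `<=` O by move=> _ ->.
have [k0 _ hk0] := compact_shift_in (base_vec i) oO (@compact_set1 _ x) sO.
near=> k; rewrite shift_rVN /f' /patch (mem_set (OD _ Ox)).
have kk : (k0 <= k)%N by near: k; exact: nbhs_infty_ge.
rewrite mem_set //; apply: OD; apply: (hk0 k kk x erefl).
by rewrite lexx invr_ge0 ler0n.
Unshelve. all: by end_near. Qed.

Lemma bounded_closure_compact D : bounded_set D -> compact (closure D).
Proof.
move=> bD; apply: bounded_closed_compact; last exact: closed_closure.
have [M M0 DM] := bounded_box bD.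
have cM : closure D `<=` cbox (const_mx (- M)) (const_mx M).
  rewrite [X in _ `<=` X](closure_id _).1; last exact: closed_cbox.
  by apply: closure_subset; apply: subset_trans DM _; exact: box_cbox.
have := compact_bounded (@compact_cbox R n (const_mx (- M)) (const_mx M)).
by move=> [N [Nr hN]]; exists N; split => // M' NM' x /cM; exact: hN.
Qed.

Lemma within_cts_bounded D f : compact D -> {within D, continuous f} ->
  exists2 M : R, 0 <= M & forall x, D x -> `|f x| <= M.
Proof.
move=> cD cf; have [[x0 Dx0]|D0] := pselect (D !=set0); last first.
  by exists 0 => // x Dx; exfalso; apply: D0; exists x.
have cn : {within D, continuous (fun x => `|f x|)}.
  by move=> x; apply: continuous_comp; [exact: cf|exact: norm_continuous].
have [c Kc hc] := @EVT_max_rV R n.+1 (fun x => `|f x|) D (ex_intro _ x0 Dx0) cD cn.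
by exists `|f c| => // x Dx; apply: hc; rewrite inE.
Qed.

Lemma integrable_bounded D f (M : R) : measurable D -> (vol D < +oo)%E ->
  measurable_fun D f -> (forall x, D x -> `|f x| <= M) -> vol.-integrable D (EFin \o f).
Proof.
move=> mD fD mf hM; apply: le_integrable (integrable_cst_fin `|M| mD fD) => //.
  exact/measurable_EFinP.
by move=> x Dx /=; rewrite lee_fin normr_id (le_trans (hM x Dx)) // ler_norm.
Qed.

(** The candidate [G] is the classical derivative on the open cells and 0 on the null remainder.
    Continuity across the cells enters through the Lipschitz bound along lines, which also bounds
    [G]. *)
Theorem discrete_is_wpd D T f i : open D -> bounded_set D -> lipschitz_boundary D ->
  triangulates D T -> {within closure D, continuous f} ->
  (forall k, k \in T -> P1b_on k f) ->
  exists G, exists L : R, [/\ is_wpd D i f G, measurable_fun D G,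
    forall x, `|G x| <= L & forall x, mesh_interior T x -> G x = pd i f x].
Proof.
move=> oD bD lD tT cf hf.
have mD := open_measurable_rV oD.
have fD : (vol D < +oo)%E by exact: bounded_leb_fin.
have [L L0 hL] := discrete_line_lipschitz tT cf hf.
have UD := mesh_interior_sub oD lD tT.
have oU := open_mesh_interior (T := T).
have mU := open_measurable_rV oU.
have mf : measurable_fun D f.
  apply: (@measurable_funS _ _ _ _ (closure D)); [|exact: subset_closure|].
    by apply: closed_measurable_rV; exact: closed_closure.
  apply: continuous_measurable_rV => //; apply: closed_measurable_rV; exact: closed_closure.
have [M M0 hM] := within_cts_bounded (bounded_closure_compact bD) cf.
have df x v : mesh_interior T x -> derivable f x v.
  move=> [k kT kx]; apply: (@P1b_derivable k f x v (hf k kT)).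
  by apply: bary_pos_interior kx; case: tT => _ nT _ _; exact: nT.
pose G := patch (fun=> 0) (mesh_interior T) (pd i f).
have mG : measurable_fun setT G.
  have mp : measurable_fun (mesh_interior T) (pd i f).
    by apply: (measurable_pd mD oU UD mf) => x; exact: df.
  have := (measurable_restrictT (pd i f) mU).1 mp; congr measurable_fun.
have hG x : `|G x| <= L.
  rewrite /G /patch; case: ifPn => [|_]; last by rewrite normr0.
  rewrite inE => Ux.
  have := cvg_norm (derivable_quotient (df x (base_vec i) Ux)).
  rewrite -/(pd i f x) => hc; rewrite -(cvg_lim (@norm_hausdorff _ _) (hc _)).
  apply: limr_le; first by apply/cvg_ex; exists `|pd i f x|; exact: hc.
  have sU : [set x] `<=` D by move=> _ ->; exact: UD.
  have [k0 _ hk0] := compact_shift_in (base_vec i) oD (@compact_set1 _ x) sU.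
  near=> k; rewrite /= normrM ger0_norm // distrC.
  rewrite -ler_pdivlMl // mulrC; apply: hL; first by rewrite invr_gt0.
  move=> s hs; apply: (hk0 k) => //=; near: k; exact: nbhs_infty_ge.
exists G, L; split => //.
- apply: (lipschitz_is_wpd (L := L)) => //.
  + by apply: (integrable_bounded (M := M)) => // x Dx; apply: hM; exact: subset_closure.
  + move=> A cA AD; apply: (@integrable_bounded A G L) => //.
    * exact: compact_measurable_rV.
    * by apply: bounded_leb_fin; [exact: compact_measurable_rV|exact: compact_bounded].
    * exact: measurable_funTS.
  + by move=> x t; exact: hL.
  + apply: filterS (mesh_interior_ae tT) => x h Dx.
    have Ux := h (subset_closure Dx).
    by rewrite /G /patch mem_set //; apply: derivable_quotient; exact: df.
- exact: measurable_funTS.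
- by move=> x Ux; rewrite /G /patch mem_set.
Unshelve. all: by end_near. Qed.

Lemma smooth_is_wpd D f i (M L : R) : open D -> bounded_set D -> smooth f ->
  (forall x, `|f x| <= M) -> (forall x, `|pd i f x| <= L) -> is_wpd D i f (pd i f).
Proof.
move=> oD bD sf hM hL.
have mD := open_measurable_rV oD.
have fD : (vol D < +oo)%E by exact: bounded_leb_fin.
apply: (lipschitz_is_wpd (L := L)) => //.
- apply: (integrable_bounded mD fD) => [|x _]; last exact: hM.
  by apply: measurable_funTS; exact: smooth_measurable.
- move=> A cA AD; apply: (@integrable_bounded A (pd i f) L) => //.
  + exact: compact_measurable_rV.
  + by apply: bounded_leb_fin; [exact: compact_measurable_rV|exact: compact_bounded].
  + by apply: measurable_funTS; apply: smooth_measurable; exact: smooth_pd.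
- move=> x t t0 _; rewrite -scalerN.
  have := @smooth_line_lipschitz _ _ f L x (- base_vec i) t sf _ (ltW t0); apply => y.
  suff -> : 'D_(- base_vec i) f y = - pd i f y by rewrite normrN.
  have dy : differentiable f y by exact: (sf [::]).
  by rewrite /pd !deriveE // linearN.
- apply: aeW => x _; apply: derivable_quotient; apply: diff_derivable; exact: (sf [::]).
Qed.

End discrete_functions.

(** * Lebesgue and Sobolev spaces *)

Section square_integrable.
Context {R : realType} {n : nat}.
Local Notation pt := 'rV[R]_n.+1.
Local Notation vol := (leb R n.+1).
Variable D : set pt.
Implicit Types (f g h : pt -> R) (v w z : pt -> pt).

(** Square-integrable functions with real-valued norms: on these classes [N2] and [NV] agree with
    the extended-real norms of exponent 2, see [Lp2E] and [LpV2E], so that estimates can be made in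
    the field. *)
Definition L2f f := measurable_fun D f /\ vol.-integrable D (EFin \o (fun x => f x ^+ 2)).
Definition L2v v := forall i, L2f (component v i).
Definition bnd f := measurable_fun D f /\
  exists M : R, {ae vol, forall x, D x -> `|f x| <= M}.
Definition N2 f : R := Num.sqrt (l2 D f f).
Definition NV v : R := Num.sqrt (l2V D v v).

Hypothesis mD : measurable D.
Hypothesis fD : (vol D < +oo)%E.

Lemma ae_le_integrable f g : measurable_fun D f -> vol.-integrable D (EFin \o g) ->
  {ae vol, forall x, D x -> `|f x| <= g x} -> vol.-integrable D (EFin \o f).
Proof.
move=> mf /integrableP[mg ig] fg; apply/integrableP; split; first exact/measurable_EFinP.
apply: le_lt_trans ig; apply: ae_ge0_le_integral => //.
- by apply/measurable_EFinP; apply: measurableT_comp.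
- by apply: measurableT_comp.
- apply: filterS fg => x h Dx /=; rewrite lee_fin.
  exact: le_trans (h Dx) (ler_norm _).
Qed.

Lemma ae_le_Rintegral f g : measurable_fun D f -> vol.-integrable D (EFin \o g) ->
  {ae vol, forall x, D x -> `|f x| <= g x} ->
  `|\int[vol]_(x in D) f x| <= \int[vol]_(x in D) g x.
Proof.
move=> mf ig fg; have if_ := ae_le_integrable mf ig fg.
rewrite -lee_fin /Rintegral -abse_EFin.
rewrite fineK; last exact: integrable_fin_num.
rewrite fineK; last exact: integrable_fin_num.
apply: le_trans (le_abse_integral _ mD _) _; first exact/measurable_EFinP.
have mg : measurable_fun D g by apply/measurable_EFinP; exact: measurable_int ig.
rewrite [leRHS](_ : _ = (\int[vol]_(x in D) `|(g x)%:E|)%E).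
  apply: ae_ge0_le_integral => //.
  - by apply/measurable_EFinP; apply: measurableT_comp.
  - by apply/measurable_EFinP; apply: measurableT_comp.
  apply: filterS fg => x h Dx /=; rewrite lee_fin.
  exact: le_trans (h Dx) (ler_norm _).
apply: ae_eq_integral => //.
- exact/measurable_EFinP.
- by apply/measurable_EFinP; apply: measurableT_comp.
- apply: filterS fg => x h Dx /=; rewrite ger0_norm //; exact: le_trans (h Dx).
Qed.

Lemma ae_eq_Rintegral f g : measurable_fun D f -> measurable_fun D g ->
  {ae vol, forall x, D x -> f x = g x} ->
  \int[vol]_(x in D) f x = \int[vol]_(x in D) g x.
Proof.
move=> mf mg fg; congr fine; apply: ae_eq_integral => //; try exact/measurable_EFinP.
by apply: filterS fg => x h /h ->.
Qed.

Lemma ae_ge0_Rintegral f : measurable_fun D f -> {ae vol, forall x, D x -> 0 <= f x} ->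
  0 <= \int[vol]_(x in D) f x.
Proof.
move=> mf f0; rewrite (@ae_eq_Rintegral f (fun x => `|f x|)) //.
- by apply: Rintegral_ge0.
- by apply: measurableT_comp.
- by apply: filterS f0 => x h /h /ger0_norm ->.
Qed.

Lemma integrable_addf f g : vol.-integrable D (EFin \o f) -> vol.-integrable D (EFin \o g) ->
  vol.-integrable D (EFin \o (fun x => f x + g x)).
Proof. exact: integrableD. Qed.

Lemma integrable_mulcf c f : vol.-integrable D (EFin \o f) ->
  vol.-integrable D (EFin \o (fun x => c * f x)).
Proof. by move=> h; have := integrableZl mD c h. Qed.

Lemma integrable_cst_D c : vol.-integrable D (EFin \o (fun=> c : R)).
Proof.
apply/integrableP; split; first exact: measurable_cst.
by rewrite integral_cst // lte_mul_pinfty.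
Qed.

Lemma bnd_integrable f : bnd f -> vol.-integrable D (EFin \o f).
Proof. by move=> [mf [M fM]]; apply: ae_le_integrable (integrable_cst_D M) fM. Qed.

Lemma bndD f g : bnd f -> bnd g -> bnd (fun x => f x + g x).
Proof.
move=> [mf [M fM]] [mg [L gL]]; split; first exact: measurable_funD.
exists (M + L); apply: filterS2 fM gL => x h1 h2 Dx.
by rewrite (le_trans (ler_normD _ _)) // lerD ?h1 ?h2.
Qed.

Lemma bndM f g : bnd f -> bnd g -> bnd (fun x => f x * g x).
Proof.
move=> [mf [M fM]] [mg [L gL]]; split; first exact: measurable_funM.
exists (M * L); apply: filterS2 fM gL => x h1 h2 Dx.
by rewrite normrM ler_pM ?h1 ?h2.
Qed.

Lemma bnd_cst c : bnd (fun=> c).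
Proof. by split; [exact: measurable_cst|exists `|c|; exact: aeW]. Qed.

Lemma bnd_sum (I : Type) (r : seq I) (F : I -> pt -> R) : (forall i, bnd (F i)) ->
  bnd (fun x => \sum_(i <- r) F i x).
Proof.
move=> h; elim: r => [|i r IH].
  under eq_fun do rewrite big_nil; exact: bnd_cst.
by under eq_fun do rewrite big_cons; exact: bndD.
Qed.

Lemma L2fM f g : L2f f -> L2f g -> vol.-integrable D (EFin \o (fun x => f x * g x)).
Proof.
move=> [mf i1] [mg i2].
apply: (@ae_le_integrable _ (fun x => f x ^+ 2 + g x ^+ 2)).
- exact: measurable_funM.
- exact: integrable_addf.
- apply: aeW => x Dx; rewrite normrM -(real_normK (num_real (f x))) -(real_normK (num_real (g x))).
  have := sqr_ge0 (`|f x| - `|g x|); have := sqr_ge0 (`|f x| + `|g x|); nra.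
Qed.

Lemma bndL2M f g : bnd f -> L2f g -> L2f (fun x => f x * g x).
Proof.
move=> [mf [M fM]] [mg ig]; split; first exact: measurable_funM.
apply: (@ae_le_integrable _ (fun x => M ^+ 2 * g x ^+ 2)).
- by apply: measurable_funX; exact: measurable_funM.
- exact: integrable_mulcf.
apply: filterS fM => x h Dx.
rewrite normrX normrM exprMn (real_normK (num_real (g x))) ler_wpM2r ?sqr_ge0 //.
by rewrite lerXn2r ?nnegrE ?h // (le_trans _ (h Dx)).
Qed.

Lemma bnd_L2 f : bnd f -> L2f f.
Proof.
move=> bf; split; first by case: bf.
by apply: bnd_integrable; under eq_fun do rewrite expr2; exact: bndM.
Qed.

Lemma L2D f g : L2f f -> L2f g -> L2f (fun x => f x + g x).
Proof.
move=> lf lg; split; first by apply: measurable_funD; [case: lf|case: lg].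
rewrite (_ : (fun x => _) = fun x => f x ^+ 2 + (2 * (f x * g x) + g x ^+ 2)); last first.
  by apply/funext => x; ring.
apply: integrable_addf; first by case: lf.
apply: integrable_addf; last by case: lg.
by apply: integrable_mulcf; exact: L2fM.
Qed.

Lemma L2Z c f : L2f f -> L2f (fun x => c * f x).
Proof. by move=> lf; apply: bndL2M => //; exact: bnd_cst. Qed.

Lemma L2N f : L2f f -> L2f (fun x => - f x).
Proof. by move=> /(@L2Z (-1)); under eq_fun do rewrite mulN1r. Qed.

Lemma L2B f g : L2f f -> L2f g -> L2f (fun x => f x - g x).
Proof. by move=> lf lg; apply: L2D => //; exact: L2N. Qed.

Lemma L2_sum (I : Type) (r : seq I) (F : I -> pt -> R) : (forall i, L2f (F i)) ->
  L2f (fun x => \sum_(i <- r) F i x).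
Proof.
move=> h; elim: r => [|i r IH].
  under eq_fun do rewrite big_nil; apply: bnd_L2; exact: bnd_cst.
by under eq_fun do rewrite big_cons; exact: L2D.
Qed.

Lemma ae_le_L2 f g : measurable_fun D f -> L2f g ->
  {ae vol, forall x, D x -> `|f x| <= `|g x|} -> L2f f.
Proof.
move=> mf [mg ig] fg; split => //; apply: ae_le_integrable ig _.
  exact: measurable_funX.
apply: filterS fg => x h Dx; rewrite normrX -[leRHS]real_normK ?num_real //.
by rewrite lerXn2r ?nnegrE ?h.
Qed.

Lemma L2abs f : L2f f -> L2f (fun x => `|f x|).
Proof.
move=> lf; apply: ae_le_L2 (lf) _; first by apply: measurableT_comp => //; case: lf.
by apply: aeW => x _; rewrite normr_id.
Qed.

Lemma l2C f g : l2 D f g = l2 D g f.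
Proof. by apply: eq_Rintegral => x _; rewrite mulrC. Qed.

Lemma l2Dl f g h : L2f f -> L2f g -> L2f h ->
  l2 D (fun x => f x + g x) h = l2 D f h + l2 D g h.
Proof.
move=> lf lg lh; rewrite /l2 -RintegralD //; try exact: L2fM.
by apply: eq_Rintegral => x _; rewrite mulrDl.
Qed.

Lemma l2Zl c f h : L2f f -> L2f h -> l2 D (fun x => c * f x) h = c * l2 D f h.
Proof.
move=> lf lh; rewrite /l2 -RintegralZl //; last exact: L2fM.
by apply: eq_Rintegral => x _; rewrite mulrA.
Qed.

Lemma l2Bl f g h : L2f f -> L2f g -> L2f h ->
  l2 D (fun x => f x - g x) h = l2 D f h - l2 D g h.
Proof.
move=> lf lg lh; rewrite /l2 -RintegralB //; try exact: L2fM.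
by apply: eq_Rintegral => x _; rewrite mulrBl.
Qed.

Lemma l2Dr f g h : L2f f -> L2f g -> L2f h ->
  l2 D h (fun x => f x + g x) = l2 D h f + l2 D h g.
Proof. by move=> lf lg lh; rewrite l2C l2Dl // !(l2C h). Qed.

Lemma l2Br f g h : L2f f -> L2f g -> L2f h ->
  l2 D h (fun x => f x - g x) = l2 D h f - l2 D h g.
Proof. by move=> lf lg lh; rewrite l2C l2Bl // !(l2C h). Qed.

Lemma l2Zr c f h : L2f f -> L2f h -> l2 D h (fun x => c * f x) = c * l2 D h f.
Proof. by move=> lf lh; rewrite l2C l2Zl // l2C. Qed.

Lemma l2_ae f f' g g' : L2f f -> L2f f' -> L2f g -> L2f g' ->
  {ae vol, forall x, D x -> f x = f' x} -> {ae vol, forall x, D x -> g x = g' x} ->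
  l2 D f g = l2 D f' g'.
Proof.
move=> [m1 _] [m2 _] [m3 _] [m4 _] h1 h2; apply: ae_eq_Rintegral.
- exact: measurable_funM.
- exact: measurable_funM.
- by apply: filterS2 h1 h2 => x e1 e2 Dx; rewrite e1 // e2.
Qed.

Lemma l2_ge0 f : 0 <= l2 D f f.
Proof. by apply: Rintegral_ge0 => x _; rewrite -expr2 sqr_ge0. Qed.

Lemma N2_ge0 f : 0 <= N2 f. Proof. exact: sqrtr_ge0. Qed.
Lemma N2_sqr f : N2 f ^+ 2 = l2 D f f. Proof. by rewrite sqr_sqrtr // l2_ge0. Qed.

(** Besides the Cauchy-Schwarz inequality this covers the case a = 0, which shows that a linear term
    vanishes at a minimum. *)
Lemma quad_discr (a b c : R) : (forall t : R, 0 <= a + 2 * b * t + c * t ^+ 2) ->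
  `|b| <= Num.sqrt a * Num.sqrt c.
Proof.
move=> h; have a0 : 0 <= a by have := h 0; rewrite expr0n /= !mulr0 !addr0.
have c0 : 0 <= c.
  rewrite leNgt; apply/negP => c0.
  have [t t0 tc] : exists2 t : R, 0 < t & a + c * t < 0.
    exists ((a + 1) / - c); first by rewrite divr_gt0 ?oppr_gt0 ?ltr_pwDr.
    by rewrite invrN mulrN mulrN mulrC -mulrA mulVf ?lt_eqF //; lra.
  (* The linear terms of the two values cancel in the sum, leaving a + c (1 + t)^2 >= 0, against a +
     c t < 0. *)
  have := h (1 + t); have := h (- (1 + t)); nra.
rewrite -sqrtrM // -sqrtr_sqr ler_wsqrtr //.
have [c00|cn] := eqVneq c 0.
  rewrite c00 mulr0.
  have [->|bn] := eqVneq b 0; first by rewrite expr0n.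
  have := h (- (a + 1) / (2 * b)); rewrite c00 mul0r addr0.
  by rewrite mulrC -mulrA mulVf ?mulf_neq0 //; lra.
have cp : 0 < c by rewrite lt_neqAle eq_sym cn.
have := h (- b / c).
have -> : a + 2 * b * (- b / c) + c * (- b / c) ^+ 2 = (a * c - b ^+ 2) / c by field.
by rewrite pmulr_lge0 ?invr_gt0 // subr_ge0.
Qed.

Lemma l2_CS f g : L2f f -> L2f g -> `|l2 D f g| <= N2 f * N2 g.
Proof.
move=> lf lg; apply: quad_discr => t.
have := l2_ge0 (fun x => f x + t * g x).
have lt : L2f (fun x => t * g x) by exact: L2Z.
rewrite l2Dl //; last exact: L2D.
rewrite !l2Dr // !l2Zl // !l2Zr // (l2C g f); lra.
Qed.

Lemma N2_le f g : L2f f -> L2f g -> {ae vol, forall x, D x -> `|f x| <= `|g x|} ->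
  N2 f <= N2 g.
Proof.
move=> [mf lf] [mg lg] h; rewrite ler_wsqrtr // (le_trans (ler_norm _)) //.
apply: ae_le_Rintegral; first exact: measurable_funM.
  by under eq_fun do rewrite -expr2.
apply: filterS h => x h Dx; rewrite normrM -[leRHS]ger0_norm ?normrM; last by rewrite -expr2 sqr_ge0.
by rewrite ler_pM ?h.
Qed.

Lemma N2_ae f g : L2f f -> L2f g -> {ae vol, forall x, D x -> f x = g x} -> N2 f = N2 g.
Proof. by move=> lf lg h; rewrite /N2 (@l2_ae f g f g). Qed.

Lemma N2D f g : L2f f -> L2f g -> N2 (fun x => f x + g x) <= N2 f + N2 g.
Proof.
move=> lf lg; rewrite -ler_sqr ?nnegrE ?addr_ge0 ?N2_ge0 // N2_sqr.
rewrite l2Dl ?l2Dr //; try exact: L2D.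
have /ler_normlP[_] := l2_CS lf lg; rewrite (l2C g f) -!N2_sqr; nra.
Qed.

Lemma N2N f : N2 (fun x => - f x) = N2 f.
Proof. by congr Num.sqrt; apply: eq_Rintegral => x _; rewrite mulrNN. Qed.

Lemma N2Z c f : L2f f -> N2 (fun x => c * f x) = `|c| * N2 f.
Proof.
move=> lf; rewrite /N2 l2Zl ?l2Zr //; last exact: L2Z.
by rewrite mulrA -expr2 sqrtrM ?sqr_ge0 // sqrtr_sqr.
Qed.

Lemma N2_0 : N2 (fun=> 0) = 0.
Proof.
rewrite /N2 /l2; under eq_Rintegral do rewrite mulr0.
by rewrite Rintegral_cst // mul0r sqrtr0.
Qed.

Lemma N2_eq0 f : L2f f -> N2 f = 0 -> {ae vol, forall x, D x -> f x = 0}.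
Proof.
move=> [mf lf] /eqP; rewrite sqrtr_eq0 => h.
have h0 : l2 D f f = 0 by apply/eqP; rewrite eq_le h l2_ge0.
have e0 : (\int[vol]_(x in D) `|(f x * f x)%:E| = 0)%E.
  have /fineK <- : (\int[vol]_(x in D) `|(f x * f x)%:E|)%E \is a fin_num.
    by apply: integrable_fin_num => //; apply: integrable_abse; under eq_fun do rewrite -expr2.
  congr EFin; rewrite -[RHS]h0; congr fine; apply: eq_integral => x _.
  by rewrite gee0_abs // lee_fin -expr2 sqr_ge0.
have mff : measurable_fun D (EFin \o (fun x => f x * f x)).
  by apply/measurable_EFinP; exact: measurable_funM.
have [+ _] := @ae_eq_integral_abs _ pt R vol D mD _ mff.
move=> /(_ e0) E; apply: filterS E => x h1 Dx; have := h1 Dx => /= -[] /eqP.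
by rewrite mulf_eq0 orbb => /eqP.
Qed.

End square_integrable.

Section vector_square_integrable.
Context {R : realType} {n : nat}.
Local Notation pt := 'rV[R]_n.+1.
Local Notation vol := (leb R n.+1).
Variable D : set pt.
Implicit Types (f g h : pt -> R) (v w z : pt -> pt).
Hypothesis mD : measurable D.
Hypothesis fD : (vol D < +oo)%E.

Let mcomp v i : L2v D v -> measurable_fun D (component v i).
Proof. by move=> lv; case: (lv i). Qed.

Lemma measurable_dotv_fun v w : (forall i, measurable_fun D (component v i)) ->
  (forall i, measurable_fun D (component w i)) -> measurable_fun D (fun x => dotv (v x) (w x)).
Proof.
move=> mv mw; rewrite /dotv; elim: (index_enum _) => [|i r IH].
  under eq_fun do rewrite big_nil; exact: measurable_cst.
under eq_fun do rewrite big_cons; apply: measurable_funD => //.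
exact: measurable_funM (mv i) (mw i).
Qed.

Lemma measurable_norm2_fun v : (forall i, measurable_fun D (component v i)) ->
  measurable_fun D (norm2 \o v).
Proof.
move=> mv; apply: (@measurableT_comp _ _ _ _ _ _ (Num.sqrt : R -> R)).
  by apply: continuous_measurable_fun; exact: sqrt_continuous.
exact: measurable_dotv_fun.
Qed.

Lemma L2v_dotv v w : L2v D v -> L2v D w -> vol.-integrable D (EFin \o (fun x => dotv (v x) (w x))).
Proof.
move=> lv lw; rewrite /dotv; elim: (index_enum _) => [|i r IH].
  under eq_fun do rewrite big_nil; exact: integrable_cst_D.
under eq_fun do rewrite big_cons; apply: integrable_addf => //.
exact: L2fM (lv i) (lw i).
Qed.

Lemma L2v_norm v : L2v D v -> L2f D (norm2 \o v).
Proof.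
move=> lv; split; first by apply: measurable_norm2_fun => i; exact: mcomp.
by under eq_fun do rewrite /= norm2_sqr; exact: L2v_dotv.
Qed.

Lemma NVE v : NV D v = N2 D (norm2 \o v).
Proof. by congr Num.sqrt; apply: eq_Rintegral => x _; rewrite /= -expr2 norm2_sqr. Qed.

Lemma NV_ge0 v : 0 <= NV D v. Proof. exact: sqrtr_ge0. Qed.

Lemma l2V_ge0 v : 0 <= l2V D v v.
Proof. by apply: Rintegral_ge0 => x _; exact: dotv_ge0. Qed.

Lemma NV_sqr v : NV D v ^+ 2 = l2V D v v.
Proof. by rewrite sqr_sqrtr // l2V_ge0. Qed.

Lemma L2vD v w : L2v D v -> L2v D w -> L2v D (fun x => v x + w x).
Proof.
move=> lv lw i; rewrite (_ : component _ i = fun x => component v i x + component w i x).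
  exact: L2D (lv i) (lw i).
by apply/funext => x; rewrite /component mxE.
Qed.

Lemma bndL2v f v : bnd D f -> L2v D v -> L2v D (fun x => f x *: v x).
Proof.
move=> bf lv i; rewrite (_ : component _ i = fun x => f x * component v i x).
  exact: bndL2M bf (lv i).
by apply/funext => x; rewrite /component mxE.
Qed.

Lemma L2vZ c v : L2v D v -> L2v D (fun x => c *: v x).
Proof. by apply: bndL2v; exact: bnd_cst. Qed.

Lemma L2vB v w : L2v D v -> L2v D w -> L2v D (fun x => v x - w x).
Proof.
move=> lv lw; rewrite (_ : (fun x => _) = fun x => v x + (-1) *: w x).
  by apply: L2vD => //; exact: L2vZ.
by apply/funext => x; rewrite scaleN1r.
Qed.

Lemma l2VC v w : l2V D v w = l2V D w v.
Proof. by apply: eq_Rintegral => x _; exact: dotvC. Qed.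

Lemma l2VZl c v z : L2v D v -> L2v D z -> l2V D (fun x => c *: v x) z = c * l2V D v z.
Proof.
move=> lv lz; rewrite /l2V -RintegralZl //; try exact: L2v_dotv.
by apply: eq_Rintegral => x _; rewrite dotvZl.
Qed.

Lemma l2VBl v w z : L2v D v -> L2v D w -> L2v D z ->
  l2V D (fun x => v x - w x) z = l2V D v z - l2V D w z.
Proof.
move=> lv lw lz; rewrite /l2V -RintegralB //; try exact: L2v_dotv.
by apply: eq_Rintegral => x _; rewrite dotvBl.
Qed.

Lemma l2VBr v w z : L2v D v -> L2v D w -> L2v D z ->
  l2V D z (fun x => v x - w x) = l2V D z v - l2V D z w.
Proof. by move=> lv lw lz; rewrite l2VC l2VBl // !(l2VC z). Qed.

Lemma l2V_ae v v' w w' : L2v D v -> L2v D v' -> L2v D w -> L2v D w' ->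
  {ae vol, forall x, D x -> v x = v' x} -> {ae vol, forall x, D x -> w x = w' x} ->
  l2V D v w = l2V D v' w'.
Proof.
move=> lv lv' lw lw' h1 h2; apply: ae_eq_Rintegral => //.
- by apply: measurable_dotv_fun => i; exact: mcomp.
- by apply: measurable_dotv_fun => i; exact: mcomp.
- by apply: filterS2 h1 h2 => x e1 e2 Dx; rewrite e1 // e2.
Qed.

Lemma l2V_CS v w : L2v D v -> L2v D w -> `|l2V D v w| <= NV D v * NV D w.
Proof.
move=> lv lw; have nv := L2v_norm lv; have nw := L2v_norm lw.
rewrite !NVE; apply: le_trans (ler_norm _) _; rewrite normr_id.
apply: (@le_trans _ _ (l2 D (norm2 \o v) (norm2 \o w))).
  apply: ae_le_Rintegral => //; last by apply: aeW => x _; exact: dotv_le.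
    by apply: measurable_dotv_fun => i; exact: mcomp.
  exact: L2fM.
by apply: le_trans (ler_norm _) _; exact: l2_CS.
Qed.

Lemma NV_ae v w : L2v D v -> L2v D w -> {ae vol, forall x, D x -> v x = w x} -> NV D v = NV D w.
Proof. by move=> lv lw h; rewrite /NV (@l2V_ae v w v w). Qed.

Lemma NVD v w : L2v D v -> L2v D w -> NV D (fun x => v x + w x) <= NV D v + NV D w.
Proof.
move=> lv lw; have nv := L2v_norm lv; have nw := L2v_norm lw; rewrite !NVE.
apply: (@le_trans _ _ (N2 D (fun x => norm2 (v x) + norm2 (w x)))); last exact: N2D.
apply: N2_le => //.
- exact: L2v_norm (L2vD lv lw).
- exact: L2D.
- apply: aeW => x _ /=; rewrite !ger0_norm ?addr_ge0 ?norm2_ge0 //; exact: norm2D.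
Qed.

Lemma NVN v : NV D (fun x => - v x) = NV D v.
Proof. by congr Num.sqrt; apply: eq_Rintegral => x _; rewrite dotvNr dotvC dotvNr opprK. Qed.

Lemma NVB v w : L2v D v -> L2v D w -> NV D (fun x => v x - w x) <= NV D v + NV D w.
Proof.
move=> lv lw; rewrite -(NVN w); apply: NVD => //.
by move: (L2vZ (-1) lw); under eq_fun do rewrite scaleN1r.
Qed.

Lemma bnd_comp_norm v : (forall i, bnd D (component v i)) -> bnd D (norm2 \o v).
Proof.
move=> bv; split; first by apply: measurable_norm2_fun => i; case: (bv i).
have bs : bnd D (fun x => \sum_i `|component v i x|).
  apply: bnd_sum => i; case: (bv i) => mv [M vM]; split; first exact: measurableT_comp.
  by exists M; apply: filterS vM => x h Dx; rewrite normr_id h.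
case: bs => ms [M sM]; exists M; apply: filterS sM => x h Dx.
rewrite /= ger0_norm ?norm2_ge0 //; apply: le_trans (norm2_le_sum _) _.
exact: le_trans (ler_norm _) (h Dx).
Qed.

Lemma bnd_L2v v : (forall i, bnd D (component v i)) -> L2v D v.
Proof. by move=> bv i; exact: bnd_L2. Qed.

Lemma L2_dotv v w : (forall i, bnd D (component v i)) -> L2v D w ->
  L2f D (fun x => dotv (v x) (w x)).
Proof. by move=> bv lw; rewrite /dotv; apply: (L2_sum mD) => // i; exact: bndL2M (bv i) (lw i). Qed.

End vector_square_integrable.

(** * Lebesgue norms and Hölder's inequality *)

Section Lp_norms.
Context {R : realType} {n : nat}.
Local Notation pt := 'rV[R]_n.+1.
Local Notation vol := (leb R n.+1).
Variable D : set pt.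
Implicit Types (f g h : pt -> R) (v w z : pt -> pt).
Hypothesis mD : measurable D.
Hypothesis fD : (vol D < +oo)%E.

Lemma Lp_ge0 p f : (0 <= Lp p D f)%E.
Proof. exact: Lnorm_ge0. Qed.

Lemma Lp_pow (k : nat) f : (0 < k)%N ->
  (Lp k%:R%:E D f `^ k%:R = \int[vol]_(x in D) (`|f x| ^+ k)%:E)%E.
Proof.
move=> k0; rewrite /Lp poweR_Lnorm ?pnatr_eq0 -?lt0n //.
rewrite [RHS]integral_mkcond; apply: eq_integral => x _.
rewrite /= /patch; case: ifPn => _; rewrite powR_mulrn //.
by rewrite normr0 expr0n eqn0Ngt k0.
Qed.

Lemma Lp_le_int (k : nat) f (A : R) : (0 < k)%N -> measurable_fun D f -> 0 <= A ->
  (Lp k%:R%:E D f <= A%:E)%E ->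
  vol.-integrable D (EFin \o (fun x => `|f x| ^+ k)) /\
  \int[vol]_(x in D) (`|f x| ^+ k) <= A ^+ k.
Proof.
move=> k0 mf A0 h.
have H : (\int[vol]_(x in D) (`|f x| ^+ k)%:E <= (A ^+ k)%:E)%E.
  rewrite -Lp_pow // -powR_mulrn // -poweR_EFin.
  apply: gt0_ler_poweR => //; first by rewrite in_itv /= Lp_ge0 leey.
  by rewrite in_itv /= lee_fin A0 leey.
have I : vol.-integrable D (EFin \o (fun x => `|f x| ^+ k)).
  apply/integrableP; split.
    by apply/measurable_EFinP; apply: measurable_funX; apply: measurableT_comp.
  apply: le_lt_trans (ltry (A ^+ k)); apply: le_trans H.
  by rewrite le_eqVlt; apply/orP; left; apply/eqP; apply: eq_integral => x _; rewrite gee0_abs ?lee_fin ?exprn_ge0.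
split => //; rewrite -lee_fin fineK //; exact: integrable_fin_num.
Qed.

Lemma Lp2E f : L2f D f -> Lp 2%:E D f = (N2 D f)%:E.
Proof.
move=> [mf lf].
have E : (Lp 2%:E D f `^ 2 = (l2 D f f)%:E)%E.
  rewrite (@Lp_pow 2) // fineK; last by apply: integrable_fin_num => //; under eq_fun do rewrite -expr2.
  by apply: eq_integral => x _; rewrite real_normK ?num_real.
transitivity ((Lp 2%:E D f `^ 2) `^ 2^-1)%E.
  by rewrite -poweRrM mulfV // poweRe1 // Lp_ge0.
by rewrite E poweR12_sqrt ?lee_fin ?l2_ge0.
Qed.

Lemma LpV2E v : L2v D v -> LpV 2%:E D v = (NV D v)%:E.
Proof. by move=> lv; rewrite /LpV Lp2E ?NVE //; exact: L2v_norm. Qed.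

Lemma inLp2_L2 f : inLp 2%:E D f -> L2f D f.
Proof.
move=> [mf h]; split => //.
have hf : Lp 2%:E D f \is a fin_num by rewrite ge0_fin_numE ?Lp_ge0.
have hle : (Lp 2%:R%:E D f <= (fine (Lp 2%:E D f))%:E)%E by rewrite fineK.
have [I _] := @Lp_le_int 2 f _ isT mf (fine_ge0 (Lp_ge0 _ _)) hle.
by rewrite (_ : (fun x => f x ^+ 2) = fun x => `|f x| ^+ 2) //; apply/funext => x; rewrite real_normK ?num_real.
Qed.

Lemma LpV2_fin_L2v v : inLpV 2%:E D v -> L2v D v.
Proof. by move=> h i; exact: inLp2_L2. Qed.

(** The norm of exponent +oo is an essential supremum provided that the whole space has positive
    measure; this discharges the proviso. *)
Lemma vol_gt0 : (0 < vol [set: pt])%E.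
Proof.
have h : (vol (box (0 : pt) (const_mx 1%R)) <= vol [set: pt])%E.
  by apply: le_measure; rewrite ?inE //; exact: measurable_box.
apply: lt_le_trans h; rewrite leb_box; last by move=> i; rewrite !mxE.
by rewrite lte_fin prodr_gt0 // => i _; rewrite !mxE subr0.
Qed.

Lemma Lpinf_ae f (M : R) : (Lp +oo D f <= M%:E)%E -> {ae vol, forall x, D x -> `|f x| <= M}.
Proof.
rewrite /Lp unlock vol_gt0 => /ess_supP; apply: filterS => x /= h Dx.
by move: h; rewrite /patch mem_set // lee_fin.
Qed.

Lemma ae_Lpinf f (M : R) : 0 <= M -> {ae vol, forall x, D x -> `|f x| <= M} -> (Lp +oo D f <= M%:E)%E.
Proof.
move=> M0 h; rewrite /Lp unlock vol_gt0; apply/ess_supP; apply: filterS h => x h /=.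
by rewrite lee_fin /patch; case: ifPn => [/set_mem /h //|]; rewrite normr0.
Qed.

Lemma Lp_ae_le (p : R) f g : 0 < p -> measurable_fun D f -> measurable_fun D g ->
  {ae vol, forall x, D x -> `|f x| <= `|g x|} -> (Lp p%:E D f <= Lp p%:E D g)%E.
Proof.
move=> p0 mf mg h; rewrite /Lp unlock; apply: gt0_ler_poweR.
- by rewrite invr_ge0 ltW.
- by rewrite in_itv /= leey integral_ge0 // => x _; exact: poweR_ge0.
- by rewrite in_itv /= leey integral_ge0 // => x _; exact: poweR_ge0.
have mp (k : pt -> R) : measurable_fun D k ->
    measurable_fun setT (fun x => (`|(patch (fun=> 0%R) D k x)%:E| `^ p)%E).
  move=> mk; apply/measurable_EFinP; apply: (@measurableT_comp _ _ _ _ _ _ (fun t => powR t p)) => //.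
  by apply: measurableT_comp => //; move: mk => /(measurable_restrictT _ mD).
apply: ae_ge0_le_integral => //.
- by move=> x _; exact: poweR_ge0.
- exact: mp.
- by move=> x _; exact: poweR_ge0.
- exact: mp.
apply: filterS h => x h _ /=; rewrite lee_fin /patch; case: ifPn => // /set_mem /h {}h.
by apply: ge0_ler_powR => //; exact: ltW.
Qed.

Lemma LpD (p : R) f g : 1 <= p -> measurable_fun D f -> measurable_fun D g ->
  (Lp p%:E D (fun x => f x + g x)%R <= Lp p%:E D f + Lp p%:E D g)%E.
Proof.
move=> p1 mf mg; rewrite /Lp.
have -> : patch (fun=> 0) D (fun x => f x + g x) = (patch (fun=> 0) D f \+ patch (fun=> 0) D g)%R.
  by apply/funext => x; rewrite /patch /=; case: ifP => // _; rewrite addr0.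
by apply: minkowski_EFin => //; [move: mf|move: mg] => /(measurable_restrictT _ mD).
Qed.

Lemma LpV_triangle (p : R) v w z : 1 <= p ->
  (forall i, measurable_fun D (component v i)) ->
  (forall i, measurable_fun D (component w i)) ->
  (forall i, measurable_fun D (component z i)) ->
  {ae vol, forall x, D x -> v x = w x + z x} ->
  (LpV p%:E D v <= LpV p%:E D w + LpV p%:E D z)%E.
Proof.
move=> p1 mv mw mz h; rewrite /LpV.
have m1 := measurable_norm2_fun mv; have m2 := measurable_norm2_fun mw.
have m3 := measurable_norm2_fun mz.
apply: le_trans (LpD p1 m2 m3); apply: Lp_ae_le => //.
- exact: lt_le_trans p1.
- exact: measurable_funD.
apply: filterS h => x h Dx /=; rewrite h // !ger0_norm ?addr_ge0 ?norm2_ge0 //; exact: norm2D.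
Qed.

Lemma Lp_cst (p c : R) : 0 < p -> 0 <= c ->
  Lp p%:E D (fun=> c) = (c * (fine (vol D)) `^ p^-1)%:E.
Proof.
move=> p0 c0.
have fv : vol D \is a fin_num by rewrite ge0_fin_numE.
rewrite /Lp unlock.
have -> : (\int[vol]_x (`|(EFin \o patch (fun=> 0%R) D (fun=> c)%R) x| `^ p))%E = ((c `^ p) * fine (vol D))%:E.
  transitivity (\int[vol]_(x in D) (c `^ p)%:E)%E.
    rewrite [RHS]integral_mkcond; apply: eq_integral => x _ /=.
    rewrite /patch; case: ifP => _; first by rewrite ger0_norm.
    by rewrite normr0 powR0 // gt_eqF.
  by rewrite integral_cst // EFinM fineK.
rewrite poweR_EFin powRM ?powR_ge0 ?fine_ge0 // -powRrM divff ?gt_eqF // powRr1 //.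
Qed.

(** The difference of the two sides is (a + b + c)/6 times the sum of the squared differences. *)
Lemma young3 (a b c : R) : 0 <= a -> 0 <= b -> 0 <= c ->
  a * b * c <= 3^-1 * a ^+ 3 + 3^-1 * b ^+ 3 + 3^-1 * c ^+ 3.
Proof.
move=> a0 b0 c0; rewrite -subr_ge0.
have -> : 3^-1 * a ^+ 3 + 3^-1 * b ^+ 3 + 3^-1 * c ^+ 3 - a * b * c =
   6^-1 * ((a + b + c) * ((a - b) ^+ 2 + (b - c) ^+ 2 + (c - a) ^+ 2)) by field.
by rewrite mulr_ge0 // mulr_ge0 // ?addr_ge0 // sqr_ge0.
Qed.

(** First a (b c) <= (a^2 + (b c)^2) / 2, then [young3] for b, b and c^2. *)
Lemma young236 (a b c : R) : 0 <= a -> 0 <= b -> 0 <= c ->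
  a * b * c <= 2^-1 * a ^+ 2 + 3^-1 * b ^+ 3 + 6^-1 * c ^+ 6.
Proof.
move=> a0 b0 c0; have := young3 b0 b0 (sqr_ge0 c).
have := sqr_ge0 (a - b * c); rewrite -exprM; nra.
Qed.

(** Young's inequality is applied to the normalized factors; it is a hypothesis because each triple
    of integer exponents has its own elementary proof. The bounds are first enlarged by [e], since
    [A], [B] or [C] may be 0 and one divides by them. *)
Lemma hoelder3 (i j k : nat) f g h (A B C : R) :
  (0 < i)%N -> (0 < j)%N -> (0 < k)%N -> i%:R^-1 + j%:R^-1 + k%:R^-1 = 1 :> R ->
  (forall a b c : R, 0 <= a -> 0 <= b -> 0 <= c ->
    a * b * c <= i%:R^-1 * a ^+ i + j%:R^-1 * b ^+ j + k%:R^-1 * c ^+ k) ->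
  measurable_fun D f -> measurable_fun D g -> measurable_fun D h ->
  0 <= A -> 0 <= B -> 0 <= C ->
  (Lp i%:R%:E D f <= A%:E)%E -> (Lp j%:R%:E D g <= B%:E)%E -> (Lp k%:R%:E D h <= C%:E)%E ->
  vol.-integrable D (EFin \o (fun x => f x * g x * h x)) /\
  \int[vol]_(x in D) `|f x * g x * h x| <= A * B * C.
Proof.
move=> i0 j0 k0 ijk Y mf mg mh A0 B0 C0 hf hg hh.
have [If hf'] := Lp_le_int i0 mf A0 hf.
have [Ig hg'] := Lp_le_int j0 mg B0 hg.
have [Ih hh'] := Lp_le_int k0 mh C0 hh.
have mfgh : measurable_fun D (fun x => f x * g x * h x) by do 2! apply: measurable_funM => //.
have step (e : R) : 0 < e ->
    vol.-integrable D (EFin \o (fun x => f x * g x * h x)) /\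
    \int[vol]_(x in D) `|f x * g x * h x| <= (A + e) * (B + e) * (C + e).
  move=> e0; have [a0 b0 c0] : [/\ 0 < A + e, 0 < B + e & 0 < C + e] by split; exact: ltr_wpDl.
  set a := A + e in a0 *; set b := B + e in b0 *; set c := C + e in c0 *.
  pose G x := a * b * c * (i%:R^-1 * a ^- i * `|f x| ^+ i
      + (j%:R^-1 * b ^- j * `|g x| ^+ j + k%:R^-1 * c ^- k * `|h x| ^+ k)).
  have I1 : vol.-integrable D (EFin \o (fun x => j%:R^-1 * b ^- j * `|g x| ^+ j + k%:R^-1 * c ^- k * `|h x| ^+ k)).
    by apply: integrable_addf => //; apply: integrable_mulcf.
  have I2 : vol.-integrable D (EFin \o G).
    by apply: integrable_mulcf => //; apply: integrable_addf => //; apply: integrable_mulcf.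
  have dom x : `|f x * g x * h x| <= G x.
    have := Y (`|f x| / a) (`|g x| / b) (`|h x| / c).
    rewrite !divr_ge0 ?(ltW a0) ?(ltW b0) ?(ltW c0) // => /(_ isT isT isT).
    rewrite !exprMn !exprVn !normrM => H.
    have -> : `|f x| * `|g x| * `|h x| = a * b * c * (`|f x| / a * (`|g x| / b) * (`|h x| / c)).
      by field; rewrite !gt_eqF.
    rewrite ler_pM2l ?mulr_gt0 //; apply: le_trans H _; lra.
  split; first by apply: ae_le_integrable (I2) _ => //; exact: aeW.
  have H1 : `|\int[vol]_(x in D) `|f x * g x * h x| | <= \int[vol]_(x in D) G x.
    apply: ae_le_Rintegral => //; first exact: measurableT_comp.
    by apply: aeW => x _; rewrite normr_id.
  apply: le_trans (ler_norm _) (le_trans H1 _).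
  rewrite /G RintegralZl //; last by apply: integrable_addf => //; apply: integrable_mulcf.
  rewrite -[leRHS]mulr1 ler_pM2l ?mulr_gt0 //.
  rewrite RintegralD //; last by apply: integrable_mulcf.
  rewrite RintegralD //; try exact: integrable_mulcf.
  rewrite !RintegralZl // -[leRHS]ijk -[leRHS]addrA.
  have aux (m : nat) (s t X : R) : 0 <= s -> 0 < t -> s <= t -> X <= s ^+ m -> m%:R^-1 * t ^- m * X <= m%:R^-1.
    move=> s0 t0 st h'; rewrite -mulrA -[leRHS]mulr1 ler_wpM2l ?invr_ge0 ?ler0n //.
    rewrite mulrC ler_pdivrMr ?exprn_gt0 // mul1r (le_trans h') // lerXn2r // nnegrE //; exact: ltW.
  have eA : A <= a by rewrite lerDl ltW.
  have eB : B <= b by rewrite lerDl ltW.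
  have eC : C <= c by rewrite lerDl ltW.
  apply: lerD; first exact: (aux _ A).
  by apply: lerD; [exact: (aux _ B)|exact: (aux _ C)].
split; first by case: (step 1 ltr01).
set I := \int[vol]_(x in D) _ in step *.
apply/ler_addgt0Pr => e e0.
pose K := A * B + B * C + A * C + A + B + C + 1.
have K0 : 0 < K by rewrite /K; nra.
(* For t <= 1 the enlarged product exceeds A B C by at most t K. *)
pose t := Num.min 1 (e / K).
have t0 : 0 < t by rewrite lt_min ltr01 divr_gt0.
have [t1 tK] : t <= 1 /\ t * K <= e.
  by split; [rewrite ge_min lexx|rewrite -ler_pdivlMr // ge_min lexx orbT].
have [_ H] := step t t0; apply: le_trans H _.
apply: le_trans (lerD (lexx (A * B * C)) tK).
rewrite -subr_ge0 /K.
have -> : A * B * C + t * (A * B + B * C + A * C + A + B + C + 1) - (A + t) * (B + t) * (C + t)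
  = t * (1 - t) * (A + B + C) + t * (1 - t ^+ 2) by ring.
by rewrite addr_ge0 // !mulr_ge0 ?subr_ge0 ?addr_ge0 ?exprn_ile1 // ltW.
Qed.

End Lp_norms.

Section sub_domain.
Context {R : realType} {n : nat}.
Local Notation pt := 'rV[R]_n.+1.
Local Notation vol := (leb R n.+1).
Implicit Types (f g h : pt -> R) (v w z : pt -> pt) (D E : set pt).

Lemma L2f_sub D E f : measurable D -> measurable E -> E `<=` D -> L2f D f -> L2f E f.
Proof.
move=> mD mE ED [mf lf]; split; first exact: measurable_funS mf.
exact: integrableS lf.
Qed.

End sub_domain.

(** * The space H1 and integration by parts *)

Section sobolev_L2.
Context {R : realType} {n : nat}.
Local Notation pt := 'rV[R]_n.+1.
Local Notation vol := (leb R n.+1).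
Variable D : set pt.
Implicit Types (f g h q phi psi : pt -> R) (v w z u : pt -> pt).
Hypothesis oD : open D.
Hypothesis bD : bounded_set D.

Definition H1f f := L2f D f /\ forall i, is_wpd D i f (wpd D i f) /\ L2f D (wpd D i f).

Let mD : measurable D. Proof. exact: open_measurable_rV. Qed.
Let fD : (vol D < +oo)%E. Proof. exact: bounded_leb_fin. Qed.

Lemma sobolev_H1f f : sobolev 1 2%:E D f -> H1f f.
Proof.
move=> /= [lf h]; split; first exact: inLp2_L2.
move=> i; have [g wg [/(inLp2_L2 mD) lg _]] := h i.
have wp := wpdP wg; split => //.
have mw : measurable_fun D (wpd D i f).
  by case: wp => _ lw _; exact: loc_integrable_measurable.
apply: (ae_le_L2 mD mw lg).
by apply: filterS (wpdE oD wg) => x e Dx; rewrite e.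
Qed.

Lemma L2_inLp2 f : L2f D f -> inLp 2%:E D f.
Proof. by move=> lf; split; [case: lf|rewrite Lp2E ?ltry]. Qed.

Lemma H1f_sobolev f : H1f f -> sobolev 1 2%:E D f.
Proof.
move=> [lf h] /=; split; first exact: L2_inLp2.
by move=> i; have [w l] := h i; exists (wpd D i f) => //; split => //; exact: L2_inLp2.
Qed.

Lemma H1f_L2v f : H1f f -> L2v D (wgrad D f).
Proof.
move=> [_ h] i; rewrite (_ : component _ i = wpd D i f); first by case: (h i).
by apply/funext => x; rewrite /component mxE.
Qed.

(** The chosen derivatives agree almost everywhere with the given ones, which transfers square
    integrability to them. *)
Lemma H1f_intro f (G : 'I_n.+1 -> pt -> R) : L2f D f -> (forall i, is_wpd D i f (G i)) ->
  (forall i, L2f D (G i)) -> H1f f.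
Proof.
move=> lf wG lG; split => // i; have wp := wpdP (wG i); split => //.
have mw : measurable_fun D (wpd D i f).
  by case: wp => _ lw _; exact: loc_integrable_measurable.
apply: (ae_le_L2 mD mw (lG i)).
by apply: filterS (wpdE oD (wG i)) => x e Dx; rewrite e.
Qed.

Lemma wgrad_ae f (G : 'I_n.+1 -> pt -> R) : (forall i, is_wpd D i f (G i)) ->
  {ae vol, forall x, D x -> wgrad D f x = \row_i G i x}.
Proof.
move=> wG.
have : {ae vol, forall x, forall i, D x -> wpd D i f x = G i x}.
  by apply: filter_forall => i; exact: wpdE.
by apply: filterS => x h Dx; apply/rowP => i; rewrite !mxE h.
Qed.

Lemma H1fB f g : H1f f -> H1f g -> H1f (f \- g).
Proof.
move=> [lf hf] [lg hg]; apply: (@H1f_intro _ (fun i => wpd D i f \- wpd D i g)).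
- exact: L2B.
- by move=> i; apply: is_wpdB => //; [case: (hf i)|case: (hg i)].
- by move=> i; apply: L2B => //; [case: (hf i)|case: (hg i)].
Qed.

Lemma wgradB f g : (forall i, is_wpd D i f (wpd D i f)) -> (forall i, is_wpd D i g (wpd D i g)) ->
  {ae vol, forall x, D x -> wgrad D (f \- g) x = wgrad D f x - wgrad D g x}.
Proof.
move=> hf hg; have := @wgrad_ae (f \- g) (fun i => wpd D i f \- wpd D i g).
case/(_ (fun i => is_wpdB oD (hf i) (hg i))) => N [mN N0 h]; exists N; split => //.
apply: subset_trans h => x /= /not_implyP[Dx h]; apply/not_implyP; split => //.
by move=> e; apply: h; rewrite e; apply/rowP => i; rewrite !mxE.
Qed.

Lemma bounded_bnd f (M : R) : measurable_fun D f -> (forall x, D x -> `|f x| <= M) -> bnd D f.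
Proof. by move=> mf h; split => //; exists M; exact: aeW. Qed.

Lemma test_bnd phi : test_fun D phi -> bnd D phi.
Proof.
move=> t; have [M M0 h] := test_fun_bounded t.
by apply: bounded_bnd => //; apply: measurable_funTS; apply: smooth_measurable; case: t.
Qed.

Lemma test_is_wpd i phi : test_fun D phi -> is_wpd D i phi (pd i phi).
Proof.
move=> t; have [M M0 h] := test_fun_bounded t; have [L L0 h'] := pd_bounded i t.
by apply: smooth_is_wpd h h' => //; case: t.
Qed.

Lemma test_H1f phi : test_fun D phi -> H1f phi.
Proof.
move=> t; apply: (@H1f_intro _ (fun i => pd i phi)).
- by apply: bnd_L2 => //; exact: test_bnd.
- by move=> i; exact: test_is_wpd.
- by move=> i; apply: bnd_L2 => //; apply: test_bnd; exact: test_fun_pd.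
Qed.

Lemma N2_le_NV f i : H1f f -> N2 D (wpd D i f) <= NV D (wgrad D f).
Proof.
move=> hf; rewrite NVE; have [_ /(_ i)[_ lw]] := hf.
apply: N2_le => //; first exact: L2v_norm (H1f_L2v hf).
apply: aeW => x _; rewrite /= [leRHS]ger0_norm ?norm2_ge0 //.
by have := coord_le_norm2 (wgrad D f x) i; rewrite mxE.
Qed.

Lemma H1normE f : H1f f -> H1norm D f = (Num.sqrt (N2 D f ^+ 2 + NV D (wgrad D f) ^+ 2))%:E.
Proof.
move=> hf; rewrite /H1norm Lp2E //; last by case: hf.
rewrite LpV2E //; last exact: H1f_L2v.
have -> : ((N2 D f)%:E `^ 2 + (NV D (wgrad D f))%:E `^ 2 = (N2 D f ^+ 2 + NV D (wgrad D f) ^+ 2)%:E)%E.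
  by rewrite EFinD -!powR_mulrn ?N2_ge0 ?NV_ge0.
by rewrite poweR12_sqrt // lee_fin addr_ge0 ?sqr_ge0.
Qed.

Lemma H10_approx f e : H10 D f -> 0 < e -> exists2 phi, test_fun D phi &
  [/\ N2 D (f \- phi) < e, NV D (wgrad D (f \- phi)) < e &
    forall i, N2 D (fun x => wpd D i f x - pd i phi x) < e].
Proof.
move=> [sf hf] e0; have [phi t] := hf e e0; have h1 := sobolev_H1f sf.
have hd := H1fB h1 (test_H1f t).
rewrite (H1normE hd) lte_fin => hlt.
have l1 : N2 D (f \- phi) < e.
  by apply: le_lt_trans hlt; rewrite -{1}(ger0_norm (N2_ge0 D (f \- phi))) -sqrtr_sqr ler_wsqrtr // lerDl sqr_ge0.
have l2_ : NV D (wgrad D (f \- phi)) < e.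
  by apply: le_lt_trans hlt; rewrite -{1}(ger0_norm (NV_ge0 D (wgrad D (f \- phi)))) -sqrtr_sqr ler_wsqrtr // lerDr sqr_ge0.
exists phi => //; split => // i; apply: le_lt_trans l2_; apply: le_trans (N2_le_NV i hd).
have [_ /(_ i)[wf lw]] := h1; have [_ /(_ i)[_ ldw]] := hd.
have lp : L2f D (pd i phi) by apply: bnd_L2 => //; apply: test_bnd; exact: test_fun_pd.
rewrite le_eqVlt; apply/orP; left; apply/eqP; apply: N2_ae => //; first exact: L2B.
have := wpdE oD (is_wpdB oD wf (test_is_wpd i t)).
by apply: filterS => x h Dx; rewrite h.
Qed.

Lemma test_H10 phi : test_fun D phi -> H10 D phi.
Proof.
move=> t; have h := test_H1f t; split; first exact: H1f_sobolev.
move=> e e0; exists phi => //; rewrite (H1normE (H1fB h h)).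
have -> : phi \- phi = fun=> 0 by apply/funext => x /=; rewrite subrr.
rewrite N2_0 // (@NV_ae _ _ _ mD _ (fun=> 0)); first 1 last.
- by rewrite (_ : (fun=> 0) = phi \- phi); [exact: (H1f_L2v (H1fB h h))|apply/funext => x /=; rewrite subrr].
- by move=> i; apply: bnd_L2 => //; rewrite (_ : component _ i = fun=> 0); [exact: bnd_cst|apply/funext => x; rewrite /component mxE].
- have := @wgradB phi phi (fun i => (h.2 i).1) (fun i => (h.2 i).1).
  have -> : phi \- phi = fun=> 0 by apply/funext => x /=; rewrite subrr.
  by apply: filterS => x e' Dx; rewrite e' // subrr.
rewrite NVE (_ : norm2 \o _ = fun=> 0); last by apply/funext => x /=; rewrite norm20.
by rewrite N2_0 // expr0n /= addr0 sqrtr0 lte_fin.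
Qed.

Lemma H10B f g : H10 D f -> H10 D g -> H10 D (f \- g).
Proof.
move=> hf hg; have h1 := sobolev_H1f hf.1; have h2 := sobolev_H1f hg.1.
split; first by apply: H1f_sobolev; exact: H1fB.
move=> e e0.
have e4 : 0 < e / 4 by rewrite divr_gt0.
have [phi t [n1 n2 _]] := H10_approx hf e4; have [psi s [m1 m2 _]] := H10_approx hg e4.
have tps : test_fun D (phi \- psi).
  have := test_funD t (test_funZ (-1) s).
  by congr (test_fun _ _); apply/funext => x /=; rewrite mulN1r.
exists (phi \- psi) => //.
have k1 := H1fB h1 (test_H1f t); have k2 := H1fB h2 (test_H1f s).
have k3 := H1fB (H1fB h1 h2) (test_H1f tps).
have E : (f \- g) \- (phi \- psi) = (f \- phi) \- (g \- psi) by apply/funext => x /=; ring.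
rewrite (H1normE k3) lte_fin.
have a1 : N2 D ((f \- g) \- (phi \- psi)) <= N2 D (f \- phi) + N2 D (g \- psi).
  rewrite E -(N2N _ (g \- psi)); apply: N2D => //; first by case: k1.
  by apply: L2N => //; case: k2.
have a2 : NV D (wgrad D ((f \- g) \- (phi \- psi))) <= NV D (wgrad D (f \- phi)) + NV D (wgrad D (g \- psi)).
  apply: le_trans (NVB mD fD (H1f_L2v k1) (H1f_L2v k2)).
  rewrite le_eqVlt; apply/orP; left; apply/eqP; apply: NV_ae => //; first exact: H1f_L2v.
    exact: L2vB (H1f_L2v k1) (H1f_L2v k2).
  by rewrite E; apply: wgradB => i; [case: (k1.2 i)|case: (k2.2 i)].
move: a1 a2 (N2_ge0 D ((f \- g) \- (phi \- psi))) (NV_ge0 D (wgrad D ((f \- g) \- (phi \- psi)))).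
move: n1 n2 m1 m2; clear -e0.
move: (N2 D (f \- phi)) (NV D (wgrad D (f \- phi))) (N2 D (g \- psi)) (NV D (wgrad D (g \- psi))).
move: (N2 D _) (NV D _) => a b c1 c2 c3 c4 h1 h2 h3 h4 h5 h6 h7 h8.
apply: (@le_lt_trans _ _ (a + b)); last by lra.
rewrite -[leRHS]ger0_norm ?addr_ge0 // -sqrtr_sqr ler_wsqrtr //; nra.
Qed.

(** A functional that is bounded in the H1 norm and vanishes on test functions vanishes on their
    closure; [a] and [b] represent it. *)
Lemma H10_density (a : pt -> R) (b : 'I_n.+1 -> pt -> R) C : L2f D a -> (forall i, L2f D (b i)) ->
  (forall phi, test_fun D phi -> l2 D a phi + \sum_i l2 D (b i) (pd i phi) = 0) ->
  H10 D C -> l2 D a C + \sum_i l2 D (b i) (wpd D i C) = 0.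
Proof.
move=> la lb h hC; have [lC hw] := sobolev_H1f hC.1.
apply/eqP; rewrite -normr_le0; apply/ler_addgt0Pr => e e0; rewrite add0r.
(* The summand 1 keeps [K] positive when all the norms are 0. *)
pose K := N2 D a + \sum_i N2 D (b i) + 1.
have K0 : 0 < K by rewrite ltr_wpDl // addr_ge0 ?N2_ge0 // sumr_ge0 // => i _; exact: N2_ge0.
have [phi t [n1 _ n2]] := H10_approx hC (divr_gt0 e0 K0).
have lp : L2f D phi by case: (test_H1f t).
have lpd i : L2f D (pd i phi) by apply: bnd_L2 => //; apply: test_bnd; exact: test_fun_pd.
have -> : l2 D a C + \sum_i l2 D (b i) (wpd D i C) = l2 D a (fun x => C x - phi x)
    + \sum_i (l2 D (b i) (wpd D i C) - l2 D (b i) (pd i phi)).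
  by rewrite sumrB l2Br // addrACA -opprD h // subr0.
apply: le_trans (ler_normD _ _) _.
have H1 : `|l2 D a (fun x => C x - phi x)| <= N2 D a * (e / K).
  apply: le_trans (l2_CS _ _ _) _ => //; first exact: L2B.
  by rewrite ler_wpM2l ?N2_ge0 // ltW.
have H2 : `|\sum_i (l2 D (b i) (wpd D i C) - l2 D (b i) (pd i phi))| <= \sum_i N2 D (b i) * (e / K).
  apply: le_trans (ler_norm_sum _ _ _) _; apply: ler_sum => i _.
  have [_ lw] := hw i; rewrite -l2Br //.
  apply: le_trans (l2_CS _ _ _) _ => //; first exact: L2B.
  by rewrite ler_wpM2l ?N2_ge0 // ltW.
apply: le_trans (lerD H1 H2) _; rewrite -mulr_suml -mulrDl mulrA ler_pdivrMr //.
by rewrite mulrC ler_wpM2l ?(ltW e0) // /K lerDl.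
Qed.

Section antisymmetry.
Variables (u : pt -> pt) (delta : pt -> R).
Hypothesis bu : forall i, bnd D (component u i).
Hypothesis bdelta : bnd D delta.
Hypothesis div_free : forall psi, test_fun D psi ->
  l2 D delta psi + \sum_i l2 D (component u i) (pd i psi) = 0.

Let dotE C x : dotv (u x) (wgrad D C x) = \sum_i component u i x * wpd D i C x.
Proof. by apply: eq_bigr => i _; rewrite mxE. Qed.

Let l2_dot C f : H1f C -> L2f D f ->
  l2 D (fun x => dotv (u x) (wgrad D C x)) f = \sum_i l2 D (fun x => component u i x * f x) (wpd D i C).
Proof.
move=> [_ hC] lf.
have -> : (fun x => dotv (u x) (wgrad D C x)) = (fun x => \sum_i component u i x * wpd D i C x).
  by apply/funext => x; exact: dotE.
elim: (index_enum _) => [|i r IH].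
  rewrite big_nil /l2; under eq_Rintegral do rewrite big_nil mul0r.
  by rewrite Rintegral_cst // mul0r.
rewrite big_cons -IH; under [in LHS]eq_fun do rewrite big_cons.
have l i' : L2f D (fun x => component u i' x * wpd D i' C x).
  by apply: bndL2M => //; case: (hC i').
rewrite l2Dl //; last by apply: L2_sum.
congr (_ + _); apply: eq_Rintegral => x _; ring.
Qed.

(** Here [delta] is the weak divergence of [u]: [div_free] is its defining identity, and [delta = 0]
    is the divergence-free case. When both functions are test functions, so is their product, and
    the claim is that identity for the product. Density is applied to one argument at a time; [sym]
    exchanges the arguments in between, since [dens] treats the second one. *)
Lemma convection_antisym C S : H10 D C -> H10 D S ->
  l2 D (fun x => delta x * C x) S + l2 D (fun x => dotv (u x) (wgrad D C x)) S
  + l2 D (fun x => dotv (u x) (wgrad D S x)) C = 0.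
Proof.
have ld f : L2f D f -> L2f D (fun x => delta x * f x) by exact: bndL2M.
have lu i f : L2f D f -> L2f D (fun x => component u i x * f x) by exact: bndL2M.
have lg f : H1f f -> L2f D (fun x => dotv (u x) (wgrad D f x)).
  by move=> hf; apply: L2_dotv => //; exact: H1f_L2v.
have step f g : H1f f -> H1f g ->
    l2 D (fun x => delta x * f x + dotv (u x) (wgrad D f x)) g
      + \sum_i l2 D (fun x => component u i x * f x) (wpd D i g)
    = l2 D (fun x => delta x * f x) g + l2 D (fun x => dotv (u x) (wgrad D f x)) g
      + l2 D (fun x => dotv (u x) (wgrad D g x)) f.
  move=> hf hg; rewrite l2Dl //; [|by apply: ld; case: hf|exact: lg|by case: hg].
  by rewrite (l2_dot hg) //; case: hf.
have sym f g : H1f f -> H1f g ->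
    l2 D (fun x => delta x * f x) g + l2 D (fun x => dotv (u x) (wgrad D f x)) g
      + l2 D (fun x => dotv (u x) (wgrad D g x)) f =
    l2 D (fun x => delta x * g x) f + l2 D (fun x => dotv (u x) (wgrad D g x)) f
      + l2 D (fun x => dotv (u x) (wgrad D f x)) g.
  move=> _ _; rewrite (_ : l2 D (fun x => delta x * f x) g = l2 D (fun x => delta x * g x) f); first by ring.
  by apply: eq_Rintegral => x _; ring.
have dens f g : H1f f -> H10 D g ->
    (forall phi, test_fun D phi -> l2 D (fun x => delta x * f x) phi
      + l2 D (fun x => dotv (u x) (wgrad D f x)) phi
      + l2 D (fun x => dotv (u x) (wgrad D phi x)) f = 0) ->
    l2 D (fun x => delta x * f x) g + l2 D (fun x => dotv (u x) (wgrad D f x)) g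
      + l2 D (fun x => dotv (u x) (wgrad D g x)) f = 0.
  move=> hf hg h; have hg1 := sobolev_H1f hg.1; rewrite -step //.
  have lf : L2f D f by case: hf.
  apply: H10_density => //.
  - by apply: L2D => //; [exact: ld|exact: lg].
  - by move=> i; exact: lu.
  move=> phi t; rewrite -[RHS](h _ t) -step //; last exact: test_H1f.
  congr (_ + _); apply: eq_bigr => i _; apply: l2_ae => //; try exact: lu.
  - by apply: bnd_L2 => //; apply: test_bnd; exact: test_fun_pd.
  - by have [_ /(_ i)[]] := test_H1f t.
  - exact: aeW.
  - by apply: filterS (wpdE oD (test_is_wpd i t)) => x e Dx; rewrite e.
move=> hC hS; have hC1 := sobolev_H1f hC.1; have hS1 := sobolev_H1f hS.1.
apply: (dens _ _ hC1 hS) => phi t; have hp := test_H1f t.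
rewrite sym //; apply: (dens _ _ hp hC) => psi s; have hs := test_H1f s.
rewrite -step //.
have tps : test_fun D (phi \* psi) by apply: test_funM => //; case: s.
rewrite -[RHS](div_free tps).
have lphi : L2f D phi by case: hp.
have lpsi : L2f D psi by case: hs.
rewrite l2Dl //; [|exact: ld|exact: lg].
rewrite l2_dot // -addrA; congr (_ + _).
  by apply: eq_Rintegral => x _ /=; ring.
rewrite -big_split /=; apply: eq_bigr => i _.
have bt f : test_fun D f -> L2f D (pd i f).
  by move=> tf; apply: bnd_L2 => //; apply: test_bnd; exact: test_fun_pd.
have df f : test_fun D f -> forall x, differentiable f x by move=> [sf _ _] x; exact: (sf [::] x).
have aw f : test_fun D f -> {ae vol, forall x, D x -> wpd D i f x = pd i f x}.
  by move=> tf; exact: wpdE (test_is_wpd i tf).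
rewrite (@l2_ae _ _ _ mD (fun x => component u i x * psi x) (fun x => component u i x * psi x) (wpd D i phi) (pd i phi));
  [|exact: lu|exact: lu|by case: (hp.2 i)|exact: bt|exact: aeW|exact: aw].
rewrite (@l2_ae _ _ _ mD (fun x => component u i x * phi x) (fun x => component u i x * phi x) (wpd D i psi) (pd i psi));
  [|exact: lu|exact: lu|by case: (hs.2 i)|exact: bt|exact: aeW|exact: aw].
rewrite pdM; [|exact: df|exact: df].
rewrite /l2 -RintegralD //; [|exact: (L2fM mD (lu i _ lpsi) (bt _ t))|exact: (L2fM mD (lu i _ lphi) (bt _ s))].
by apply: eq_Rintegral => x _ /=; ring.
Qed.

End antisymmetry.

Lemma bnd_Lp_fin (p : R) f : 0 < p -> bnd D f -> inLp p%:E D f.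
Proof.
move=> p0 [mf [M hM]]; split => //.
have H : (Lp p%:E D f <= Lp p%:E D (fun=> `|M|)%R)%E.
  apply: Lp_ae_le => //.
  by apply: filterS hM => x h Dx; rewrite normr_id; apply: le_trans (h Dx) (ler_norm _).
by apply: le_lt_trans H _; rewrite Lp_cst // ltry.
Qed.

Lemma open_vol_gt0 : D !=set0 -> (0 < vol D)%E.
Proof.
move=> [x Dx]; have /box_nbhs[a [b [h1 h2]]] : nbhs x D by apply: open_nbhs_nbhs.
have ab i : ratr (a ord0 i) < ratr (b ord0 i) :> R.
  by have := h1 i; rewrite !mxE => /andP[]; exact: lt_trans.
apply: (@lt_le_trans _ _ (vol (box (map_mx ratr a) (map_mx ratr b)))).
  rewrite leb_box; last by move=> i; rewrite !mxE.
  by rewrite lte_fin prodr_gt0 // => i _; rewrite !mxE subr_gt0.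
apply: le_measure; rewrite ?inE //; first exact: measurable_box.
by apply: subset_trans h2; exact: box_cbox.
Qed.

(** Test functions need not have zero mean. Subtracting the mean makes them admissible in the
    divergence equation and leaves the gradient unchanged. *)
Lemma zero_mean_spM f : D !=set0 -> smooth f -> (exists M : R, forall x, `|f x| <= M) ->
  (forall i, exists L : R, forall x, `|pd i f x| <= L) ->
  let c := (\int[vol]_(x in D) f x) / fine (vol D) in
  spM D (fun x => f x - c) /\ forall i, is_wpd D i (fun x => f x - c) (pd i f).
Proof.
move=> D0 sf [M hM] hL c.
have V0 : 0 < fine (vol D) by rewrite fine_gt0 // fD andbT open_vol_gt0.
have df x : differentiable f x by exact: (sf [::] x).
have sg : smooth (fun x => f x - c) by apply: (smoothD sf (smooth_cst (- c))).
have pg i : pd i (fun x => f x - c) = pd i f.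
  rewrite (pdD i df) /=; last by move=> x; exact: differentiable_cst.
  by rewrite pd_cst; apply/funext => x /=; rewrite addr0.
have mf g : smooth g -> measurable_fun D g by move=> s; apply: measurable_funTS; exact: smooth_measurable.
have bg : bnd D (fun x => f x - c).
  apply: (@bounded_bnd _ (M + `|c|)); first exact: mf.
  by move=> x _; rewrite (le_trans (ler_normB _ _)) // lerD.
have bf : bnd D f by apply: (@bounded_bnd _ M) => //; exact: mf.
have wg i : is_wpd D i (fun x => f x - c) (pd i f).
  have [L hL'] := hL i; rewrite -pg; apply: (@smooth_is_wpd _ _ D _ i (M + `|c|) L) => //.
    by move=> x; rewrite (le_trans (ler_normB _ _)) // lerD.
  by move=> x; rewrite pg.
split => //; split.
  have p0 : 0 < 3 / 2 :> R by [].
  split; first exact: bnd_Lp_fin.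
  move=> i; exists (pd i f) => //; split => //.
  apply: bnd_Lp_fin => //; have [L hL'] := hL i.
  by apply: (@bounded_bnd _ L) => //; apply: mf; exact: smooth_pd.
split; first exact: bnd_Lp_fin.
rewrite RintegralB //; [|exact: bnd_integrable|exact: integrable_cst_D].
by rewrite Rintegral_cst // /c divfK ?subrr // gt_eqF.
Qed.

End sobolev_L2.

(** * Finite element spaces *)

Section discrete_spaces.
Context {R : realType} {n : nat}.
Local Notation pt := 'rV[R]_n.+1.
Local Notation vol := (leb R n.+1).
Variables (D : set pt) (T : mesh R n).
Hypothesis oD : open D.
Hypothesis bD : bounded_set D.
Hypothesis lD : lipschitz_boundary D.
Hypothesis tT : triangulates D T.
Implicit Types (f g q : pt -> R) (u v w : pt -> pt).

Let mD : measurable D. Proof. exact: open_measurable_rV. Qed.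
Let fD : (vol D < +oo)%E. Proof. exact: bounded_leb_fin. Qed.

(** One class for velocity components, pressures and concentrations: affine functions are the case
    of a zero bubble coefficient. *)
Definition discrete f := {within closure D, continuous f} /\ forall k, k \in T -> P1b_on k f.

Lemma discrete_bounded f : discrete f ->
  measurable_fun D f /\ exists2 M : R, 0 <= M & forall x, D x -> `|f x| <= M.
Proof.
move=> [cf _]; split.
  apply: (@measurable_funS _ _ _ _ (closure D)); [|exact: subset_closure|].
    by apply: closed_measurable_rV; exact: closed_closure.
  apply: continuous_measurable_rV => //; apply: closed_measurable_rV; exact: closed_closure.
have [M M0 hM] := within_cts_bounded (bounded_closure_compact bD) cf.
by exists M => // x Dx; apply: hM; exact: subset_closure.
Qed.

Lemma discrete_bnd f : discrete f -> bnd D f.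
Proof. by move=> /discrete_bounded[mf [M _ hM]]; exact: bounded_bnd hM. Qed.

Lemma discrete_wpd i f : discrete f -> [/\ is_wpd D i f (wpd D i f), bnd D (wpd D i f) &
  {ae vol, forall x, D x -> wpd D i f x = pd i f x}].
Proof.
move=> [cf hf]; have [G [L [wG mG bG eG]]] := discrete_is_wpd i oD bD lD tT cf hf.
have wp := wpdP wG; have wE := wpdE oD wG; split => //.
- split; first by case: wp => _ lw _; exact: loc_integrable_measurable.
  by exists L; apply: filterS wE => x e Dx; rewrite e.
- apply: filterS2 wE (mesh_interior_ae tT) => x e m Dx.
  by rewrite e // eG //; apply: m; exact: subset_closure.
Qed.

Lemma discrete_H1f f : discrete f -> H1f D f.
Proof.
move=> df; split; first by apply: bnd_L2 => //; exact: discrete_bnd.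
by move=> i; have [w b _] := discrete_wpd i df; split => //; exact: bnd_L2.
Qed.

Lemma discrete_wgrad f : discrete f -> {ae vol, forall x, D x -> wgrad D f x = cgrad f x}.
Proof.
move=> df.
have : {ae vol, forall x, forall i, D x -> wpd D i f x = pd i f x}.
  by apply: filter_forall => i; case: (discrete_wpd i df).
by apply: filterS => x h Dx; apply/rowP => i; rewrite !mxE h.
Qed.

Lemma P1_P1b k f : P1_on k f -> P1b_on k f.
Proof. by move=> [a [w h]]; exists a, w, 0 => x kx; rewrite mul0r addr0 h. Qed.

Lemma P1h_discrete f : P1h D T f -> discrete f.
Proof. by move=> [cf h]; split => // k kT; apply: P1_P1b; exact: h. Qed.

Lemma component_continuous v i : {within closure D, continuous v} ->
  {within closure D, continuous (component v i)}.
Proof.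
move=> cv x.
exact: (@continuous_comp (subspace (closure D)) _ _ v (fun M : pt => M ord0 i) x (cv x) (@coord_continuous _ _ _ _ _ _)).
Qed.

Lemma spXh_discrete v i : spXh D T v -> discrete (component v i).
Proof. by move=> [cv h]; split; [exact: component_continuous|move=> k kT; exact: h]. Qed.

Lemma spXh_bnd v i : spXh D T v -> bnd D (component v i).
Proof. by move=> h; apply: discrete_bnd; exact: spXh_discrete. Qed.

Lemma spXh_L2v v : spXh D T v -> L2v D v.
Proof. by move=> h; apply: bnd_L2v => // i; exact: spXh_bnd. Qed.

Lemma wdiv_bnd v : spXh D T v -> bnd D (wdiv D v).
Proof.
move=> hv; apply: bnd_sum => // i.
by have [_ b _] := discrete_wpd i (spXh_discrete i hv).
Qed.

(** The identity that [convection_antisym] asks of a velocity and its divergence. *)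
Lemma wdiv_test v psi : spXh D T v -> test_fun D psi ->
  l2 D (wdiv D v) psi + \sum_i l2 D (component v i) (pd i psi) = 0.
Proof.
move=> hv tp.
have -> : l2 D (wdiv D v) psi = \sum_i l2 D (wpd D i (component v i)) psi.
  have lw i : L2f D (wpd D i (component v i)).
    by apply: bnd_L2 => //; have [_ b _] := discrete_wpd i (spXh_discrete i hv).
  have lp : L2f D psi by apply: bnd_L2 => //; exact: test_bnd.
  rewrite /wdiv; elim: (index_enum _) => [|i r IH].
    rewrite big_nil /l2; under eq_Rintegral do rewrite big_nil mul0r.
    by rewrite Rintegral_cst // mul0r.
  rewrite big_cons -IH; under [in LHS]eq_fun do rewrite big_cons.
  by rewrite l2Dl //; exact: L2_sum.
rewrite -big_split /= big1 // => i _.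
have [[_ _ w] _ _] := discrete_wpd i (spXh_discrete i hv).
by rewrite w // subrr.
Qed.

Lemma within_continuousB (V : normedModType R) (f1 f2 : pt -> V) :
  {within closure D, continuous f1} -> {within closure D, continuous f2} ->
  {within closure D, continuous (fun x => f1 x - f2 x)}.
Proof. by move=> c1 c2 x; apply: continuousB; [exact: c1|exact: c2]. Qed.

Lemma P1bB k f g : P1b_on k f -> P1b_on k g -> P1b_on k (fun x => f x - g x).
Proof.
move=> [a [w [c h]]] [a' [w' [c' h']]]; exists (a - a'), (w - w'), (c - c') => x kx.
by rewrite h // h' // dotvBl; ring.
Qed.

Lemma P1B k f g : P1_on k f -> P1_on k g -> P1_on k (fun x => f x - g x).
Proof.
move=> [a [w h]] [a' [w' h']]; exists (a - a'), (w - w') => x kx.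
by rewrite h // h' // dotvBl; ring.
Qed.

Lemma spXhB v w : spXh D T v -> spXh D T w -> spXh D T (fun x => v x - w x).
Proof.
move=> [cv hv] [cw hw]; split; first exact: within_continuousB.
move=> k kT i; rewrite (_ : component _ i = fun x => component v i x - component w i x).
  by apply: P1bB; [exact: hv|exact: hw].
by apply/funext => x; rewrite /component !mxE.
Qed.

Lemma P1hB f g : P1h D T f -> P1h D T g -> P1h D T (f \- g).
Proof.
move=> [cf hf] [cg hg]; split; first exact: within_continuousB.
by move=> k kT; apply: P1B; [exact: hf|exact: hg].
Qed.

Lemma spYhB f g : spYh D T f -> spYh D T g -> spYh D T (f \- g).
Proof. by move=> [pf hf] [pg hg]; split; [exact: P1hB|exact: H10B]. Qed.

End discrete_spaces.

(** * Coercivity of symmetric matrices *)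

Section coercive_matrix.
Context {R : realType} {m : nat}.
Local Notation pt := 'rV[R]_m.+1.
Implicit Types (v w : pt) (A : 'M[R]_m.+1).

Lemma app_mxD A v w : app_mx A (v + w) = app_mx A v + app_mx A w.
Proof. exact: mulmxDl. Qed.

Lemma app_mxZ A c v : app_mx A (c *: v) = c *: app_mx A v.
Proof. by rewrite /app_mx scalemxAl. Qed.

Lemma dotv_mx v w : dotv v w = (v *m w^T) ord0 ord0.
Proof. by rewrite mxE; apply: eq_bigr => i _; rewrite mxE. Qed.

Lemma app_mx_sym A v w : A^T = A -> dotv (app_mx A v) w = dotv (app_mx A w) v.
Proof.
move=> sA; rewrite /app_mx sA [RHS]dotvC !dotv_mx trmx_mul sA mulmxA.
by [].
Qed.

Lemma sum_mul_cts (F G : 'I_m.+1 -> pt -> R) : (forall i, continuous (F i)) ->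
  (forall i, continuous (G i)) -> continuous (fun v => \sum_i F i v * G i v).
Proof.
move=> cF cG v; elim: (index_enum _) => [|i r IH].
  rewrite (_ : (fun v => _) = cst 0); first exact: cst_continuous.
  by apply/funext => w; rewrite big_nil.
rewrite (_ : (fun v => _) = (fun v => F i v * G i v + \sum_(i <- r) F i v * G i v)).
  exact: (continuousD (continuousM (cF i v) (cG i v)) IH).
by apply/funext => w; rewrite big_cons.
Qed.

Lemma quad_form_cts A : continuous (fun v => dotv (app_mx A v) v).
Proof.
apply: sum_mul_cts => i; last exact: coord_continuous.
have -> : (fun v => (app_mx A v) ord0 i) = (fun v => \sum_j v ord0 j * A^T j i).
  by apply/funext => v; rewrite mxE.
by apply: sum_mul_cts => j; [exact: coord_continuous|exact: cst_continuous].
Qed.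

Lemma compact_sphere : compact [set v : pt | dotv v v = 1].
Proof.
have cS : closed [set v : pt | dotv v v = 1].
  rewrite (_ : [set v | _] = (fun v : pt => dotv v v) @^-1` [set 1]) //.
  by apply: preimage_closed; [move=> x _; apply: sum_mul_cts => i; exact: coord_continuous|exact: closed_eq].
apply: (@subclosed_compact _ _ (cbox (const_mx (- 1)) (const_mx 1))) => //.
  exact: compact_cbox.
move=> v /= v1 i; rewrite !mxE -ler_norml; apply: le_trans (coord_le_norm2 v i) _.
by rewrite /norm2 v1 sqrtr1.
Qed.

(* The minimum of the quadratic form on the unit sphere is an eigenvalue. *)
Lemma eigenvalue_coercive A (c : R) : A^T = A -> (forall a, eigenvalue A a -> c <= a) ->
  forall v, c * norm2 v ^+ 2 <= dotv (app_mx A v) v.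
Proof.
move=> sA hA.
have S0 : [set v : pt | dotv v v = 1] !=set0.
  exists (base_vec ord0); rewrite /= dotv_base /base_vec mxE !eqxx //.
have [w /set_mem w1 hw] := EVT_min_rV S0 compact_sphere
  (continuous_subspaceT (@quad_form_cts A)).
pose l := dotv (app_mx A w) w.
have hl v : l * dotv v v <= dotv (app_mx A v) v.
  have [->|v0] := eqVneq v 0; first by rewrite dotv0l mulr0 dotvC dotv0l.
  have dv := dotv_gt0 v0.
  have nv : norm2 v != 0 by rewrite gt_eqF // sqrtr_gt0.
  have := hw ((norm2 v)^-1 *: v); rewrite inE /=.
  rewrite app_mxZ !dotvZl !dotvZr -norm2_sqr => /(_ _).
  have -> : (norm2 v)^-1 * ((norm2 v)^-1 * norm2 v ^+ 2) = 1 by field.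
  move=> /(_ erefl); rewrite -/l mulrA -invfM -expr2 mulrC ler_pdivlMr ?norm2_sqr //.
(* The form minus l |.|^2 is nonnegative and vanishes at [w]. Along w + t z its constant term is 0,
   so its linear term is 0 as well. *)
have key z : dotv (app_mx A w) z = l * dotv w z.
  apply/eqP; rewrite -subr_eq0 -normr_le0.
  have := @quad_discr R 0 (dotv (app_mx A w) z - l * dotv w z)
     (dotv (app_mx A z) z - l * dotv z z).
  rewrite sqrtr0 mul0r; apply => t.
  have := hl (w + t *: z); rewrite app_mxD app_mxZ !dotvDl !dotvDr !dotvZl !dotvZr.
  rewrite (app_mx_sym z w sA) (dotvC z w) w1 -/l; lra.
have e : app_mx A w = l *: w.
  apply/eqP; rewrite -subr_eq0; apply/eqP; apply: dotv_eq0.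
  by rewrite dotvBl dotvZl key subrr.
have : c <= l.
  apply: hA; apply/eigenvalueP; exists w; first by rewrite -e /app_mx sA.
  apply/eqP => w0; move: w1; rewrite /= w0 dotv0l => /eqP; by rewrite eq_sym oner_eq0.
move=> cl v; apply: le_trans (hl v); rewrite norm2_sqr ler_wpM2r //; exact: dotv_ge0.
Qed.

(** Ellipticity gives both invertibility and a bound on the inverse: a kernel vector has zero form,
    and k |z|^2 <= w.z when A z = w. *)
Lemma coercive_unit A (k : R) : 0 < k -> (forall w, k * norm2 w ^+ 2 <= dotv (app_mx A w) w) ->
  A \in unitmx /\ forall w, norm2 (app_mx (invmx A) w) <= k^-1 * norm2 w.
Proof.
move=> k0 h.
have uA : A \in unitmx.
  rewrite -unitmx_tr -row_free_unit -kermx_eq0; apply/eqP/row_matrixP => i.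
  have := h (row i (kermx A^T)); rewrite /app_mx -row_mul mulmx_ker row0 dotv0l.
  rewrite pmulr_rle0 // => hh; apply: norm2_eq0.
  by apply/eqP; rewrite -sqrf_eq0 eq_le hh sqr_ge0.
split => // w; set z := app_mx _ w.
have wz : app_mx A z = w by rewrite /app_mx /z /app_mx -mulmxA -trmx_mul mulmxV // trmx1 mulmx1.
have := h z; rewrite wz => h1.
have h2 := le_trans h1 (le_trans (ler_norm _) (dotv_le w z)).
rewrite ler_pdivlMl //.
have [z0|z0] := eqVneq (norm2 z) 0; first by rewrite z0 mulr0 norm2_ge0.
have zp : 0 < norm2 z by rewrite lt_neqAle eq_sym z0 norm2_ge0.
by move: h2; rewrite expr2 mulrA ler_pM2r.
Qed.

End coercive_matrix.

Section matrix_measurability.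
Context {R : realType} {n : nat}.
Local Notation pt := 'rV[R]_n.+1.
Variable D : set pt.
Hypothesis mD : measurable D.

Lemma measurable_det m (A : pt -> 'M[R]_m) : (forall i j, measurable_fun D (fun x => A x i j)) ->
  measurable_fun D (fun x => \det (A x)).
Proof.
move=> mA; rewrite /determinant.
elim: (index_enum _) => [|s r IH].
  under eq_fun do rewrite big_nil; exact: measurable_cst.
under eq_fun do rewrite big_cons; apply: measurable_funD => //; apply: measurable_funM => //.
elim: (index_enum _) => [|i r' IH'].
  under eq_fun do rewrite big_nil; exact: measurable_cst.
by under eq_fun do rewrite big_cons; apply: measurable_funM.
Qed.

(** Cramer's rule. The reciprocal of the determinant is expressed through a real power of its
    square, which is correct for negative determinants too; for a singular matrix [invmx] returns
    the matrix itself. *)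
Lemma measurable_invmx m (A : pt -> 'M[R]_m) i j : (forall i j, measurable_fun D (fun x => A x i j)) ->
  measurable_fun D (fun x => invmx (A x) i j).
Proof.
move=> mA; have md := measurable_det mA.
have -> : (fun x => invmx (A x) i j) = (fun x => if \det (A x) == 0 then A x i j else
    (\det (A x) * (\det (A x) ^+ 2) `^ (-1)) * ((-1) ^+ (j + i) * \det (row' j (col' i (A x))))).
  apply/funext => x; rewrite /invmx unitmxE unitfE; case: eqP => //= /eqP d0.
  have -> : \det (A x) * (\det (A x) ^+ 2) `^ (-1) = (\det (A x))^-1.
    by rewrite powR_inv1 ?sqr_ge0 // expr2 invfM mulrA mulfV // mul1r.
  by rewrite !mxE.
apply: measurable_fun_if => //.
- by apply: measurable_fun_eqr => //; exact: measurable_cst.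
- by apply: measurable_funS (mA i j) => // x [].
apply: (@measurable_funS _ _ _ _ D) => //.
apply: measurable_funM.
  apply: measurable_funM => //.
  apply: (@measurableT_comp _ _ _ _ _ _ (fun t => powR t (-1))) => //.
  exact: measurable_funX.
apply: measurable_funM => //; apply: measurable_det => a b.
by rewrite (_ : (fun x => _) = fun x => A x (lift j a) (lift i b)) //; apply/funext => x; rewrite !mxE.
Qed.

End matrix_measurability.

(** * The Darcy-Forchheimer problem *)

Section trilinear.
Context {R : realType} {n : nat}.
Local Notation pt := 'rV[R]_n.+1.
Local Notation vol := (leb R n.+1).
Variable D : set pt.
Hypothesis mD : measurable D.
Implicit Types (f g : pt -> R) (u v w : pt -> pt).

(** Hölder's inequality for the convection terms; the position of each exponent decides whether the
    velocity is measured in L2 or in L3. *)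
Lemma trilinear_bound (i j k : nat) u v f (A B C : R) :
  (0 < i)%N -> (0 < j)%N -> (0 < k)%N -> i%:R^-1 + j%:R^-1 + k%:R^-1 = 1 :> R ->
  (forall a b c : R, 0 <= a -> 0 <= b -> 0 <= c ->
    a * b * c <= i%:R^-1 * a ^+ i + j%:R^-1 * b ^+ j + k%:R^-1 * c ^+ k) ->
  (forall l, measurable_fun D (component u l)) -> (forall l, measurable_fun D (component v l)) ->
  measurable_fun D f -> 0 <= A -> 0 <= B -> 0 <= C ->
  (LpV i%:R%:E D u <= A%:E)%E -> (LpV j%:R%:E D v <= B%:E)%E -> (Lp k%:R%:E D f <= C%:E)%E ->
  `|l2 D (fun x => dotv (u x) (v x)) f| <= A * B * C.
Proof.
move=> i0 j0 k0 ijk Y mu mv mf A0 B0 C0 hu hv hf.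
have m1 := measurable_norm2_fun mu; have m2 := measurable_norm2_fun mv.
have [I H] := hoelder3 mD i0 j0 k0 ijk Y m1 m2 mf A0 B0 C0 hu hv hf.
apply: le_trans H; apply: ae_le_Rintegral => //.
- by apply: measurable_funM => //; exact: measurable_dotv_fun.
- by have := integrable_abse I; congr (integrable _ _ _); apply/funext => x.
- apply: aeW => x _; rewrite !normrM ler_wpM2r //.
  by rewrite (ger0_norm (norm2_ge0 _)) (ger0_norm (norm2_ge0 _)); exact: dotv_le.
Qed.

Lemma young326 (a b c : R) : 0 <= a -> 0 <= b -> 0 <= c ->
  a * b * c <= 3^-1 * a ^+ 3 + 2^-1 * b ^+ 2 + 6^-1 * c ^+ 6.
Proof. by move=> a0 b0 c0; have := young236 b0 a0 c0; lra. Qed.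

(** The friction is lagged, its modulus being taken at the previous iterate [a]. With |b| instead of
    |a| it would be the monotone map sending b to |b| b; the replacement costs at most |b - a| |b|
    |b - c|. *)
Lemma forchheimer_monotone m (a b c : 'rV[R]_m) :
  - (norm2 (b - a) * norm2 b * norm2 (b - c)) <=
  dotv (norm2 a *: b - norm2 c *: c) (b - c).
Proof.
have -> : norm2 a *: b - norm2 c *: c = (norm2 a - norm2 b) *: b + (norm2 b *: b - norm2 c *: c).
  by rewrite scalerBl addrA subrK.
rewrite dotvDl dotvZl.
have h1 : 0 <= dotv (norm2 b *: b - norm2 c *: c) (b - c).
  rewrite dotvBl !dotvBr !dotvZl -!norm2_sqr (dotvC c b).
  have := ler_norm (dotv b c); have := dotv_le b c.
  have := norm2_ge0 b; have := norm2_ge0 c.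
  set x := norm2 b; set y := norm2 c; set p := dotv b c => y0 x0 h2 h3.
  have h4 : p <= x * y by exact: le_trans h3 h2.
  have -> : x * (x ^+ 2) - x * p - (y * p - y * y ^+ 2) =
    (x + y) * (x - y) ^+ 2 + (x + y) * (x * y - p) by ring.
  by apply: addr_ge0; apply: mulr_ge0; first [exact: sqr_ge0|by rewrite subr_ge0|exact: addr_ge0].
have h2 : `|(norm2 a - norm2 b) * dotv b (b - c)| <= norm2 (b - a) * norm2 b * norm2 (b - c).
  rewrite normrM -mulrA ler_pM //; last exact: dotv_le.
  by rewrite distrC; exact: norm2_dist.
by have := ler_norm (- ((norm2 a - norm2 b) * dotv b (b - c))); rewrite normrN; lra.
Qed.

End trilinear.

(** * Properties of the data and energy estimates *)

Section problem_basics.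
Context {R : realType} {n : nat} (P : problem R n).
Local Notation pt := 'rV[R]_n.+1.
Local Notation vol := (leb R n.+1).
Local Notation D := (Omega P).
Implicit Types (u v w : pt -> pt) (p q C S : pt -> R) (T : mesh R n).
Hypothesis hP : standing_assumptions P.

Lemma domain_open : open D. Proof. by case: hP => -[_ []]. Qed.
Lemma domain_bounded : bounded_set D. Proof. by case: hP => -[_ []]. Qed.
Lemma domain_measurable : measurable D. Proof. exact: open_measurable_rV domain_open. Qed.
Lemma domain_finite : (vol D < +oo)%E.
Proof. exact: bounded_leb_fin domain_measurable domain_bounded. Qed.
Lemma domain_lipschitz : lipschitz_boundary D. Proof. by case: hP => -[]. Qed.
Lemma domain_neq0 : D !=set0. Proof. by case: hP => -[]. Qed.

Let oD := domain_open.
Let bD := domain_bounded.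
Let mD := domain_measurable.
Let fD := domain_finite.

Lemma Kinv_measurable i j : measurable_fun D (fun x => Kinv P x i j).
Proof. by case: hP => _ _ [mK _ _ _ _] _; apply: measurable_invmx. Qed.

(** The bound on the inverse comes from the ellipticity of [Kperm], pointwise almost everywhere. *)
Lemma Kinv_bounded : exists k : R, {ae vol, forall x, D x ->
  forall w : pt, norm2 (app_mx (Kinv P x) w) <= k * norm2 w}.
Proof.
case: hP => _ _ [_ [k k0 hk] _ _ _] _; exists k^-1.
apply: filterS hk => x h Dx w; have [_ h2] := h Dx.
by have [_] := coercive_unit k0 h2; apply.
Qed.

(** A lower bound on the eigenvalues gives coercivity because the tensor, hence its inverse, is
    symmetric. *)
Lemma Kinv_coercive : {ae vol, forall x, D x ->
  forall w : pt, Km P * norm2 w ^+ 2 <= dotv (app_mx (Kinv P x) w) w}.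
Proof.
case: hP => _ _ [_ [k k0 hk] _ _ he] _.
apply: filterS2 hk he => x h1 h2 Dx; have [sK _] := h1 Dx.
apply: eigenvalue_coercive; last exact: h2.
by rewrite /Kinv trmx_inv sK.
Qed.

Lemma mu_gt0 : 0 < mu P. Proof. by case: hP => _ []. Qed.
Lemma rho_gt0 : 0 < rho P. Proof. by case: hP => _ []. Qed.
Lemma beta_gt0 : 0 < beta P. Proof. by case: hP => _ []. Qed.
Lemma alpha_gt0 : 0 < alpha P. Proof. by case: hP => _ []. Qed.
Lemma r0_gt0 : 0 < r0 P. Proof. by case: hP => _ []. Qed.
Lemma Km_gt0 : 0 < Km P. Proof. by case: hP => _ _ [_ _ _ []]. Qed.
Lemma Km_le_KM : Km P <= KM P.
Proof. by case: hP => _ _ [_ _ _ [_ /andP[h1 h2]]] _ _; rewrite -lee_fin (le_trans h1). Qed.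
Lemma cf1_gt0 : 0 < cf1 P. Proof. by case: hP => _ _ _ []. Qed.
Lemma g_L2 : L2f D (g P). Proof. by case: hP => _ _ _ [_ _ _ _ h]; exact: inLp2_L2. Qed.

Lemma Kinv_L2v u : L2v D u -> L2v D (fun x => app_mx (Kinv P x) (u x)).
Proof.
move=> lu i; have [k hk] := Kinv_bounded.
have mu_ j : measurable_fun D (component u j) by case: (lu j).
apply: (@ae_le_L2 _ _ D mD _ (fun x => `|k| * norm2 (u x))).
- rewrite (_ : component _ i = fun x => \sum_j component u j x * Kinv P x i j).
    elim: (index_enum _) => [|j r IH].
      under eq_fun do rewrite big_nil; exact: measurable_cst.
    under eq_fun do rewrite big_cons; apply: measurable_funD => //; apply: measurable_funM => //.
    exact: Kinv_measurable.
  by apply/funext => x; rewrite /component !mxE; apply: eq_bigr => j _; rewrite mxE.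
- by apply: L2Z => //; exact: L2v_norm.
- apply: filterS hk => x h Dx; apply: le_trans (coord_le_norm2 _ _) _.
  apply: le_trans (h Dx _) _; apply: le_trans (ler_norm _) _.
  by rewrite !normrM normr_id.
Qed.

Lemma Kinv_coercive_int u : L2v D u ->
  Km P * NV D u ^+ 2 <= l2V D (fun x => app_mx (Kinv P x) (u x)) u.
Proof.
move=> lu; have lK := Kinv_L2v lu.
rewrite NV_sqr -subr_ge0 -l2VZl // -l2VBl //; last exact: L2vZ.
have mu_ j : measurable_fun D (component u j) by case: (lu j).
apply: ae_ge0_Rintegral => //.
  have lB : L2v D (fun x => app_mx (Kinv P x) (u x) - Km P *: u x) by apply: L2vB => //; exact: L2vZ.
  by apply: measurable_dotv_fun => // i; case: (lB i).
apply: filterS Kinv_coercive => x h Dx.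
by rewrite dotvBl dotvZl -norm2_sqr subr_ge0 h.
Qed.

Lemma f1_lipschitz a b : norm2 (f1 P a - f1 P b) <= cf1 P * `|a - b|.
Proof. by case: hP => _ _ _ [_ _ _ h _]. Qed.

Lemma f1_0 : f1 P 0 = 0. Proof. by case: hP => _ _ _ []. Qed.

Lemma f1_measurable i : measurable_fun setT (fun t => f1 P t ord0 i).
Proof.
apply: continuous_measurable_fun => t; apply/cvgrPdist_lt => e e0.
have c0 := cf1_gt0.
near=> s; apply: (@le_lt_trans _ _ (cf1 P * `|t - s|)).
  apply: le_trans (f1_lipschitz t s); have := coord_le_norm2 (f1 P t - f1 P s) i.
  by rewrite !mxE.
rewrite mulrC -ltr_pdivlMr //; near: s.
apply/nbhs_ballP; exists (e / cf1 P) => //=; exact: divr_gt0.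
Unshelve. all: by end_near. Qed.

Hypothesis hf0 : L2v D (f0 P).

Lemma f1_L2v C : L2f D C -> L2v D (fun x => f1 P (C x)).
Proof.
move=> lC i; apply: (@ae_le_L2 _ _ D mD _ (fun x => cf1 P * C x)).
- by apply: (measurableT_comp (f1_measurable i)); case: lC.
- exact: L2Z.
- apply: aeW => x _; apply: le_trans (coord_le_norm2 _ _) _.
  have := f1_lipschitz (C x) 0; rewrite f1_0 !subr0 => h.
  by rewrite normrM (gtr0_norm cf1_gt0).
Qed.

Lemma fC_L2v C : L2f D C -> L2v D (fC P C).
Proof. by move=> lC; apply: L2vD => //; exact: f1_L2v. Qed.

Lemma f1_NV C C' : L2f D C -> L2f D C' ->
  NV D (fun x => f1 P (C x) - f1 P (C' x)) <= cf1 P * N2 D (C \- C').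
Proof.
move=> lC lC'; rewrite NVE -[X in X * _](gtr0_norm cf1_gt0) -N2Z //; last exact: L2B.
apply: N2_le => //.
- by apply: L2v_norm => //; apply: L2vB => //; exact: f1_L2v.
- by apply: L2Z => //; exact: L2B.
- apply: aeW => x _ /=; rewrite ger0_norm ?norm2_ge0 // normrM (gtr0_norm cf1_gt0).
  exact: f1_lipschitz.
Qed.

Variables (S2 : R).
Hypothesis hS2 : sobolev_cst P 2 S2.

Lemma S2_gt0 : 0 < S2. Proof. by case: hS2. Qed.

Lemma poincare q : H10 D q -> N2 D q <= S2 * NV D (wgrad D q).
Proof.
move=> hq; have h1 := sobolev_H1f oD hq.1; have [_ /(_ _ hq)] := hS2.
rewrite Lp2E //; last by case: h1.
by rewrite LpV2E //; exact: H1f_L2v.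
Qed.

Lemma FcstE : Fcst P S2 = NV D (f0 P) + cf1 P * (S2 ^+ 2 / alpha P) * N2 D (g P).
Proof. by rewrite /Fcst LpV2E // Lp2E //; exact: g_L2. Qed.

Variable T : mesh R n.
Hypothesis tT : triangulates D T.

Let lD := domain_lipschitz.

Definition trans u C S : R := l2 D (fun x => dotv (u x) (wgrad D C x)) S.

Lemma dot_wgrad_L2 u C : spXh D T u -> H1f D C -> L2f D (fun x => dotv (u x) (wgrad D C x)).
Proof.
move=> hu hC; apply: L2_dotv => //; last exact: H1f_L2v.
by move=> i; apply: spXh_bnd hu.
Qed.

(** Half the divergence term turns the convection into its skew-symmetric part, which vanishes for
    [S = C]: the energy of the concentration does not see the velocity. *)
Lemma conc_hE u C S : spXh D T u -> H10 D C -> H10 D S ->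
  conc_h P u C S = alpha P * l2V D (wgrad D C) (wgrad D S)
    + 2^-1 * (trans u C S - trans u S C) + r0 P * l2 D C S.
Proof.
move=> hu hC hS.
have bu i : bnd D (component u i) by apply: spXh_bnd hu.
have bd := wdiv_bnd oD bD lD tT hu.
have := convection_antisym oD bD bu bd (fun psi => wdiv_test oD bD lD tT hu (psi := psi)) hC hS.
rewrite /conc_h -/(trans u C S) -/(trans u S C) => h; lra.
Qed.

Lemma conc_energy u C : spXh D T u -> H10 D C ->
  conc_h P u C C = l2 D (g P) C -> NV D (wgrad D C) <= S2 / alpha P * N2 D (g P).
Proof.
move=> hu hC; rewrite conc_hE // subrr mulr0 addr0 -NV_sqr => e.
have h1 := sobolev_H1f oD hC.1; have lC : L2f D C by case: h1.
have a0 := alpha_gt0.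
have := l2_ge0 D C; have := r0_gt0 => r00 l0.
have r1 : 0 <= r0 P * l2 D C C by rewrite mulr_ge0 // ltW.
have h2 : l2 D (g P) C <= N2 D (g P) * (S2 * NV D (wgrad D C)).
  apply: le_trans (ler_norm _) _; apply: le_trans (l2_CS mD g_L2 lC) _.
  by rewrite ler_wpM2l ?N2_ge0 // poincare.
have h3 : alpha P * NV D (wgrad D C) ^+ 2 <= (S2 * N2 D (g P)) * NV D (wgrad D C) by nra.
rewrite mulrAC ler_pdivlMr // mulrC.
have [->|x0] := eqVneq (NV D (wgrad D C)) 0.
  by rewrite mulr0 mulr_ge0 ?N2_ge0 // ltW // S2_gt0.
have xp : 0 < NV D (wgrad D C) by rewrite lt_neqAle eq_sym x0 NV_ge0.
by rewrite -(ler_pM2r xp) -mulrA -expr2.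
Qed.

(** This is the origin of [Fcst]: the Lipschitz constant of [f1] and two uses of the Poincaré
    inequality, one in the energy estimate and one from the gradient back to [C], whence the square
    of [S2]. *)
Lemma fC_energy u C : spXh D T u -> H10 D C ->
  conc_h P u C C = l2 D (g P) C -> NV D (fC P C) <= Fcst P S2.
Proof.
move=> hu hC e; have h := conc_energy hu hC e.
have lC : L2f D C by case: (sobolev_H1f oD hC.1).
have l0 : L2f D (fun=> 0) by apply: bnd_L2 => //; exact: bnd_cst.
rewrite FcstE; apply: le_trans (NVD mD fD hf0 (f1_L2v lC)) _; rewrite lerD2l.
have := f1_NV lC l0; rewrite (_ : (fun x => f1 P (C x) - _) = fun x => f1 P (C x)); last first.
  by apply/funext => x; rewrite f1_0 subr0.
rewrite (_ : C \- _ = C); last by apply/funext => x /=; rewrite subr0.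
move=> h1; apply: le_trans h1 _; rewrite -mulrA ler_wpM2l ?(ltW cf1_gt0) //.
apply: le_trans (poincare hC) _.
by rewrite expr2 -!mulrA ler_wpM2l ?(ltW S2_gt0) // mulrA.
Qed.

End problem_basics.

(** * Convergence of the iterates *)

Section step_arithmetic.
Context {R : realFieldType}.
Implicit Types (a b c d k : R).

(** In this section norms and integrals become real variables, so that the closing inequalities of
    the estimates are linear in their monomials. *)
Lemma velocity_arith (gamma m F X Y a b c d : R) : gamma * (X ^+ 2 - c) + a + b = d ->
  m * X ^+ 2 <= a -> 0 <= b -> gamma * c <= gamma * (Y * X) -> d <= F * X ->
  ((gamma + m) * X) * X <= (gamma * Y + F) * X.
Proof. by move=> *; lra. Qed.

Lemma polarization_arith a b c : a = 2^-1 * (b - (b - a - (a - c)) + c).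
Proof. by field. Qed.

Lemma error_arith (gamma m mr br X2 Y2 Z2 K1 K2 f1 f2 F1 F2 N Q : R) :
  gamma * (2^-1 * (X2 - Y2 + Z2)) + mr * K1 + br * f1 = F1 -> mr * K2 + br * f2 = F2 ->
  m * X2 <= mr * (K1 - K2) -> F1 - F2 <= Q -> - N <= br * (f1 - f2) ->
  gamma / 2 * (X2 - Y2 + Z2) + m * X2 <= N + Q.
Proof. by move=> *; lra. Qed.

Lemma conc_arith (al r L1 L2 I1 I2 gt u1 u2 v1 v2 w a b c d : R) :
  al * L1 + 2^-1 * (u1 - u2) + r * I1 = gt -> al * L2 + 2^-1 * (v1 - v2) + r * I2 = gt ->
  u1 - v1 = w + (a - b) -> u2 - v2 = w + (c - d) ->
  al * (L1 - L2) + r * (I1 - I2) = 2^-1 * (c - d - (a - b)).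
Proof. by move=> *; lra. Qed.

Lemma conc_bound_arith (al G r2 a b c d E c3 S6 M K d' : R) :
  al * G ^+ 2 + r2 = 2^-1 * (c - d - (a - b)) -> 0 <= r2 ->
  `|a| <= E * c3 * (S6 * G) -> `|c| <= M * (E * G) ->
  `|d| <= K * E * G * (S6 * d') -> `|b| <= K * E * d' * (S6 * G) ->
  al * G ^+ 2 <= ((2^-1 * (S6 * c3 + M) + K * S6 * d') * E) * G.
Proof.
move=> h1 h2; rewrite !ler_norml => /andP[? ?] /andP[? ?] /andP[? ?] /andP[? ?]; lra.
Qed.

Lemma ler_cancel_sqr a b c : 0 <= b -> 0 <= c -> a * c ^+ 2 <= b * c -> a * c <= b.
Proof.
move=> b0; rewrite le_eqVlt => /predU1P[<-|c0]; first by move=> _; rewrite mulr0.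
by rewrite expr2 mulrA ler_pM2r.
Qed.

Lemma inv236 : 2^-1 + 3^-1 + 6^-1 = 1 :> R. Proof. by lra. Qed.
Lemma inv326 : 3^-1 + 2^-1 + 6^-1 = 1 :> R. Proof. by lra. Qed.
Lemma inv333 : 3^-1 + 3^-1 + 3^-1 = 1 :> R. Proof. by lra. Qed.

End step_arithmetic.

(** * One step of the iteration *)

Section one_step.
Context {R : realType} {n : nat} (P : problem R n).
Local Notation pt := 'rV[R]_n.+1.
Local Notation vol := (leb R n.+1).
Local Notation D := (Omega P).
Implicit Types (u v w : pt -> pt) (p q C S : pt -> R).
Hypothesis hP : standing_assumptions P.
Hypothesis hf0 : L2v D (f0 P).
Variable T : mesh R n.
Hypothesis tT : triangulates D T.

Let oD := domain_open hP.
Let bD := domain_bounded hP.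
Let mD := domain_measurable hP.
Let fD := domain_finite hP.
Let lD := domain_lipschitz hP.

Lemma transBu u v C S : spXh D T u -> spXh D T v -> H1f D C -> L2f D S ->
  trans P (fun x => u x - v x) C S = trans P u C S - trans P v C S.
Proof.
move=> hu hv hC lS; rewrite /trans -l2Bl //; try exact: (dot_wgrad_L2 hP (T := T)).
by apply: eq_Rintegral => x _; rewrite dotvBl.
Qed.

Lemma transBC u C C' S : spXh D T u -> H1f D C -> H1f D C' -> L2f D S ->
  trans P u (C \- C') S = trans P u C S - trans P u C' S.
Proof.
move=> hu hC hC' lS; rewrite /trans -l2Bl //; try exact: (dot_wgrad_L2 hP (T := T)).
have l1 := dot_wgrad_L2 hP hu hC; have l2_ := dot_wgrad_L2 hP hu hC'.
apply: l2_ae => //.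
- by apply: (dot_wgrad_L2 hP hu); exact: H1fB.
- exact: L2B.
- have := wgradB oD (fun i => (hC.2 i).1) (fun i => (hC'.2 i).1).
  by apply: filterS => x e Dx; rewrite e // dotvBr.
- exact: aeW.
Qed.

Lemma transBS u C S S' : spXh D T u -> H1f D C -> L2f D S -> L2f D S' ->
  trans P u C (S \- S') = trans P u C S - trans P u C S'.
Proof.
move=> hu hC lS lS'; rewrite /trans (_ : S \- S' = fun x => S x - S' x) // l2Br //.
exact: (dot_wgrad_L2 hP hu hC).
Qed.

Lemma trans_bounded u C S (M : R) : spXh D T u -> H1f D C -> L2f D S -> 0 <= M ->
  {ae vol, forall x, D x -> `|S x| <= M} ->
  `|trans P u C S| <= M * (NV D u * NV D (wgrad D C)).
Proof.
move=> hu hC lS M0 hS.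
have lu : L2v D u by exact: (spXh_L2v oD bD hu).
have lg : L2v D (wgrad D C) by exact: H1f_L2v.
have n1 := L2v_norm mD fD lu; have n2 := L2v_norm mD fD lg.
have l1 := dot_wgrad_L2 hP hu hC.
apply: (@le_trans _ _ (\int[vol]_(x in D) (M * (norm2 (u x) * norm2 (wgrad D C x))))).
  apply: ae_le_Rintegral => //.
  - by apply: measurable_funM; [case: l1|case: lS].
  - by apply: integrable_mulcf => //; exact: L2fM n1 n2.
  - apply: filterS hS => x h Dx; rewrite normrM mulrC ler_pM //; first exact: h.
    exact: dotv_le.
rewrite RintegralZl //; last exact: L2fM n1 n2.
rewrite ler_wpM2l // !NVE; apply: le_trans (ler_norm _) _; exact: (l2_CS mD n1 n2).
Qed.

(** [K3] will be cI h^(d/3 - d/2), the constant of the inverse inequality from L2 to L3 on the given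
    mesh. *)
Variables (S2 S6 K3 : R).
Hypothesis hS2 : sobolev_cst P 2 S2.
Hypothesis hS6 : sobolev_cst P 6 S6.
Hypothesis K30 : 0 <= K3.
Hypothesis hK3 : forall v, spXh D T v -> (LpV 3%:E D v <= (K3 * NV D v)%:E)%E.

Lemma sobolev6 q : H10 D q -> (Lp 6%:E D q <= (S6 * NV D (wgrad D q))%:E)%E.
Proof.
move=> hq; have [_ /(_ _ hq)] := hS6; rewrite LpV2E //.
by apply: H1f_L2v; exact: (sobolev_H1f oD hq.1).
Qed.

Let m := mu P / rho P * Km P.

Let m_gt0 : 0 < m.
Proof. by rewrite mulr_gt0 ?(Km_gt0 hP) // divr_gt0 ?(mu_gt0 hP) ?(rho_gt0 hP). Qed.

Variables (gamma : R) (u0 u : pt -> pt) (C0 p C : pt -> R).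
Hypothesis gamma0 : 0 < gamma.
Hypothesis hu0 : spXh D T u0.
Hypothesis hC0 : spYh D T C0.
Hypothesis step : solves_Vahi P T gamma u0 C0 u p C.

Let hu : spXh D T u. Proof. by case: step. Qed.
Let hp : spMh D T p. Proof. by case: step. Qed.
Let hC : spYh D T C. Proof. by case: step. Qed.
Let lu0 : L2v D u0. Proof. exact: (spXh_L2v oD bD hu0). Qed.
Let lu : L2v D u. Proof. exact: (spXh_L2v oD bD hu). Qed.
Let lp : L2v D (wgrad D p).
Proof. by apply: H1f_L2v; apply: (discrete_H1f oD bD lD tT); apply: P1h_discrete; case: hp. Qed.
Let hC1 : H1f D C. Proof. exact: (sobolev_H1f oD hC.2.1). Qed.
Let hC01 : H1f D C0. Proof. exact: (sobolev_H1f oD hC0.2.1). Qed.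
Let lfC0 : L2v D (fC P C0). Proof. by apply: (fC_L2v hP hf0); case: hC01. Qed.

Let fric v w : spXh D T v -> spXh D T w -> L2v D (fun x => norm2 (v x) *: w x).
Proof.
move=> hv hw; apply: (bndL2v mD (f := norm2 \o v)); last exact: (spXh_L2v oD bD hw).
by apply: bnd_comp_norm => // i; exact: (spXh_bnd bD i hv).
Qed.

(** Tested with [u], the pressure drops out by the divergence equation and the friction term is
    nonnegative. The result is an affine recursion for the norms of the iterates, with fixed point F
    / m. *)
Lemma step_velocity_bound (F : R) : NV D (fC P C0) <= F ->
  (gamma + m) * NV D u <= gamma * NV D u0 + F.
Proof.
move=> hF; have [_ _ _ /(_ u p C hu hp hC)[e1 e2 _]] := step.
have i1 := Kinv_coercive_int hP lu.
have i2 : 0 <= l2V D (fun x => norm2 (u0 x) *: u x) u.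
  by apply: Rintegral_ge0 => x _; rewrite dotvZl mulr_ge0 ?norm2_ge0 ?dotv_ge0.
have i3 : l2V D u0 u <= NV D u0 * NV D u.
  by apply: le_trans (ler_norm _) _; exact: l2V_CS.
have i4 : l2V D (fC P C0) u <= F * NV D u.
  apply: le_trans (ler_norm _) _; apply: le_trans (l2V_CS mD fD lfC0 lu) _.
  by rewrite ler_wpM2r ?NV_ge0.
move: e1; rewrite e2 addr0 l2VBl // -NV_sqr => e1.
have b0 : 0 < beta P / rho P by rewrite divr_gt0 ?(beta_gt0 hP) ?(rho_gt0 hP).
have c0 : 0 < mu P / rho P by rewrite divr_gt0 ?(mu_gt0 hP) ?(rho_gt0 hP).
have h1 : m * NV D u ^+ 2 <= mu P / rho P * l2V D (fun x => app_mx (Kinv P x) (u x)) u.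
  by rewrite /m -mulrA ler_pM2l.
have h2 : 0 <= beta P / rho P * l2V D (fun x => norm2 (u0 x) *: u x) u by rewrite mulr_ge0 // ltW.
have h4 : gamma * l2V D u0 u <= gamma * (NV D u0 * NV D u) by rewrite ler_pM2l.
have h3 : ((gamma + m) * NV D u) * NV D u <= (gamma * NV D u0 + F) * NV D u.
  exact: (velocity_arith e1 h1 h2 h4 i4).
apply: (ler_cancel_sqr _ (NV_ge0 D u)); last by rewrite expr2 mulrA.
rewrite addr_ge0 ?mulr_ge0 ?NV_ge0 ?(ltW gamma0) //; exact: le_trans (NV_ge0 _ _) hF.
Qed.

Variables (uh : pt -> pt) (ph Ch : pt -> R).
Hypothesis limit : solves_Vah P T uh ph Ch.

Let huh : spXh D T uh. Proof. by case: limit. Qed.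
Let hph : spMh D T ph. Proof. by case: limit. Qed.
Let hCh : spYh D T Ch. Proof. by case: limit. Qed.
Let luh : L2v D uh. Proof. exact: (spXh_L2v oD bD huh). Qed.
Let lph : L2v D (wgrad D ph).
Proof. by apply: H1f_L2v; apply: (discrete_H1f oD bD lD tT); apply: P1h_discrete; case: hph. Qed.
Let hCh1 : H1f D Ch. Proof. exact: (sobolev_H1f oD hCh.2.1). Qed.
Let lfCh : L2v D (fC P Ch). Proof. by apply: (fC_L2v hP hf0); case: hCh1. Qed.

Let e x := u x - uh x.
Let he : spXh D T e. Proof. exact: spXhB. Qed.
Let le_ : L2v D e. Proof. exact: (spXh_L2v oD bD he). Qed.

(** The pointwise lag estimate, integrated with Hölder's inequality for the exponents 3, 3, 3; each
    factor spends one inverse inequality, whence the cube of [K3]. *)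
Lemma friction_diff :
  - (K3 ^+ 3 * (NV D (fun x => (u x - u0 x)%R) * NV D u * NV D e)) <=
  l2V D (fun x => norm2 (u0 x) *: u x) e - l2V D (fun x => norm2 (uh x) *: uh x) e.
Proof.
have hd : spXh D T (fun x => u x - u0 x) by exact: spXhB.
have mes v : spXh D T v -> measurable_fun D (norm2 \o v).
  move=> hv; apply: measurable_norm2_fun => i.
  by case: (spXh_L2v oD bD hv i).
have n3 v : 0 <= K3 * NV D v by rewrite mulr_ge0 ?NV_ge0.
have [I H] := @hoelder3 R n D mD 3 3 3 _ _ _ _ _ _ isT isT isT inv333 (@young3 R)
  (mes _ hd) (mes _ hu) (mes _ he) (n3 _) (n3 _) (n3 _) (hK3 hd) (hK3 hu) (hK3 he).
have lf1 := fric hu0 hu; have lf2 := fric huh huh.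
rewrite -l2VBl //.
have lw := L2vB mD lf1 lf2.
have I2 := L2v_dotv mD fD lw le_.
pose G x := norm2 (u x - u0 x) * norm2 (u x) * norm2 (e x).
have h0 : 0 <= \int[vol]_(x in D) (dotv (norm2 (u0 x) *: u x - norm2 (uh x) *: uh x) (e x) + G x).
  apply: Rintegral_ge0 => x _.
  by have := forchheimer_monotone (u0 x) (u x) (uh x); rewrite /G /e; lra.
move: h0; rewrite RintegralD // -/(l2V D _ _) => h0.
have h1 : \int[vol]_(x in D) G x <= K3 ^+ 3 * (NV D (fun x => u x - u0 x) * NV D u * NV D e).
  apply: le_trans (ler_norm _) _; apply: le_trans (le_normr_Rintegral mD I) _.
  by apply: le_trans H _; rewrite le_eqVlt; apply/orP; left; apply/eqP; ring.
lra.
Qed.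

(** The stabilization gamma (u - u0) tested with [e] is polarized. Besides the difference of squared
    errors it produces gamma/2 |u - u0|^2, which will absorb the error of the lagged friction. *)
Lemma step_error :
  gamma / 2 * (NV D e ^+ 2 - NV D (fun x => u0 x - uh x) ^+ 2 + NV D (fun x => u x - u0 x) ^+ 2)
    + m * NV D e ^+ 2 <=
  beta P / rho P * K3 ^+ 3 * NV D (fun x => u x - u0 x) * NV D u * NV D e
    + cf1 P * N2 D (C0 \- Ch) * NV D e.
Proof.
have [_ _ _ s1] := step; have [_ _ _ s2] := limit.
have [a1 _ _] := s1 e p C he hp hC; have [a2 _ _] := s2 e ph Ch he hph hCh.
(* Both pressures are paired with both velocities, so that each of them vanishes against e = u -
   uh. *)
have [_ b1 _] := s1 u p C hu hp hC; have [_ b2 _] := s2 uh p Ch huh hp hCh.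
have [_ b3 _] := s1 u ph C hu hph hC; have [_ b4 _] := s2 uh ph Ch huh hph hCh.
have p1 : l2V D (wgrad D p) e = 0 by rewrite /e l2VBr // b1 b2 subrr.
have p2 : l2V D (wgrad D ph) e = 0 by rewrite /e l2VBr // b3 b4 subrr.
rewrite p1 addr0 in a1; rewrite p2 addr0 in a2.
have ld : L2v D (fun x => u x - u0 x) by exact: L2vB.
have le0 : L2v D (fun x => u0 x - uh x) by exact: L2vB.
have lKu := Kinv_L2v hP lu; have lKuh := Kinv_L2v hP luh.
have k1 : m * NV D e ^+ 2 <= mu P / rho P * (l2V D (fun x => app_mx (Kinv P x) (u x)) e
    - l2V D (fun x => app_mx (Kinv P x) (uh x)) e).
  rewrite /m -mulrA ler_pM2l ?divr_gt0 ?(mu_gt0 hP) ?(rho_gt0 hP) //.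
  apply: le_trans (Kinv_coercive_int hP le_) _.
  rewrite -l2VBl // le_eqVlt; apply/orP; left; apply/eqP; apply: eq_Rintegral => x _.
  by rewrite /app_mx mulmxBl.
have k2 : l2V D (fun x => u x - u0 x) e =
    2^-1 * (NV D e ^+ 2 - NV D (fun x => u0 x - uh x) ^+ 2 + NV D (fun x => u x - u0 x) ^+ 2).
  set a0 := (fun x => u x - u0 x).
  have -> : (fun x => u0 x - uh x) = (fun x => e x - a0 x).
    by apply/funext => x; rewrite /e /a0; apply/rowP => i; rewrite !mxE; ring.
  move: ld le_; rewrite -/a0; move: a0 e => a e' la le'.
  have lea : L2v D (fun x => e' x - a x) by exact: L2vB.
  rewrite !NV_sqr (l2VBl mD fD le' la lea) (l2VBr mD fD le' la le') (l2VBr mD fD le' la la).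
  rewrite (l2VC D e' a); exact: polarization_arith.
have k3 := friction_diff.
have k4 : l2V D (fC P C0) e - l2V D (fC P Ch) e <= cf1 P * N2 D (C0 \- Ch) * NV D e.
  rewrite -l2VBl //; apply: le_trans (ler_norm _) _.
  apply: le_trans (l2V_CS mD fD (L2vB mD lfC0 lfCh) le_) _.
  rewrite ler_wpM2r ?NV_ge0 // (_ : (fun x => _) = fun x => f1 P (C0 x) - f1 P (Ch x)).
    by apply: f1_NV => //; [case: hC01|case: hCh1].
  by apply/funext => x; rewrite /fC opprD addrACA subrr add0r.
have b0 : 0 < beta P / rho P by rewrite divr_gt0 ?(beta_gt0 hP) ?(rho_gt0 hP).
have k5 : - (beta P / rho P * K3 ^+ 3 * NV D (fun x => u x - u0 x) * NV D u * NV D e) <=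
   beta P / rho P * (l2V D (fun x => norm2 (u0 x) *: u x) e - l2V D (fun x => norm2 (uh x) *: uh x) e).
  by move: k3; rewrite -(ler_pM2l b0); apply: le_trans; rewrite le_eqVlt; apply/orP; left; apply/eqP; ring.
rewrite k2 in a1; exact: (error_arith a1 a2 k1 k4 k5).
Qed.

(** The bounds on the gradient in L3 and on the supremum concern [Cx], so [Ch] is written as Cx -
    (Cx - Ch). The part of [Cx] uses these bounds and the L2 norm of [e]; the part of Cx - Ch is
    small through [d], which compensates the inverse inequality spent on [e]. *)
Lemma step_conc_error Cx (c3 M d : R) : H10 D Cx -> 0 <= c3 -> 0 <= M ->
  (LpV 3%:E D (wgrad D Cx) <= c3%:E)%E -> {ae vol, forall x, D x -> `|Cx x| <= M} ->
  NV D (wgrad D (Cx \- Ch)) <= d ->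
  alpha P * NV D (wgrad D (C \- Ch)) <=
    (2^-1 * (S6 * c3 + M) + K3 * S6 * d) * NV D e.
Proof.
move=> hCx c30 M0 hc3 hM hd.
have S60 : 0 < S6 by case: hS6.
have hCx1 := sobolev_H1f oD hCx.1.
have [t tE] : exists t, t = C \- Ch by exists (C \- Ch).
have [dl dlE] : exists dl, dl = Cx \- Ch by exists (Cx \- Ch).
rewrite -tE; rewrite -dlE in hd.
have hC2 : H10 D C by case: hC.
have hCh2 : H10 D Ch by case: hCh.
have ht : H10 D t by rewrite tE; exact: (H10B oD bD hC2 hCh2).
have hdl : H10 D dl by rewrite dlE; exact: (H10B oD bD hCx hCh2).
have ht1 := sobolev_H1f oD ht.1; have hdl1 := sobolev_H1f oD hdl.1.
have hty : spYh D T t by rewrite tE; exact: (spYhB oD bD hC hCh).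
have [_ _ _ /(_ u p t hu hp hty)[_ _ a1]] := step.
have [_ _ _ /(_ uh ph t huh hph hty)[_ _ a2]] := limit.
have lt : L2f D t by case: ht1.
have lC : L2f D C by case: hC1.
have lCh : L2f D Ch by case: hCh1.
have lCx : L2f D Cx by case: hCx1.
have ldl : L2f D dl by case: hdl1.
move: a1 a2; rewrite (conc_hE hP tT hu hC2 ht) (conc_hE hP tT huh hCh2 ht) => a1 a2.
have gt : l2V D (wgrad D C) (wgrad D t) - l2V D (wgrad D Ch) (wgrad D t) = NV D (wgrad D t) ^+ 2.
  have lg f : H1f D f -> L2v D (wgrad D f) by exact: (H1f_L2v).
  rewrite -(l2VBl mD fD (lg _ hC1) (lg _ hCh1) (lg _ ht1)) NV_sqr.
  apply: (l2V_ae mD (L2vB mD (lg _ hC1) (lg _ hCh1)) (lg _ ht1) (lg _ ht1) (lg _ ht1)); last exact: aeW.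
  have := wgradB oD (fun i => (hC1.2 i).1) (fun i => (hCh1.2 i).1).
  by apply: filterS => x h Dx; rewrite tE h.
have g2 : l2 D C t - l2 D Ch t = l2 D t t by rewrite -(l2Bl mD lC lCh lt); exact: (congr1 (fun z => l2 D z t) (esym tE)).
(* The transport of [t] by [u] appears identically in [s1] and [s2] and cancels in the skew form. *)
have s1 : trans P u C t - trans P uh Ch t = trans P u t t + trans P e Ch t.
  by rewrite (congr1 (fun z => trans P u z t) tE) /e (transBu hu huh hCh1 lt) (transBC hu hC1 hCh1 lt) addrA subrK.
have s2 : trans P u t C - trans P uh t Ch = trans P u t t + trans P e t Ch.
  by rewrite (congr1 (fun z => trans P u t z) tE) /e (transBu hu huh ht1 lCh) (transBS hu ht1 lC lCh) addrA subrK.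
have s3 : trans P e Ch t = trans P e Cx t - trans P e dl t.
  by rewrite dlE (transBC he hCx1 hCh1 lt) opprB addrC subrK.
have s4 : trans P e t Ch = trans P e t Cx - trans P e t dl.
  by rewrite dlE (transBS he ht1 lCx lCh) opprB addrC subrK.
pose E := NV D e; pose G := NV D (wgrad D t).
have E0 : 0 <= E by exact: NV_ge0.
have G0 : 0 <= G by exact: NV_ge0.
have mg f : H1f D f -> forall l, measurable_fun D (component (wgrad D f) l).
  by move=> hf l; case: (H1f_L2v hf l).
have me l : measurable_fun D (component e l) by case: (le_ l).
have mf f : L2f D f -> measurable_fun D f by case.
have n3 v : 0 <= K3 * NV D v by rewrite mulr_ge0 ?NV_ge0.
have n6 f : 0 <= S6 * NV D (wgrad D f) by rewrite mulr_ge0 ?NV_ge0 // ltW.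
have LE2 v : L2v D v -> (LpV 2%:E D v <= (NV D v)%:E)%E by move=> lv; rewrite LpV2E.
have t1 : `|trans P e Cx t| <= E * c3 * (S6 * G).
  exact: (@trilinear_bound R n D mD 2 3 6 _ _ _ _ _ _ isT isT isT inv236 (@young236 R)
    me (mg _ hCx1) (mf _ lt) E0 c30 (n6 t) (LE2 _ le_) hc3 (sobolev6 ht)).
have t2 : `|trans P e t Cx| <= M * (E * G) by exact: (trans_bounded he ht1 lCx M0 hM).
have d0 : 0 <= d := le_trans (NV_ge0 _ _) hd.
have Sd0 : 0 <= S6 * d by rewrite mulr_ge0 ?(ltW S60).
have hd6 : (Lp 6%:E D dl <= (S6 * d)%:E)%E.
  by apply: le_trans (sobolev6 hdl) _; rewrite lee_fin ler_wpM2l ?(ltW S60).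
have hd2 : (LpV 2%:E D (wgrad D dl) <= d%:E)%E.
  by apply: le_trans (LE2 _ (H1f_L2v hdl1)) _; rewrite lee_fin.
(* Exponents 3, 2, 6: the velocity error by the inverse inequality, a gradient in L2, and the last
   factor by the Sobolev inequality. *)
have t3 : `|trans P e t dl| <= K3 * E * G * (S6 * d).
  exact: (@trilinear_bound R n D mD 3 2 6 _ _ _ _ _ _ isT isT isT inv326 (@young326 R)
    me (mg _ ht1) (mf _ ldl) (n3 e) G0 Sd0 (hK3 he) (LE2 _ (H1f_L2v ht1)) hd6).
have t4 : `|trans P e dl t| <= K3 * E * d * (S6 * G).
  exact: (@trilinear_bound R n D mD 3 2 6 _ _ _ _ _ _ isT isT isT inv326 (@young326 R)
    me (mg _ hdl1) (mf _ lt) (n3 e) d0 (n6 t) (hK3 he) hd2 (sobolev6 ht)).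
have r0p := r0_gt0 hP; have ltt := l2_ge0 D t; have a0 := alpha_gt0 hP.
have rt : 0 <= r0 P * l2 D t t by rewrite mulr_ge0 // ltW.
have main : alpha P * G ^+ 2 <= ((2^-1 * (S6 * c3 + M) + K3 * S6 * d) * E) * G.
  have eq : alpha P * G ^+ 2 + r0 P * l2 D t t =
     2^-1 * (trans P e t Cx - trans P e t dl - (trans P e Cx t - trans P e dl t)).
    by rewrite /G -gt -g2; rewrite s3 in s1; rewrite s4 in s2; exact: (conc_arith a1 a2 s1 s2).
  exact: (conc_bound_arith eq rt t1 t2 t3 t4).
apply: (ler_cancel_sqr _ G0 main); rewrite mulr_ge0 //.
by rewrite addr_ge0 // mulr_ge0 ?addr_ge0 // mulr_ge0 // ltW.
Qed.

End one_step.

Section convergence_arithmetic.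
Context {R : realType}.
Implicit Types (a b c r : R).

(** [b] may be negative: besides squared errors, the lemma serves for the excess of the velocity
    norm over the fixed point of its recursion. *)
Lemma geometric_eventually (b : nat -> R) r i0 : 0 <= r -> r < 1 ->
  (forall i, (i0 <= i)%N -> b i.+1 <= r * b i) ->
  forall e : R, 0 < e -> exists N, forall i, (N <= i)%N -> b i <= e.
Proof.
move=> r0 r1 h e e0.
have hk k : b (i0 + k)%N <= r ^+ k * `|b i0|.
  elim: k => [|k IH]; first by rewrite addn0 expr0 mul1r ler_norm.
  rewrite addnS exprS -mulrA; apply: le_trans (h _ (leq_addr _ _)) _.
  by rewrite ler_wpM2l.
have : (r ^+ k * `|b i0|) @[k --> \oo] --> 0 * `|b i0|.
  by apply: cvgM; [apply: cvg_expr; rewrite ger0_norm|exact: cvg_cst].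
rewrite mul0r => /cvgrPdist_le/(_ e e0)[N _ hN].
exists (i0 + N)%N => i Ni; have E : i = (i0 + (i - i0))%N.
  by rewrite subnKC // (leq_trans (leq_addr _ _) Ni).
rewrite E; apply: le_trans (hk _) _.
have := hN (i - i0)%N; rewrite /= sub0r normrN => /(_ _).
rewrite leq_subRL ?(leq_trans (leq_addr _ _) Ni) // Ni => /(_ isT).
by apply: le_trans; exact: ler_norm.
Qed.

(** Since (8/7)^2 27/32 <= 9/8, Young's inequality bounds the friction term by gamma/2 Z^2 + 9/16 m
    X^2. Since c <= 3/8, the coupling is at most 3/16 m (X^2 + Y^2). Of the coercivity m X^2 there
    remains m/4 on the left, against 3/16 m < m/5 on the right. *)
Lemma contraction_arith (gamma m B L1 s c t X Y Z : R) : 0 < gamma -> 0 < m -> 0 <= B ->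
  0 <= s -> 0 <= X -> 0 <= Y -> 0 <= c -> c ^+ 2 <= 8^-1 ->
  s <= 8 / 7 * L1 -> 32 * (B * L1) ^+ 2 <= 27 * m * gamma -> t <= c * m * Y ->
  gamma / 2 * (X ^+ 2 - Y ^+ 2 + Z ^+ 2) + m * X ^+ 2 <= B * Z * s * X + t * X ->
  (gamma / 2 + m / 4) * X ^+ 2 <= (gamma / 2 + m / 5) * Y ^+ 2.
Proof.
move=> g0 m0 B0 s0 X0 Y0 c0 c2 sL gL tc h.
have c1 : c <= 3 / 8 by nra.
have b2 : (B * s) ^+ 2 <= 9 / 8 * (m * gamma).
  have h1 : B * s <= B * (8 / 7 * L1) by rewrite ler_wpM2l.
  have h2 : (B * s) ^+ 2 <= (B * (8 / 7 * L1)) ^+ 2.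
    by apply: lerXn2r h1; rewrite nnegrE mulr_ge0 // (le_trans s0).
  apply: le_trans h2 _.
  have -> : (B * (8 / 7 * L1)) ^+ 2 = (8 / 7) ^+ 2 * (B * L1) ^+ 2 by ring.
  have mg : 0 < m * gamma by rewrite mulr_gt0.
  by move: gL; rewrite -mulrA; lra.
have k1 : 2 * (B * s * Z * X) <= gamma * Z ^+ 2 + 9 / 8 * m * X ^+ 2.
  rewrite -(ler_pM2l g0).
  have := sqr_ge0 (gamma * Z - B * s * X).
  have : (B * s) ^+ 2 * X ^+ 2 <= 9 / 8 * (m * gamma) * X ^+ 2.
    by rewrite ler_wpM2r ?sqr_ge0.
  by move=> *; lra.
have k2 : t * X <= 3 / 8 * m * (Y * X).
  apply: (@le_trans _ _ (c * m * Y * X)); first by rewrite ler_wpM2r.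
  by rewrite -mulrA ler_wpM2r ?mulr_ge0 // ler_wpM2r // ltW.
have k3 : m * (2 * (Y * X)) <= m * (X ^+ 2 + Y ^+ 2).
  by rewrite ler_pM2l //; have := sqr_ge0 (X - Y); lra.
have k4 := mulr_ge0 (ltW m0) (sqr_ge0 Y).
lra.
Qed.

Lemma contraction_ratio (gamma m : R) : 0 < gamma -> 0 < m -> exists r, [/\ 0 <= r, r < 1 &
  forall x y : R, (gamma / 2 + m / 4) * x <= (gamma / 2 + m / 5) * y -> x <= r * y].
Proof.
move=> g0 m0.
have gp : 0 < gamma / 2 + m / 4 by lra.
have gp' : 0 < gamma / 2 + m / 5 by lra.
exists ((gamma / 2 + m / 5) / (gamma / 2 + m / 4)); split.
- by rewrite divr_ge0 // ltW.
- by rewrite ltr_pdivrMr // mul1r ltrD2l; lra.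
- by move=> x y h; rewrite mulrAC ler_pdivlMr // mulrC.
Qed.

(** Chains the Poincaré inequality, the concentration estimate and the first smallness condition;
    [sq] stands for the square root of 2. *)
Lemma smallness_arith (al mu Km rho cf S2 A Y G N sq : R) : 0 < al -> 0 < rho -> 0 < cf -> 0 < S2 ->
  0 < sq -> 0 <= Y -> A <= al * mu * Km / (2 * sq * rho * cf * S2) ->
  N <= S2 * G -> al * G <= A * Y -> cf * N <= (2 * sq)^-1 * (mu / rho * Km) * Y.
Proof.
move=> a0 r0 c0 S0 s0 Y0 hA hN hG.
have h1 : al * (cf * N) <= al * (cf * (S2 * G)) by rewrite !ler_pM2l.
have h2 : cf * S2 * (al * G) <= cf * S2 * (A * Y) by rewrite ler_pM2l ?mulr_gt0.
have h3 : cf * S2 * (A * Y) <= cf * S2 * (al * mu * Km / (2 * sq * rho * cf * S2) * Y).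
  by rewrite ler_pM2l ?mulr_gt0 // ler_wpM2r.
rewrite -(ler_pM2l a0); apply: le_trans h1 _.
rewrite [leLHS](_ : _ = cf * S2 * (al * G)); last by ring.
apply: le_trans h2 _; apply: le_trans h3 _.
by rewrite le_eqVlt; apply/orP; left; apply/eqP; field; rewrite !gt_eqF.
Qed.

(** The constant left over from the first smallness condition; the bound 1/8 on its square is what
    [contraction_arith] asks of [c]. *)
Lemma inv_2sqrt2 : 0 <= (2 * Num.sqrt 2 : R)^-1 /\ (2 * Num.sqrt 2 : R)^-1 ^+ 2 <= 8^-1.
Proof.
split; first by rewrite invr_ge0 mulr_ge0 ?sqrtr_ge0.
rewrite exprVn exprMn sqr_sqrtr // le_eqVlt; apply/orP; left; apply/eqP; congr (_^-1); ring.
Qed.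

End convergence_arithmetic.

(** * Contraction of the iteration on a fixed mesh *)

Section convergence.
Context {R : realType} {n : nat} (P : problem R n).
Local Notation pt := 'rV[R]_n.+1.
Local Notation vol := (leb R n.+1).
Local Notation D := (Omega P).
Implicit Types (u v w : pt -> pt) (p q C S : pt -> R).
Hypothesis hP : standing_assumptions P.
Hypothesis hf0 : L2v D (f0 P).
Variable T : mesh R n.
Hypothesis tT : triangulates D T.
Variables (S2 S6 K3 : R).
Hypothesis hS2 : sobolev_cst P 2 S2.
Hypothesis hS6 : sobolev_cst P 6 S6.
Hypothesis K30 : 0 <= K3.
Hypothesis hK3 : forall v, spXh D T v -> (LpV 3%:E D v <= (K3 * NV D v)%:E)%E.
Variables (gamma : R) (us : nat -> pt -> pt) (ps Cs : nat -> pt -> R).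
Hypothesis gamma0 : 0 < gamma.
Hypothesis iter_ok : iterates P T gamma us ps Cs.
Variables (uh : pt -> pt) (ph Ch : pt -> R).
Hypothesis limit : solves_Vah P T uh ph Ch.

Let m := mu P / rho P * Km P.
Let F := Fcst P S2.
Hypothesis F0 : 0 < F.
Let oD := domain_open hP.
Let bD := domain_bounded hP.
Let mD := domain_measurable hP.
Let fD := domain_finite hP.

Let m_gt0 : 0 < m.
Proof. by rewrite mulr_gt0 ?(Km_gt0 hP) // divr_gt0 ?(mu_gt0 hP) ?(rho_gt0 hP). Qed.

Lemma iterate_spXh i : spXh D T (us i).
Proof. by case: iter_ok => h0 _ h; case: i => // i; case: (h i). Qed.

Lemma iterate_spYh i : spYh D T (Cs i).
Proof.
case: iter_ok => _ h0 h; case: i => [|i]; first exact: h0.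
by have [_ _ hh _] := h i.
Qed.

Lemma iterate_step i : solves_Vahi P T gamma (us i) (Cs i) (us i.+1) (ps i.+1) (Cs i.+1).
Proof. by case: iter_ok. Qed.

Lemma iterate_conc i S : spYh D T S -> conc_h P (us i.+1) (Cs i.+1) S = l2 D (g P) S.
Proof.
move=> hS; have [hu hp _ /(_ _ _ S hu hp hS)[]] := iterate_step i.
by [].
Qed.

Lemma iterate_fC i : NV D (fC P (Cs i.+1)) <= F.
Proof.
have hC := iterate_spYh i.+1.
apply: (fC_energy hP hf0 hS2 tT (iterate_spXh i.+1)); first by case: hC.
exact: iterate_conc.
Qed.

(** [L1cst] is the fixed point F / m of the affine recursion, and the excess over it shrinks by
    gamma / (gamma + m) at each step. The factor 8/7 is the room that [contraction_arith] leaves. *)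
Lemma velocity_eventually : exists N, forall i, (N <= i)%N -> NV D (us i) <= 8 / 7 * L1cst P S2.
Proof.
have L1E : L1cst P S2 = F / m.
  rewrite /L1cst /m /F; field.
  by rewrite !gt_eqF ?(mu_gt0 hP) ?(rho_gt0 hP) ?(Km_gt0 hP).
pose r := gamma / (gamma + m).
have gm : 0 < gamma + m by exact: addr_gt0.
(* From rank 1 on, because the data term is bounded for concentrations that solve a discrete
   equation. *)
have h i : (1 <= i)%N -> NV D (us i.+1) - F / m <= r * (NV D (us i) - F / m).
  case: i => // i _.
  have := step_velocity_bound hP hf0 gamma0 (iterate_spXh i.+1) (iterate_spYh i.+1) (iterate_step i.+1) (iterate_fC i).
  rewrite -/m => h; rewrite /r lerBlDr mulrAC.
  have -> : gamma * (NV D (us i.+1) - F / m) / (gamma + m) + F / m = (gamma * NV D (us i.+1) + F) / (gamma + m).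
    by field; rewrite !gt_eqF.
  by rewrite ler_pdivlMr // mulrC.
have r0 : 0 <= r by rewrite divr_ge0 ?ltW.
have r1 : r < 1 by rewrite ltr_pdivrMr // mul1r ltrDl.
have e0 : 0 < 1 / 7 * (F / m) by rewrite mulr_gt0 // divr_gt0.
have [N hN] := geometric_eventually r0 r1 h e0.
by exists N => i /hN; rewrite L1E; move: (F / m) => L; lra.
Qed.

Variables (Cx : pt -> R) (c3 M d : R).
Hypothesis hCx : H10 D Cx.
Hypothesis c30 : 0 <= c3.
Hypothesis M0 : 0 <= M.
Hypothesis hc3 : (LpV 3%:E D (wgrad D Cx) <= c3%:E)%E.
Hypothesis hM : {ae vol, forall x, D x -> `|Cx x| <= M}.
Hypothesis hd : NV D (wgrad D (Cx \- Ch)) <= d.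
Let A := S6 * c3 + M.
Hypothesis hA : A <= alpha P * mu P * Km P / (2 * Num.sqrt 2 * rho P * cf1 P * S2).
Hypothesis hKd : K3 * S6 * d <= A / 2.
Hypothesis hgamma : 32 * (beta P / rho P * K3 ^+ 3 * L1cst P S2) ^+ 2 <= 27 * m * gamma.

(** By [hKd] the contribution of Cx - Ch is at most A/2, the same as the share of [Cx] itself. *)
Lemma conc_le_velocity i : alpha P * NV D (wgrad D (Cs i.+1 \- Ch)) <=
  A * NV D (fun x => us i.+1 x - uh x).
Proof.
have h := step_conc_error hP tT hS6 K30 hK3 (iterate_step i) limit hCx c30 M0 hc3 hM hd.
apply: le_trans h _; rewrite ler_wpM2r ?NV_ge0 //.
apply: le_trans (lerD (lexx _) hKd) _.
by rewrite -/A [2^-1 * A]mulrC -splitr.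
Qed.

(** The smallness of the exact concentration makes the coupling weaker than the coercivity [m] of
    the velocity equation, by the factor 1 / (2 sqrt 2). *)
Lemma conc_error_L2 i : cf1 P * N2 D (Cs i.+1 \- Ch) <=
  (2 * Num.sqrt 2)^-1 * m * NV D (fun x => us i.+1 x - uh x).
Proof.
have [hC1 hC2] := iterate_spYh i.+1; have [_ _ [_ hCh] _] := limit.
have hp := poincare hP hS2 (H10B oD bD hC2 hCh).
have S20 := S2_gt0 hS2; have c0 := cf1_gt0 hP; have a0 := alpha_gt0 hP.
have s2 : 0 < Num.sqrt 2 :> R by rewrite sqrtr_gt0.
have h := conc_le_velocity i.
exact: (smallness_arith a0 (rho_gt0 hP) c0 S20 s2 (NV_ge0 _ _) hA hp h).
Qed.

Lemma velocity_contraction : exists r, exists N, [/\ 0 <= r, r < 1 & forall i, (N <= i)%N ->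
  NV D (fun x => us i.+1 x - uh x) ^+ 2 <= r * NV D (fun x => us i x - uh x) ^+ 2].
Proof.
have [N hN] := velocity_eventually.
have [r [r0 r1 hr]] := contraction_ratio gamma0 m_gt0.
(* Rank 1 at least, so that the concentration entering the step was computed from the velocity of
   the same rank. *)
exists r, (maxn 1 N); split; [exact: r0|exact: r1|].
case=> [|i]; first by rewrite geq_max.
rewrite geq_max => /andP[_ Ni].
have s := step_error hP hf0 tT K30 hK3 (iterate_spXh i.+1) (iterate_spYh i.+1) (iterate_step i.+1) limit.
apply: hr; have [c0 sq] := @inv_2sqrt2 R.
have B0 : 0 <= beta P / rho P * K3 ^+ 3.
  by rewrite mulr_ge0 ?exprn_ge0 // divr_ge0 ?ltW ?(beta_gt0 hP) ?(rho_gt0 hP).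
have N' : (N <= i.+2)%N by exact: leq_trans (leqnSn _).
exact: (contraction_arith gamma0 m_gt0 B0 (NV_ge0 D (us i.+2)) (NV_ge0 D _) (NV_ge0 D _) c0 sq (hN _ N') hgamma
  (conc_error_L2 i) s).
Qed.

Lemma velocity_converges e : 0 < e -> exists N, forall i, (N <= i)%N ->
  NV D (fun x => us i x - uh x) <= e.
Proof.
move=> e0; have [r [N [r0 r1 h]]] := velocity_contraction.
have e2 : 0 < e ^+ 2 by rewrite exprn_gt0.
have [N' hN'] := geometric_eventually r0 r1 h e2.
exists N' => i /hN' h'; by rewrite -ler_sqr ?nnegrE ?NV_ge0 // ltW.
Qed.

Lemma conc_converges e : 0 < e -> exists N, forall i, (N <= i)%N -> N2 D (Cs i \- Ch) <= e.
Proof.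
move=> e0; have c0 := cf1_gt0 hP.
have s2 : 0 < Num.sqrt 2 :> R by rewrite sqrtr_gt0.
pose k := (2 * Num.sqrt 2)^-1 * m.
have k0 : 0 < k by rewrite mulr_gt0 // invr_gt0 mulr_gt0.
have [N hN] := velocity_converges (divr_gt0 (mulr_gt0 e0 c0) k0).
exists N.+1; case=> // i Ni.
have Ni' : (N <= i.+1)%N by exact: leq_trans Ni.
have := conc_error_L2 i; rewrite -/k => h.
rewrite -(ler_pM2l c0); apply: le_trans h _.
have := hN _ Ni'; rewrite -(ler_pM2l k0) => h'; apply: le_trans h' _.
by rewrite mulrC divfK ?gt_eqF // mulrC.
Qed.

End convergence.

(** * Convergence of the pressure *)

Section cell_bump.
Context {R : realType} {n : nat}.
Local Notation pt := 'rV[R]_n.+1.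
Local Notation vol := (leb R n.+1).
Implicit Types (D : set pt) (T : mesh R n) (k : simplex R n) (x w : pt) (q : pt -> R).

(* On the cell this is [2 ^ (d+1)] times the bubble; unlike the product of the
   barycentric coordinates it vanishes outside the cell. *)
Definition cell_bump k x : R := \prod_j (bary k x ord0 j + `|bary k x ord0 j|).

Lemma cell_bump_ge0 k x : 0 <= cell_bump k x.
Proof. by apply: prodr_ge0 => j _; rewrite -lerBlDl sub0r -normrN ler_norm. Qed.

Lemma cell_bump_gt0 k x : bary_pos k x -> 0 < cell_bump k x.
Proof. by move=> h; apply: prodr_gt0 => j _; rewrite ltr_pwDl // h. Qed.

Lemma cell_bumpE k x : nondegenerate_simplex k -> cell k x ->
  cell_bump k x = 2 ^+ n.+2 * bubble k x.
Proof.
move=> nk /(cellP _ nk) h; rewrite /cell_bump /bubble.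
rewrite (eq_bigr (fun j => 2 * bary k x ord0 j)); last first.
  by move=> j _; rewrite ger0_norm // mulr_natl mulr2n.
by rewrite big_split /= prodr_const card_ord.
Qed.

(** Where the bump of [k] is nonzero all barycentric coordinates of [k] are positive, whereas two
    distinct cells meet in a proper face, on which one of them is 0. *)
Lemma cell_bump_out D T k k' x : triangulates D T -> k \in T -> k' \in T -> k != k' ->
  cell k' x -> cell_bump k x = 0.
Proof.
move=> [_ nT _ cT] kT k'T kk' k'x; have nk := nT _ kT.
have [//|/eqP h] := eqVneq (cell_bump k x) 0.
have hb j : bary k x ord0 j + `|bary k x ord0 j| != 0.
  by apply/eqP => e; apply: h; apply/eqP/prodf_eq0; exists j => //; apply/eqP.
have hp j : 0 < bary k x ord0 j.
  rewrite ltNge; apply/negP => le0; have := hb j; rewrite ler0_norm // subrr eqxx.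
  by [].
have kx : cell k x by apply/(cellP _ nk) => j; exact: ltW.
have [I [_ [IT eI _]]] := cT _ _ kT k'T kk'.
have : face k I x by rewrite -eI; split.
move=> /(faceP _ _ nk)[_ hI].
have [j jI] : exists j, j \notin I.
  apply/existsP; rewrite -negb_forall; apply: contra IT => /forallP hall.
  by apply/eqP/setP => j; rewrite inE hall.
by have := hp j; rewrite hI // ltxx.
Qed.

Lemma cell_bump_cts k : continuous (cell_bump k).
Proof.
move=> x; rewrite /cell_bump; elim: (index_enum _) => [|j r IH].
  rewrite (_ : (fun x => _) = cst 1); first exact: cst_continuous.
  by apply/funext => y; rewrite big_nil.
rewrite (_ : (fun x => _) = (fun x => (bary k x ord0 j + `|bary k x ord0 j|) *
  \prod_(i <- r) (bary k x ord0 i + `|bary k x ord0 i|))); last first.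
  by apply/funext => y; rewrite big_cons.
have ca : {for x, continuous (fun y : pt => `|bary k y ord0 j|)}.
  apply: (@continuous_comp _ _ _ (fun y : pt => bary k y ord0 j) (fun t : R => `|t|) x).
    exact: bary_cts.
  exact: norm_continuous.
have cb : {for x, continuous (fun y : pt => bary k y ord0 j)} by exact: bary_cts.
have cab := continuousD cb ca.
exact: (continuousM cab IH).
Qed.

(** On its own cell the bump is a multiple of the bubble and on the others it is 0; continuity is
    that of the formula with absolute values. *)
Lemma cell_bump_spXh D T k w : triangulates D T -> k \in T ->
  spXh D T (fun x => cell_bump k x *: w).
Proof.
move=> tT kT; have [_ nT _ _] := tT; split.
  apply: continuous_subspaceT => x.
  apply: (@continuous_comp _ _ _ (cell_bump k) (fun t : R => t *: w) x).
    exact: cell_bump_cts.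
  by apply: cvgZr_tmp.
move=> k' k'T i; have [<-|kk'] := eqVneq k k'.
  exists 0, 0, (2 ^+ n.+2 * w ord0 i) => x kx.
  by rewrite /component mxE dotv0l add0r add0r cell_bumpE ?nT //; ring.
exists 0, 0, 0 => x kx.
by rewrite /component mxE dotv0l (cell_bump_out tT kT k'T kk' kx) !mul0r !addr0.
Qed.

Lemma P1_cgrad k q : P1_on k q -> exists w, forall x, (cell k)° x -> cgrad q x = w.
Proof.
move=> [a [w h]]; exists w => x kx; apply/rowP => i; rewrite mxE /pd.
have E : \forall y \near x, q y = a + dotv w y.
  by have : nbhs x (cell k) by []; apply: filterS.
rewrite (near_eq_derive _ E) -[w ord0 i]dotv_base.
apply: cvg_lim => //; apply: cvg_near_cst; near=> t.
have t0 : t != 0 by near: t; exact: nbhs_dnbhs_neq.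
rewrite /= dotvDr dotvZr /GRing.scale /=.
by field.
Unshelve. all: by end_near. Qed.

Lemma bary_pos_neq0 k : nondegenerate_simplex k -> bary_pos k !=set0.
Proof.
move=> nk; exists ((n.+2%:R^-1 *: const_mx 1) *m k) => j.
rewrite -(bary_unique nk (l := n.+2%:R^-1 *: const_mx 1)) //.
  by rewrite !mxE mulr1 invr_gt0.
rewrite (eq_bigr (fun=> n.+2%:R^-1)); last by move=> i _; rewrite !mxE mulr1.
by rewrite sumr_const card_ord -[LHS]mulr_natr mulVf.
Qed.

(** Were the integral 0, the bump would vanish almost everywhere, but it is positive on a nonempty
    open set, which has positive measure. *)
Lemma Rintegral_cell_bump D T k : open D -> bounded_set D -> lipschitz_boundary D ->
  triangulates D T -> k \in T -> bnd D (cell_bump k) /\ 0 < \int[vol]_(x in D) cell_bump k x.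
Proof.
move=> oD bD lD tT kT; have mD := open_measurable_rV oD.
have fD : (vol D < +oo)%E by exact: bounded_leb_fin.
have [_ nT _ _] := tT; have nk := nT _ kT.
have hv : spXh D T (fun x => cell_bump k x *: const_mx 1) by exact: cell_bump_spXh.
have bb : bnd D (cell_bump k).
  have := spXh_bnd bD ord0 hv; rewrite (_ : component _ ord0 = cell_bump k) //.
  by apply/funext => x; rewrite /component !mxE mulr1.
split => //; rewrite lt_neqAle Rintegral_ge0 ?andbT; last by move=> x _; exact: cell_bump_ge0.
apply/eqP => e0.
have mb : measurable_fun D (EFin \o cell_bump k) by apply/measurable_EFinP; case: bb.
have ib := bnd_integrable mD fD bb.
have z : (\int[vol]_(x in D) `|(cell_bump k x)%:E| = 0)%E.
  rewrite (eq_integral (fun x => (cell_bump k x)%:E)); last first.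
    by move=> x _; rewrite gee0_abs // lee_fin cell_bump_ge0.
  by rewrite -[LHS]fineK ?[fine _](esym e0) //; exact: integrable_fin_num.
have [+ _] := @ae_eq_integral_abs _ pt R vol D mD _ mb.
move=> /(_ z) [N [mN N0 hN]].
have kN : bary_pos k `<=` N.
  move=> x kx; apply: hN => /= h.
  have Dx : D x by apply: (cell_interior_sub oD lD tT kT); exact: bary_pos_interior.
  by have := h Dx => -[] e; have := cell_bump_gt0 kx; rewrite e ltxx.
have ok := open_bary_pos (k := k).
have := open_vol_gt0 ok (bary_pos_neq0 nk); rewrite (subset_measure0 _ _ kN) ?ltxx //.
exact: open_measurable_rV.
Qed.

End cell_bump.

Section pressure.
Context {R : realType} {n : nat} (D : set 'rV[R]_n.+1) (T : mesh R n).
Local Notation pt := 'rV[R]_n.+1.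
Local Notation vol := (leb R n.+1).
Implicit Types (v : pt -> pt) (p q : pt -> R).
Hypothesis oD : open D.
Hypothesis bD : bounded_set D.
Hypothesis lD : lipschitz_boundary D.
Hypothesis tT : triangulates D T.

Let mD : measurable D. Proof. exact: open_measurable_rV. Qed.
Let fD : (vol D < +oo)%E. Proof. exact: bounded_leb_fin. Qed.

Lemma P1h_L2v q : P1h D T q -> L2v D (wgrad D q).
Proof. by move=> hq; apply: H1f_L2v; apply: (discrete_H1f oD bD lD tT); exact: P1h_discrete. Qed.

(** On a cell the difference [w] of the two gradients is constant. Testing with the bump times [w]
    isolates it, as the bump vanishes on the other cells: the pairing becomes |w|^2 times the
    integral of the bump. *)
Lemma grad_cell_bound k p q (e : R) : k \in T -> P1h D T p -> P1h D T q -> 0 <= e ->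
  (forall v, spXh D T v -> `|l2V D (wgrad D p) v - l2V D (wgrad D q) v| <= e * NV D v) ->
  forall x, (cell k)° x -> norm2 (cgrad p x - cgrad q x) <=
    (N2 D (cell_bump k) / \int[vol]_(x in D) cell_bump k x) * e.
Proof.
move=> kT hp hq e0 h x kx.
have [bb I0] := Rintegral_cell_bump oD bD lD tT kT.
set I := \int[vol]_(x in D) _ in I0 *.
have [_ hpT] := hp; have [_ hqT] := hq.
have [wp hwp] := P1_cgrad (hpT _ kT); have [wq hwq] := P1_cgrad (hqT _ kT).
rewrite hwp // hwq //; set w := wp - wq.
have hv := cell_bump_spXh w tT kT.
have lv := spXh_L2v oD bD hv; have lp := P1h_L2v hp; have lq := P1h_L2v hq.
have := h _ hv; rewrite -l2VBl //.
have -> : l2V D (fun y => wgrad D p y - wgrad D q y) (fun y => cell_bump k y *: w) = norm2 w ^+ 2 * I.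
  rewrite /I -RintegralZl //; last exact: bnd_integrable.
  have lpq := L2vB mD lp lq.
  apply: ae_eq_Rintegral => //.
  - by apply: measurable_dotv_fun => // i; [case: (lpq i)|case: (lv i)].
  - by apply: measurable_funM => //; case: bb.
  have e1 := discrete_wgrad oD bD lD tT (P1h_discrete hp).
  have e2 := discrete_wgrad oD bD lD tT (P1h_discrete hq).
  apply: filterS3 e1 e2 (mesh_interior_ae tT) => y E1 E2 E3 Dy.
  have [k' k'T k'y] := E3 (subset_closure Dy); have [_ nT _ _] := tT.
  have [ek|kk'] := eqVneq k k'.
    have ky : (cell k)° y by rewrite ek; exact: (bary_pos_interior (nT _ k'T)).
    by rewrite E1 // E2 // hwp // hwq // dotvZr -norm2_sqr mulrC.
  have k'y' : cell k' y by exact: (bary_pos_cell (nT _ k'T)).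
  by rewrite (cell_bump_out tT kT k'T kk' k'y') scale0r dotvC dotv0l mulr0.
rewrite (ger0_norm (mulr_ge0 (sqr_ge0 _) (ltW I0))).
have -> : NV D (fun y => cell_bump k y *: w) = N2 D (cell_bump k) * norm2 w.
  rewrite mulrC -[norm2 w](ger0_norm (norm2_ge0 w)) -(N2Z mD (norm2 w) (bnd_L2 mD fD bb)).
  rewrite NVE; congr Num.sqrt; apply: eq_Rintegral => y _ /=.
  by rewrite norm2Z (ger0_norm (cell_bump_ge0 k y)) [norm2 w * _]mulrC.
move=> H; rewrite mulrAC ler_pdivlMr // mulrC.
apply: (ler_cancel_sqr _ (norm2_ge0 w)); first by rewrite mulr_ge0 // N2_ge0.
by rewrite mulrC; apply: le_trans H _; rewrite le_eqVlt; apply/orP; left; apply/eqP; ring.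
Qed.

(** The constant sums over the finitely many cells and depends on the mesh; it only determines how
    soon the iterates are close. *)
Lemma grad_uniform_bound : exists2 c : R, 0 <= c & forall p q (e : R), P1h D T p -> P1h D T q -> 0 <= e ->
  (forall v, spXh D T v -> `|l2V D (wgrad D p) v - l2V D (wgrad D q) v| <= e * NV D v) ->
  {ae vol, forall x, D x -> norm2 (wgrad D p x - wgrad D q x) <= c * e}.
Proof.
pose ck k := N2 D (cell_bump k) / \int[vol]_(x in D) cell_bump k x.
have ck0 k : k \in T -> 0 <= ck k.
  by move=> kT; have [_ I0] := Rintegral_cell_bump oD bD lD tT kT; rewrite divr_ge0 ?N2_ge0 // ltW.
exists (\sum_(k <- T | k \in T) ck k); first by rewrite big_seq_cond sumr_ge0 // => k /andP[kT _]; exact: ck0.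
move=> p q e hp hq e0 h.
have e1 := discrete_wgrad oD bD lD tT (P1h_discrete hp).
have e2 := discrete_wgrad oD bD lD tT (P1h_discrete hq).
apply: filterS3 e1 e2 (mesh_interior_ae tT) => y E1 E2 E3 Dy.
have [k kT ky] := E3 (subset_closure Dy); have [uT nT _ _] := tT.
rewrite E1 // E2 //.
apply: le_trans (grad_cell_bound kT hp hq e0 h (bary_pos_interior (nT _ kT) ky)) _.
rewrite ler_wpM2r // -big_seq (bigD1_seq k) //= lerDl.
by rewrite big_seq_cond sumr_ge0 // => k' /andP[k'T _]; exact: ck0.
Qed.

End pressure.

Lemma pressure_arith (R : realFieldType) (gamma mr br G K1 K2 f1 f2 p1 p2 F1 F2 a b c d V : R) :
  0 <= gamma -> 0 <= mr -> 0 <= br ->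
  gamma * G + mr * K1 + br * f1 + p1 = F1 -> mr * K2 + br * f2 + p2 = F2 ->
  `|F1 - F2| <= a * V -> `|G| <= b * V -> `|K1 - K2| <= c * V -> `|f1 - f2| <= d * V ->
  `|p1 - p2| <= (a + gamma * b + mr * c + br * d) * V.
Proof.
move=> g0 m0 b0 e1 e2 h1 h2 h3 h4.
have -> : p1 - p2 = (F1 - F2) - gamma * G - mr * (K1 - K2) - br * (f1 - f2) by rewrite -e1 -e2; ring.
rewrite !mulrDl -!mulrA; apply: le_trans (ler_normB _ _) _; rewrite normrM (ger0_norm b0).
apply: lerD; last by rewrite ler_wpM2l.
apply: le_trans (ler_normB _ _) _; rewrite normrM (ger0_norm m0).
apply: lerD; last by rewrite ler_wpM2l.
apply: le_trans (ler_normB _ _) _; rewrite normrM (ger0_norm g0).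
by apply: lerD; last by rewrite ler_wpM2l.
Qed.

Section pressure_convergence.
Context {R : realType} {n : nat} (P : problem R n).
Local Notation pt := 'rV[R]_n.+1.
Local Notation vol := (leb R n.+1).
Local Notation D := (Omega P).
Implicit Types (u v w : pt -> pt) (p q C S : pt -> R).
Hypothesis hP : standing_assumptions P.
Hypothesis hf0 : L2v D (f0 P).
Variable T : mesh R n.
Hypothesis tT : triangulates D T.
Let oD := domain_open hP.
Let bD := domain_bounded hP.
Let mD := domain_measurable hP.
Let fD := domain_finite hP.
Let lD := domain_lipschitz hP.

Lemma Kinv_NV : exists2 k : R, 0 <= k & forall w, L2v D w ->
  NV D (fun x => app_mx (Kinv P x) (w x)) <= k * NV D w.
Proof.
have [k hk] := Kinv_bounded hP; exists `|k| => // w lw.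
have nw := L2v_norm mD fD lw; have nK := L2v_norm mD fD (Kinv_L2v hP lw).
rewrite !NVE -[X in X * _]normr_id -(N2Z mD `|k| nw).
apply: (N2_le mD nK (L2Z mD _ nw)); apply: filterS hk => x h Dx /=.
rewrite (ger0_norm (norm2_ge0 _)); apply: le_trans (h Dx _) _.
by apply: le_trans (ler_norm _) _; rewrite !normrM normr_id.
Qed.

Lemma LpV_le_cst (p b : R) v : 0 < p -> (forall i, measurable_fun D (component v i)) -> 0 <= b ->
  {ae vol, forall x, D x -> norm2 (v x) <= b} ->
  (LpV p%:E D v <= (b * fine (vol D) `^ p^-1)%:E)%E.
Proof.
move=> p0 mv b0 hb; rewrite -(Lp_cst mD fD p0 b0).
apply: (Lp_ae_le mD p0) => //; first exact: measurable_norm2_fun.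
by apply: filterS hb => x h Dx; rewrite /= (ger0_norm (norm2_ge0 _)) (ger0_norm b0) h.
Qed.

Variable K3 : R.
Hypothesis K30 : 0 <= K3.
Hypothesis hK3 : forall v, spXh D T v -> (LpV 3%:E D v <= (K3 * NV D v)%:E)%E.

Let n3 v : 0 <= K3 * NV D v. Proof. by rewrite mulr_ge0 ?NV_ge0. Qed.
Let mes v : spXh D T v -> measurable_fun D (norm2 \o v).
Proof.
by move=> hv; apply: measurable_norm2_fun => i; case: (spXh_L2v oD bD hv i).
Qed.

Lemma norm3_integral u v w : spXh D T u -> spXh D T v -> spXh D T w ->
  vol.-integrable D (EFin \o (fun x => norm2 (u x) * norm2 (v x) * norm2 (w x))) /\
  \int[vol]_(x in D) (norm2 (u x) * norm2 (v x) * norm2 (w x)) <=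
    K3 ^+ 3 * (NV D u * NV D v) * NV D w.
Proof.
move=> hu hv hw.
have [I H] := @hoelder3 R n D mD 3 3 3 _ _ _ _ _ _ isT isT isT inv333 (@young3 R)
  (mes hu) (mes hv) (mes hw) (n3 _) (n3 _) (n3 _) (hK3 hu) (hK3 hv) (hK3 hw).
split; first exact: I.
apply: le_trans (ler_norm _) _; apply: le_trans (le_normr_Rintegral mD I) _.
by apply: le_trans H _; rewrite le_eqVlt; apply/orP; left; apply/eqP; ring.
Qed.

Variables (gamma : R) (u0 u : pt -> pt) (C0 p C : pt -> R).
Hypothesis gamma0 : 0 < gamma.
Hypothesis hu0 : spXh D T u0.
Hypothesis hC0 : spYh D T C0.
Hypothesis step : solves_Vahi P T gamma u0 C0 u p C.
Variables (uh : pt -> pt) (ph Ch : pt -> R).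
Hypothesis limit : solves_Vah P T uh ph Ch.

Let hu : spXh D T u. Proof. by case: step. Qed.
Let huh : spXh D T uh. Proof. by case: limit. Qed.
Let hp : spMh D T p. Proof. by case: step. Qed.
Let hph : spMh D T ph. Proof. by case: limit. Qed.
Let hC : spYh D T C. Proof. by case: step. Qed.
Let hCh : spYh D T Ch. Proof. by case: limit. Qed.
Let lu0 : L2v D u0. Proof. exact: (spXh_L2v oD bD hu0). Qed.
Let lu : L2v D u. Proof. exact: (spXh_L2v oD bD hu). Qed.
Let luh : L2v D uh. Proof. exact: (spXh_L2v oD bD huh). Qed.
Let lC0 : L2f D C0. Proof. by case: (sobolev_H1f oD hC0.2.1). Qed.
Let lCh : L2f D Ch. Proof. by case: (sobolev_H1f oD hCh.2.1). Qed.

Let fric v w : spXh D T v -> spXh D T w -> L2v D (fun x => norm2 (v x) *: w x).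
Proof.
move=> hv hw; apply: (bndL2v mD (f := norm2 \o v)); last exact: (spXh_L2v oD bD hw).
by apply: bnd_comp_norm => // i; exact: (spXh_bnd bD i hv).
Qed.

(** Both the modulus and the vector vary: |u0| u - |uh| uh = |u0| (u - uh) + (|u0| - |uh|) uh. *)
Lemma friction_lipschitz v : spXh D T v ->
  `|l2V D (fun x => norm2 (u0 x) *: u x) v - l2V D (fun x => norm2 (uh x) *: uh x) v| <=
  K3 ^+ 3 * (NV D u0 * NV D (fun x => (u x - uh x)%R)
    + NV D (fun x => (u0 x - uh x)%R) * NV D uh) * NV D v.
Proof.
move=> hv; have he : spXh D T (fun x => u x - uh x) by exact: spXhB.
have hd : spXh D T (fun x => u0 x - uh x) by exact: spXhB.
have [I1 H1] := norm3_integral hu0 he hv; have [I2 H2] := norm3_integral hd huh hv.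
have lf1 := fric hu0 hu; have lf2 := fric huh huh; have lv := spXh_L2v oD bD hv.
rewrite -(l2VBl mD fD lf1 lf2 lv).
apply: (@le_trans _ _ (\int[vol]_(x in D) (norm2 (u0 x) * norm2 (u x - uh x) * norm2 (v x)
    + norm2 (u0 x - uh x) * norm2 (uh x) * norm2 (v x)))).
  have lw := L2vB mD lf1 lf2.
  apply: (ae_le_Rintegral mD _ (integrable_addf mD I1 I2)).
    by apply: measurable_dotv_fun => i; [case: (lw i)|case: (lv i)].
  apply: aeW => x _; apply: le_trans (dotv_le _ _) _.
  rewrite -mulrDl ler_wpM2r ?norm2_ge0 //.
  have -> : norm2 (u0 x) *: u x - norm2 (uh x) *: uh x =
      norm2 (u0 x) *: (u x - uh x) + (norm2 (u0 x) - norm2 (uh x)) *: uh x.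
    by rewrite scalerBr scalerBl addrA subrK.
  apply: le_trans (norm2D _ _) _; rewrite !norm2Z (ger0_norm (norm2_ge0 (u0 x))) lerD2l.
  by rewrite ler_wpM2r ?norm2_ge0 //; exact: norm2_dist.
rewrite (RintegralD mD I1 I2) mulrDr mulrDl; exact: lerD.
Qed.

(** The two momentum equations are subtracted and solved for the pressure terms; what remains is
    controlled by the errors of velocity and concentration, which tend to 0. *)
Lemma pressure_residual k : (forall w, L2v D w -> NV D (fun x => app_mx (Kinv P x) (w x)) <= k * NV D w) ->
  forall v, spXh D T v -> `|l2V D (wgrad D p) v - l2V D (wgrad D ph) v| <=
  (cf1 P * N2 D (C0 \- Ch)
   + gamma * (NV D (fun x => (u x - uh x)%R) + NV D (fun x => (u0 x - uh x)%R))
   + mu P / rho P * (k * NV D (fun x => (u x - uh x)%R))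
   + beta P / rho P * (K3 ^+ 3 * (NV D u0 * NV D (fun x => (u x - uh x)%R)
      + NV D (fun x => (u0 x - uh x)%R) * NV D uh))) * NV D v.
Proof.
move=> hk v hv.
have [_ _ _ /(_ v p C hv hp hC)[a1 _ _]] := step.
have [_ _ _ /(_ v ph Ch hv hph hCh)[a2 _ _]] := limit.
have lv := spXh_L2v oD bD hv.
have le_ := L2vB mD lu luh; have ld := L2vB mD lu0 luh; have lz := L2vB mD lu lu0.
have lf0 := fC_L2v hP hf0 lC0; have lfh := fC_L2v hP hf0 lCh.
have k1 : `|l2V D (fC P C0) v - l2V D (fC P Ch) v| <= cf1 P * N2 D (C0 \- Ch) * NV D v.
  rewrite -(l2VBl mD fD lf0 lfh lv); apply: le_trans (l2V_CS mD fD (L2vB mD lf0 lfh) lv) _.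
  rewrite ler_wpM2r ?NV_ge0 // (_ : (fun x => _) = fun x => f1 P (C0 x) - f1 P (Ch x)).
    exact: (f1_NV hP lC0 lCh).
  by apply/funext => x; rewrite /fC opprD addrACA subrr add0r.
have k2 : `|l2V D (fun x => u x - u0 x) v| <=
    (NV D (fun x => u x - uh x) + NV D (fun x => u0 x - uh x)) * NV D v.
  apply: le_trans (l2V_CS mD fD lz lv) _; rewrite ler_wpM2r ?NV_ge0 //.
  apply: le_trans (NVB mD fD le_ ld); rewrite le_eqVlt; apply/orP; left; apply/eqP; congr NV.
  by apply/funext => x; apply/rowP => i; rewrite !mxE; ring.
have k3 : `|l2V D (fun x => app_mx (Kinv P x) (u x)) v - l2V D (fun x => app_mx (Kinv P x) (uh x)) v|
    <= k * NV D (fun x => u x - uh x) * NV D v.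
  rewrite -(l2VBl mD fD (Kinv_L2v hP lu) (Kinv_L2v hP luh) lv).
  rewrite (_ : (fun x => _) = fun x => app_mx (Kinv P x) (u x - uh x)); last first.
    by apply/funext => x; rewrite /app_mx mulmxBl.
  apply: le_trans (l2V_CS mD fD (Kinv_L2v hP le_) lv) _.
  by rewrite ler_wpM2r ?NV_ge0 // hk.
have k4 := friction_lipschitz hv.
have c1 : 0 <= mu P / rho P by rewrite divr_ge0 ?ltW ?(mu_gt0 hP) ?(rho_gt0 hP).
have c2 : 0 <= beta P / rho P by rewrite divr_ge0 ?ltW ?(beta_gt0 hP) ?(rho_gt0 hP).
exact: (pressure_arith (ltW gamma0) c1 c2 a1 a2 k1 k2 k3 k4).
Qed.

End pressure_convergence.

Lemma residual_arith (R : realFieldType) (G Rp t1 w t2 I r N M L V U gC C r0 Sa SSa : R) :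
  Rp = G - t1 - 2^-1 * w - r0 * I -> w + t1 + t2 = 0 ->
  gC <= Sa * r -> C <= SSa * r -> `|Rp| <= r * N -> `|t1| <= M * (U * gC) -> `|t2| <= L * (U * C) ->
  `|I| <= C * N -> U <= V -> 0 <= U -> 0 <= M -> 0 <= L -> 0 <= V -> 0 <= C -> 0 <= gC ->
  0 <= N -> 0 <= r0 -> 0 <= r ->
  `|G| <= (N + 2^-1 * (M * V * Sa + L * V * SSa) + r0 * SSa * N + 1) * r.
Proof.
move=> e a hg hC hR h1 h2 hI hU U0 M0 L0 V0 C0 g0 N0 r00 r_ge0.
have k1 : `|t1| <= M * V * Sa * r.
  by apply: le_trans h1 _; rewrite -!mulrA ler_wpM2l // (le_trans (ler_pM U0 g0 hU hg)).
have k2 : `|t2| <= L * V * SSa * r.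
  by apply: le_trans h2 _; rewrite -!mulrA ler_wpM2l // (le_trans (ler_pM U0 C0 hU hC)).
have k3 : r0 * `|I| <= r0 * SSa * N * r.
  apply: (@le_trans _ _ (r0 * (SSa * r * N))); last by rewrite le_eqVlt; apply/orP; left; apply/eqP; ring.
  by rewrite ler_wpM2l // (le_trans hI) // ler_wpM2r.
have -> : G = Rp + 2^-1 * (t1 - t2) + r0 * I by rewrite e; move: a; lra.
apply: le_trans (ler_normD _ _) _; rewrite [`|r0 * I|]normrM (ger0_norm r00).
have k4 := le_trans (ler_normD Rp (2^-1 * (t1 - t2))) (lexx _).
have k5 : `|2^-1 * (t1 - t2)| <= 2^-1 * (`|t1| + `|t2|).
  by rewrite normrM ger0_norm // ler_wpM2l // ler_normB.
lra.
Qed.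

Section pressure_limit.
Context {R : realType} {n : nat} (P : problem R n).
Local Notation pt := 'rV[R]_n.+1.
Local Notation vol := (leb R n.+1).
Local Notation D := (Omega P).
Implicit Types (u v w : pt -> pt) (p q C S : pt -> R).
Hypothesis hP : standing_assumptions P.
Hypothesis hf0 : L2v D (f0 P).
Variable T : mesh R n.
Hypothesis tT : triangulates D T.
Variable K3 : R.
Hypothesis K30 : 0 <= K3.
Hypothesis hK3 : forall v, spXh D T v -> (LpV 3%:E D v <= (K3 * NV D v)%:E)%E.
Variables (gamma : R) (us : nat -> pt -> pt) (ps Cs : nat -> pt -> R).
Hypothesis gamma0 : 0 < gamma.
Hypothesis iter_ok : iterates P T gamma us ps Cs.
Variables (uh : pt -> pt) (ph Ch : pt -> R).
Hypothesis limit : solves_Vah P T uh ph Ch.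

Let oD := domain_open hP.
Let bD := domain_bounded hP.
Let mD := domain_measurable hP.
Let fD := domain_finite hP.
Let lD := domain_lipschitz hP.

Lemma pressure_error_arith (cf ga mr br K V W k c x y b : R) (de : R) :
  0 <= cf -> 0 <= ga -> 0 <= mr -> 0 <= br -> 0 <= K -> 0 <= W -> 0 <= k -> 0 <= x -> 0 <= y ->
  c <= de -> x <= de -> y <= de -> 0 <= V -> V <= b ->
  cf * c + ga * (x + y) + mr * (k * x) + br * (K * (V * x + y * W)) <=
  (cf + 2 * ga + mr * k + br * K * (b + W)) * de.
Proof.
move=> cf0 ga0 mr0 br0 K0 W0 k0 x0 y0 hc hx hy V0 hV.
have h1 : cf * c <= cf * de by rewrite ler_wpM2l.
have h2 : ga * (x + y) <= ga * (2 * de) by rewrite ler_wpM2l //; lra.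
have h3 : mr * (k * x) <= mr * (k * de) by rewrite !ler_wpM2l.
have de0 : 0 <= de by exact: le_trans hx.
have h4 : br * (K * (V * x + y * W)) <= br * (K * (b * de + de * W)).
  rewrite !ler_wpM2l // lerD //; last by rewrite ler_wpM2r.
  by apply: ler_pM.
lra.
Qed.

Hypothesis conv_u : forall e : R, 0 < e -> exists N, forall i, (N <= i)%N ->
  NV D (fun x => us i x - uh x) <= e.
Hypothesis conv_C : forall e : R, 0 < e -> exists N, forall i, (N <= i)%N -> N2 D (Cs i \- Ch) <= e.
Variable b : R.
Hypothesis bound_u : exists N, forall i, (N <= i)%N -> NV D (us i) <= b.

Lemma iterate_pressure i : P1h D T (ps i.+1).
Proof. by have [_ [h _] _ _] := iterate_step iter_ok i; exact: h. Qed.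

Lemma limit_pressure : P1h D T ph.
Proof. by have [_ [h _] _ _] := limit; exact: h. Qed.

(** [L] collects the coefficients of the residual estimate. The velocity iterates enter it through a
    uniform bound, because the Lipschitz constant of the friction grows with its arguments. *)
Lemma discrete_pressure_converges e : 0 < e -> exists N, forall i, (N <= i)%N ->
  {ae vol, forall x, D x -> norm2 (wgrad D ph x - wgrad D (ps i.+1) x) <= e}.
Proof.
move=> e0; have [k k0 hk] := Kinv_NV hP; have [c c0 hc] := grad_uniform_bound oD bD lD tT.
pose L := cf1 P + 2 * gamma + mu P / rho P * k + beta P / rho P * K3 ^+ 3 * (`|b| + NV D uh).
have c1 : 0 <= mu P / rho P by rewrite divr_ge0 ?ltW ?(mu_gt0 hP) ?(rho_gt0 hP).
have c2 : 0 <= beta P / rho P by rewrite divr_ge0 ?ltW ?(beta_gt0 hP) ?(rho_gt0 hP).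
have cf0 : 0 <= cf1 P by rewrite ltW ?(cf1_gt0 hP).
have K3p : 0 <= K3 ^+ 3 by rewrite exprn_ge0.
have L0 : 0 <= L.
  rewrite /L !addr_ge0 ?(mulr_ge0 c1 k0) ?(mulr_ge0 (mulr_ge0 c2 K3p)) ?addr_ge0 ?NV_ge0 //.
  by rewrite mulr_ge0 // ltW.
have cL : 0 < c * L + 1 by rewrite ltr_wpDl // mulr_ge0.
(* This accuracy for velocity and concentration gives at most [e] for the gradient, as c L / (c L +
   1) <= 1. *)
have de0 : 0 < e / (c * L + 1) by rewrite divr_gt0.
have [N1 h1] := conv_u de0; have [N2' h2] := conv_C de0; have [N3 h3] := bound_u.
exists (N1 + N2' + N3)%N => i Ni.
have i1 : (N1 <= i)%N by rewrite (leq_trans _ Ni) // -addnA leq_addr.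
have i2 : (N2' <= i)%N by rewrite (leq_trans _ Ni) // addnAC leq_addl.
have i3 : (N3 <= i)%N by rewrite (leq_trans _ Ni) // leq_addl.
have st := iterate_step iter_ok i.
have res := pressure_residual hP hf0 K30 hK3 gamma0 (iterate_spXh iter_ok i)
  (iterate_spYh iter_ok i) st limit hk.
have hb : NV D (us i) <= `|b| by exact: le_trans (h3 _ i3) (ler_norm _).
have ar := pressure_error_arith cf0 (ltW gamma0) c1 c2 K3p (NV_ge0 D uh) k0
  (NV_ge0 D (fun x => us i.+1 x - uh x)) (NV_ge0 D (fun x => us i x - uh x))
  (h2 _ i2) (h1 _ (leqW i1)) (h1 _ i1) (NV_ge0 D (us i)) hb.
have de_ge0 : 0 <= L * (e / (c * L + 1)) by rewrite mulr_ge0 // ltW.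
have := hc (ps i.+1) ph _ (iterate_pressure i) limit_pressure de_ge0 (fun v hv =>
  le_trans (res v hv) (ler_wpM2r (NV_ge0 D v) ar)).
apply: filterS => x h Dx; rewrite -norm2N opprB; apply: le_trans (h Dx) _.
rewrite mulrA [c * L * _]mulrC -mulrA ler_piMr ?(ltW e0) // mulrC.
by rewrite ler_pdivrMr // mul1r lerDl.
Qed.

Variable px : pt -> R.
Hypothesis hpx : H1f D px.

(** The discrete gradients are uniformly close almost everywhere, and on a bounded domain this makes
    the norm of exponent 3/2 of their difference small. *)
Lemma pressure_limit e : 0 < e -> exists N, forall i, (N <= i)%N ->
  (LpV (3 / 2)%:E D (wgrad D (px \- ps i.+1)%R) <= LpV (3 / 2)%:E D (wgrad D (px \- ph)%R) + e%:E)%E.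
Proof.
move=> e0; set W := fine (vol D) `^ (3 / 2)^-1.
have W0 : 0 <= W by exact: powR_ge0.
have W1 : 0 < W + 1 by rewrite ltr_wpDl.
have [N hN] := discrete_pressure_converges (divr_gt0 e0 W1).
exists N => i Ni; have hph := limit_pressure; have hpi := iterate_pressure i.
have h1 : H1f D ph by apply: (discrete_H1f oD bD lD tT); exact: P1h_discrete.
have h2 : H1f D (ps i.+1) by apply: (discrete_H1f oD bD lD tT); exact: P1h_discrete.
have l1 := H1f_L2v h1; have l2_ := H1f_L2v h2.
have m1 l : measurable_fun D (component (wgrad D (px \- ps i.+1)) l).
  by case: (H1f_L2v (H1fB oD hpx h2) l).
have m2 l : measurable_fun D (component (wgrad D (px \- ph)) l).
  by case: (H1f_L2v (H1fB oD hpx h1) l).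
have m3 l : measurable_fun D (component (fun x => wgrad D ph x - wgrad D (ps i.+1) x) l).
  by case: (L2vB mD l1 l2_ l).
have p1 : 1 <= 3 / 2 :> R by rewrite ler_pdivlMr // mul1r ler_nat.
have p0 : 0 < 3 / 2 :> R by exact: lt_le_trans p1.
have e1 := wgradB oD (fun i => (hpx.2 i).1) (fun i => (h2.2 i).1).
have e2 := wgradB oD (fun i => (hpx.2 i).1) (fun i => (h1.2 i).1).
have tri := LpV_triangle mD p1 m1 m2 m3 _.
apply: le_trans (tri _) _.
  by apply: filterS2 e1 e2 => x E1 E2 Dx; rewrite E1 // E2 // addrA subrK.
rewrite leeD2l //; apply: le_trans (LpV_le_cst hP p0 m3 (ltW (divr_gt0 e0 W1)) (hN i Ni)) _.
rewrite lee_fin -/W mulrAC ler_pdivrMr // ler_wpM2l ?(ltW e0) //.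
by rewrite lerDl.
Qed.

End pressure_limit.

(** * Lower bound for the indicators *)

Section residual.
Context {R : realType} {n : nat} (P : problem R n).
Local Notation pt := 'rV[R]_n.+1.
Local Notation vol := (leb R n.+1).
Local Notation D := (Omega P).
Implicit Types (u v w : pt -> pt) (p q C S : pt -> R).
Hypothesis hP : standing_assumptions P.
Let oD := domain_open hP.
Let bD := domain_bounded hP.
Let mD := domain_measurable hP.
Let fD := domain_finite hP.
Let lD := domain_lipschitz hP.

(** Counterpart of [trans_bounded] in which the bounded factor is the gradient, that of a test
    function. *)
Lemma l2_dot_bounded u v C (L : R) : L2v D u -> L2v D v -> L2f D C -> 0 <= L ->
  L2f D (fun x => dotv (u x) (v x)) ->
  {ae vol, forall x, D x -> norm2 (v x) <= L} ->
  `|l2 D (fun x => dotv (u x) (v x)) C| <= L * (NV D u * N2 D C).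
Proof.
move=> lu lv lC L0 ld hL.
have n1 := L2v_norm mD fD lu; have aC := L2abs mD lC.
have I := L2fM mD n1 aC.
apply: (@le_trans _ _ (\int[vol]_(x in D) (L * (norm2 (u x) * `|C x|)))).
  apply: (ae_le_Rintegral mD _ (integrable_mulcf mD L I)).
    by apply: measurable_funM; [case: ld|case: lC].
  apply: filterS hL => x h Dx; rewrite normrM mulrA ler_wpM2r //.
  rewrite mulrC; apply: le_trans (dotv_le _ _) _.
  by rewrite ler_wpM2l ?norm2_ge0 // h.
rewrite (RintegralZl _ mD I) ler_wpM2l // NVE.
apply: le_trans (ler_norm _) _; apply: le_trans (l2_CS mD n1 aC) _.
by rewrite ler_wpM2l ?N2_ge0 //; apply: (N2_le mD aC lC); apply: aeW => x _; rewrite normr_id.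
Qed.

(** The strong residual of the discrete concentration equation. The Laplacian is absent as it
    vanishes inside the cells for piecewise affine [C]; weak derivatives make this one function on
    the whole domain. *)
Definition residual u C : pt -> R := fun x =>
  g P x - dotv (u x) (wgrad D C x) - 2^-1 * (wdiv D u x * C x) - r0 P * C x.

Lemma residual_L2 T u C : triangulates D T -> spXh D T u -> H1f D C -> L2f D (residual u C).
Proof.
move=> tT hu hC; have lC : L2f D C by case: hC.
have l1 := dot_wgrad_L2 hP hu hC; have b := wdiv_bnd oD bD lD tT hu.
apply: (L2B mD _ (L2Z mD _ lC)); apply: (L2B mD _ (L2Z mD _ (bndL2M mD b lC))).
exact: (L2B mD (g_L2 hP) l1).
Qed.

Lemma l2_residual T u C S : triangulates D T -> spXh D T u -> H1f D C -> L2f D S ->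
  l2 D (residual u C) S = l2 D (g P) S - trans P u C S
    - 2^-1 * l2 D (fun x => wdiv D u x * C x) S - r0 P * l2 D C S.
Proof.
move=> tT hu hC lS; have lC : L2f D C by case: hC.
have l1 := dot_wgrad_L2 hP hu hC; have lw := bndL2M mD (wdiv_bnd oD bD lD tT hu) lC.
have lg := g_L2 hP; have a1 := L2B mD lg l1; have a2 := L2B mD a1 (L2Z mD 2^-1 lw).
rewrite /residual (l2Bl mD a2 (L2Z mD _ lC) lS) (l2Bl mD a1 (L2Z mD _ lw) lS).
by rewrite (l2Bl mD lg l1 lS) (l2Zl mD _ lw lS) (l2Zl mD _ lC lS).
Qed.

Variables (S2 : R).
Hypothesis hS2 : sobolev_cst P 2 S2.

(** [phi] is not discrete; what is paired with it is the residual. Paired with [C], the residual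
    leaves only the diffusion term, so [C] is bounded in H1 by its own residual. Paired with [phi],
    it gives the pairing of [g] with [phi] up to terms linear in [C], hence bounded by the residual
    again. In these terms antisymmetry trades the divergence of [u] for the gradient of [phi], so
    that [K] involves the velocity through [V] alone. *)
Lemma residual_test (phi : pt -> R) (V : R) : test_fun D phi -> 0 <= V ->
  exists2 K : R, 0 < K & forall T u C, triangulates D T -> spXh D T u -> H10 D C ->
    conc_h P u C C = l2 D (g P) C -> NV D u <= V ->
    `|l2 D (g P) phi| <= K * N2 D (residual u C).
Proof.
move=> tphi V0; have hphi := test_H1f oD bD tphi; have lphi : L2f D phi by case: hphi.
have [M M0 hM] := test_fun_bounded tphi.
have [L L0 hL] : exists2 L : R, 0 <= L & {ae vol, forall x, D x -> norm2 (wgrad D phi x) <= L}.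
  have hb i : exists L : R, forall x, `|pd i phi x| <= L.
    by have [L _ h] := pd_bounded i tphi; exists L.
  have [Lf hLf] := choice hb.
  exists (\sum_i `|Lf i|); first by apply: sumr_ge0.
  apply: filterS (wgrad_ae oD (fun i => test_is_wpd oD bD i tphi)) => x e Dx.
  rewrite e //; apply: le_trans (norm2_le_sum _) _; apply: ler_sum => i _.
  by rewrite mxE; apply: le_trans (hLf i x) (ler_norm _).
have S20 := S2_gt0 hS2; have a0 := alpha_gt0 hP; have r00 := r0_gt0 hP.
pose K := N2 D phi + 2^-1 * (M * V * (S2 / alpha P) + L * V * (S2 * (S2 / alpha P)))
   + r0 P * (S2 * (S2 / alpha P)) * N2 D phi + 1.
have Sa : 0 < S2 / alpha P by exact: divr_gt0.
have SSa : 0 < S2 * (S2 / alpha P) by exact: mulr_gt0.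
have K0 : 0 < K.
  rewrite /K; apply: ltr_wpDl => //; apply: addr_ge0; last first.
    by apply: mulr_ge0; [exact: ltW (mulr_gt0 r00 SSa)|exact: N2_ge0].
  apply: addr_ge0; first exact: N2_ge0.
  apply: mulr_ge0 => //; apply: addr_ge0; (apply: mulr_ge0; last exact: ltW).
    by apply: mulr_ge0 => //; exact: ltW.
  exact: mulr_ge0.
exists K => // T u C tT hu hC eC hV.
have hC1 := sobolev_H1f oD hC.1; have lC : L2f D C by case: hC1.
have lr := residual_L2 tT hu hC1.
set r := N2 D (residual u C).
have rge : 0 <= r by exact: N2_ge0.
have b1 : NV D (wgrad D C) <= S2 / alpha P * r.
  have e : alpha P * NV D (wgrad D C) ^+ 2 = l2 D (residual u C) C.
    rewrite (l2_residual tT hu hC1 lC) NV_sqr -eC /conc_h /trans.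
    by set x1 := alpha P * _; set x2 := l2 _ _ _; set x3 := 2^-1 * _; set x4 := r0 P * _; ring.
  have h : alpha P * NV D (wgrad D C) ^+ 2 <= (S2 * r) * NV D (wgrad D C).
    rewrite e; apply: le_trans (ler_norm _) _; apply: le_trans (l2_CS mD lr lC) _.
    by rewrite mulrAC [S2 * _ * _]mulrC ler_wpM2l // (poincare hP hS2 hC).
  have := ler_cancel_sqr (mulr_ge0 (ltW S20) rge) (NV_ge0 D _) h.
  by rewrite mulrAC ler_pdivlMr // mulrC.
have b2 : N2 D C <= S2 * (S2 / alpha P) * r.
  by apply: le_trans (poincare hP hS2 hC) _; rewrite -mulrA ler_pM2l.
have b3 : `|l2 D (residual u C) phi| <= r * N2 D phi by exact: (l2_CS mD lr lphi).
have b4 : `|trans P u C phi| <= M * (NV D u * NV D (wgrad D C)).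
  by apply: (trans_bounded hP hu hC1 lphi (ltW M0)); apply: aeW => x _; exact: hM.
have lu := spXh_L2v oD bD hu.
have b5 : `|trans P u phi C| <= L * (NV D u * N2 D C).
  exact: (l2_dot_bounded lu (H1f_L2v hphi) lC L0 (dot_wgrad_L2 hP hu hphi) hL).
have b6 : `|l2 D C phi| <= N2 D C * N2 D phi by exact: (l2_CS mD lC lphi).
have bu i : bnd D (component u i) by apply: spXh_bnd hu.
have bd := wdiv_bnd oD bD lD tT hu.
have as_ := convection_antisym oD bD bu bd (fun psi => wdiv_test oD bD lD tT hu (psi := psi)) hC
  (test_H10 oD bD tphi).
have e := l2_residual tT hu hC1 lphi.
exact: (residual_arith e as_ b1 b2 b3 b4 b5 b6 hV (NV_ge0 D u) (ltW M0) L0 V0 (N2_ge0 D C)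
  (NV_ge0 D (wgrad D C)) (N2_ge0 D phi) (ltW r00) rge).
Qed.

End residual.

Lemma Rintegral_sum (R : realType) (n : nat) (D : set 'rV[R]_n.+1) (I : Type) (s : seq I)
    (F : I -> 'rV[R]_n.+1 -> R) : measurable D -> (leb R n.+1 D < +oo)%E ->
  (forall i, (leb R n.+1).-integrable D (EFin \o F i)) ->
  (leb R n.+1).-integrable D (EFin \o (fun x => \sum_(i <- s) F i x)) /\
  \int[leb R n.+1]_(x in D) (\sum_(i <- s) F i x) = \sum_(i <- s) \int[leb R n.+1]_(x in D) F i x.
Proof.
move=> mD fD iF; elim: s => [|i s [I1 I2]].
  have -> : (fun x => \sum_(i <- [::]) F i x) = fun=> 0 by apply/funext => x; rewrite big_nil.
  by rewrite big_nil Rintegral_cst // mul0r; split => //; exact: integrable_cst_D.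
have -> : (fun x => \sum_(j <- i :: s) F j x) = (fun x => F i x + \sum_(j <- s) F j x).
  by apply/funext => x; rewrite big_cons.
by rewrite big_cons -I2 -RintegralD //; split => //; exact: integrable_addf.
Qed.

(** * Splitting norms over the cells *)

Section cell_decomposition.
Context {R : realType} {n : nat} (D : set 'rV[R]_n.+1) (T : mesh R n).
Local Notation pt := 'rV[R]_n.+1.
Local Notation vol := (leb R n.+1).
Implicit Types (f : pt -> R) (k : simplex R n).
Hypothesis oD : open D.
Hypothesis bD : bounded_set D.
Hypothesis lD : lipschitz_boundary D.
Hypothesis tT : triangulates D T.

Let mD : measurable D. Proof. exact: open_measurable_rV. Qed.
Let fD : (vol D < +oo)%E. Proof. exact: bounded_leb_fin. Qed.

Lemma open_cell_interior k : open (cell k)°. Proof. exact: open_interior. Qed.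
Lemma measurable_cell_interior k : measurable (cell k)°.
Proof. by apply: open_measurable_rV; exact: open_cell_interior. Qed.

Lemma diam_ge0 (A : set pt) : 0 <= diam A.
Proof.
rewrite /diam; set S := (X in sup X).
have [hS|hS] := pselect (has_sup S); last by rewrite sup_out.
have [[s Ss] bS] := hS; apply: le_trans (ub_le_sup bS Ss).
by case: Ss => z _ <-; exact: norm2_ge0.
Qed.

(** Two points near an interior point are at positive distance. The diameter is a real supremum, so
    the boundedness of the cell, inherited from the domain, has to be shown as well. *)
Lemma diam_cell_gt0 k : k \in T -> 0 < diam (cell k).
Proof.
move=> kT; have [_ nT cT _] := tT; have nk := nT _ kT.
have [x kx] := bary_pos_neq0 nk.
have := bary_pos_interior nk kx; move=> /nbhs_rV[e e0 he].
have kcD : cell k `<=` closure D by rewrite cT => y ky; exists k.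
have [M M0 hM] := bounded_box bD.
have cM : cell k `<=` cbox (const_mx (- M)) (const_mx M).
  apply: subset_trans kcD _; rewrite [X in _ `<=` X](closure_id _).1; last exact: closed_cbox.
  by apply: closure_subset; apply: subset_trans hM _; exact: box_cbox.
pose y := x + (e / 2) *: base_vec ord0.
have ky : cell k y.
  apply: he => i; rewrite !mxE opprD addNKr normrN normrM (ger0_norm (ltW (divr_gt0 e0 _))) //.
  apply: (@le_lt_trans _ _ (e / 2)); last by rewrite ltr_pdivrMr // ltr_pMr // ltr1n.
  have e2 : 0 <= e / 2 by rewrite divr_ge0 // ltW.
  by rewrite ler_piMr //; case: (_ && _); rewrite ?normr1 ?normr0.
apply: (@lt_le_trans _ _ (norm2 (y - x))).
  rewrite /y addrC addKr norm2Z mulr_gt0 ?normr_gt0 ?gt_eqF ?divr_gt0 //.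
  by rewrite /norm2 sqrtr_gt0 dotv_base /base_vec mxE !eqxx.
apply: ub_le_sup; last by exists (y, x) => //; split => //; exact: bary_pos_cell nk _ kx.
exists (\sum_(i < n.+1) (2 * M)) => _ [[a b] [/= ka kb] <-].
apply: le_trans (norm2_le_sum _) _; apply: ler_sum => i _; rewrite !mxE.
have := cM _ ka i; have := cM _ kb i; rewrite !mxE => /andP[h1 h2] /andP[h3 h4].
by rewrite ler_norml; apply/andP; split; lra.
Qed.

Lemma mesh_neq0 : D !=set0 -> exists k, k \in T.
Proof.
move=> [x Dx]; have [_ _ cT _] := tT.
have : closure D x by exact: subset_closure.
by rewrite cT => -[k kT _]; exists k.
Qed.

Lemma hmesh_gt0 : D !=set0 -> 0 < hmesh T.
Proof.
move=> /mesh_neq0[k kT]; apply: lt_le_trans (diam_cell_gt0 kT) _.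
exact: (@le_bigmax_seq _ _ _ T 0 k xpredT (fun k => diam (cell k)) kT isT).
Qed.

Lemma sqrt_sum_le (I : Type) (s : seq I) (a : I -> R) : (forall i, 0 <= a i) ->
  Num.sqrt (\sum_(i <- s) a i) <= \sum_(i <- s) Num.sqrt (a i).
Proof.
move=> a0; elim: s => [|i s IH]; first by rewrite !big_nil sqrtr0.
rewrite !big_cons; apply: (@le_trans _ _ (Num.sqrt (a i) + Num.sqrt (\sum_(j <- s) a j))); last by rewrite lerD2l.
have s0 : 0 <= \sum_(j <- s) a j by exact: sumr_ge0.
rewrite -ler_sqr ?nnegrE ?addr_ge0 ?sqrtr_ge0 // sqr_sqrtr ?addr_ge0 // sqrrD !sqr_sqrtr //.
by rewrite lerD2r lerDl mulrn_wge0 // mulr_ge0 ?sqrtr_ge0.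
Qed.

(** The square root is subadditive, so the norm is bounded by the plain sum of local norms, the form
    in which the indicators are added. *)
Lemma N2_cells f : L2f D f -> N2 D f <= \sum_(k <- T) N2 (cell k)° f.
Proof.
move=> lf; have [mf if_] := lf.
pose F k x := patch (fun=> 0) (cell k)° (fun x => f x ^+ 2) x.
have iF k : vol.-integrable D (EFin \o F k).
  apply: (ae_le_integrable mD _ if_).
    rewrite (_ : F k = fun x => \1_((cell k)°) x * f x ^+ 2).
      apply: measurable_funM; last exact: measurable_funX.
      by apply: measurable_indic; exact: measurable_cell_interior.
    by apply/funext => x; rewrite /F /patch indicE; case: ifP => _; rewrite ?mul1r ?mul0r.
  apply: aeW => x _; rewrite /F /patch; case: ifP => _; rewrite ?normr0 ?sqr_ge0 //.
  by rewrite ger0_norm ?sqr_ge0.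
have eF k : k \in T -> \int[vol]_(x in D) F k x = l2 (cell k)° f f.
  move=> kT; have kD := cell_interior_sub oD lD tT kT.
  have -> : \int[vol]_(x in D) F k x = \int[vol]_(x in D `&` (cell k)°) (f x ^+ 2).
    by rewrite Rintegral_mkcondr.
  by rewrite setIidr //; apply: eq_Rintegral => x _; rewrite expr2.
have [I1 I2] := Rintegral_sum T mD fD iF.
apply: (@le_trans _ _ (Num.sqrt (\sum_(k <- T) l2 (cell k)° f f))); last first.
  by apply: sqrt_sum_le => k; exact: l2_ge0.
rewrite ler_wsqrtr // big_seq -(eq_bigr _ (fun k kT => eF k kT)) -big_seq -I2.
apply: le_trans (ler_norm _) _; apply: (ae_le_Rintegral mD _ I1); first exact: measurable_funM.
apply: filterS (mesh_interior_ae tT) => x m Dx.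
have [k kT kx] := m (subset_closure Dx); have [uT nT _ _] := tT.
have F0 k' : 0 <= F k' x by rewrite /F /patch; case: ifP => _ //; exact: sqr_ge0.
rewrite (bigD1_seq k) //= [F k x]/F /patch mem_set; last exact: (bary_pos_interior (nT _ kT)).
by rewrite ger0_norm -?expr2 ?sqr_ge0 // lerDl sumr_ge0.
Qed.

End cell_decomposition.

Section indicators.
Context {R : realType} {n : nat} (P : problem R n).
Local Notation pt := 'rV[R]_n.+1.
Local Notation vol := (leb R n.+1).
Local Notation D := (Omega P).
Implicit Types (u v w : pt -> pt) (p q C S : pt -> R) (k : simplex R n).
Hypothesis hP : standing_assumptions P.
Let oD := domain_open hP.
Let bD := domain_bounded hP.
Let mD := domain_measurable hP.
Let fD := domain_finite hP.
Let lD := domain_lipschitz hP.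
Variable T : mesh R n.
Hypothesis tT : triangulates D T.

Lemma clap_P1 k C x : P1_on k C -> (cell k)° x -> clap C x = 0.
Proof.
move=> hC kx; have [w hw] := P1_cgrad hC.
rewrite /clap big1 // => i _; rewrite /pd.
rewrite (@near_eq_derive _ _ _ _ (cst (w ord0 i))); first by rewrite derive_cst.
have : nbhs x (cell k)° by apply: open_nbhs_nbhs; split => //; exact: open_interior.
apply: filterS => y ky; have := hw _ ky => /(congr1 (fun v : pt => v ord0 i)).
by rewrite mxE.
Qed.

(** Inside a cell the residual is the integrand of [eta_D1] plus g - gh: the Laplacian is 0 there,
    and weak derivatives agree with classical ones almost everywhere. *)
Lemma Lp2_residual_cell k u C gh : k \in T -> spXh D T u -> spYh D T C ->
  piecewise_cst T gh ->
  ((N2 (cell k)° (residual P u C))%:E <=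
   Lp 2%:E (cell k)° (fun x =>
       alpha P * clap C x - dotv (u x) (cgrad C x) - 2^-1 * cdiv u x * C x
       - r0 P * C x + gh x)%R + Lp 2%:E (cell k)° (g P \- gh)%R)%E.
Proof.
move=> kT hu [hC hC0] hgh; set E := (cell k)°.
have mE : measurable E by exact: measurable_cell_interior.
have oE : open E by exact: open_interior.
have ED : E `<=` D by exact: (cell_interior_sub oD lD tT kT).
have dC := P1h_discrete hC; have hC1 := discrete_H1f oD bD lD tT dC.
have lr := residual_L2 hP tT hu hC1.
have lrE := L2f_sub mD mE ED lr.
have mub i : measurable_fun D (component u i) by case: (spXh_bnd bD i hu).
have mC : measurable_fun D C by case: (discrete_bnd bD dC).
have mg : measurable_fun D (g P) by case: (g_L2 hP).
have mgh : measurable_fun E gh.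
  have [c hc] := hgh _ kT.
  apply: (eq_measurable_fun (cst c)); last exact: measurable_cst.
  by move=> x /set_mem Ex; rewrite hc.
have mdiv : measurable_fun E (cdiv u).
  rewrite /cdiv; elim: (index_enum _) => [|i r IH].
    under eq_fun do rewrite big_nil; exact: measurable_cst.
  under eq_fun do rewrite big_cons; apply: measurable_funD => //.
  apply: (measurable_pd mD oE ED (mub i)) => x Ex.
  by have [_ h] := hu; exact: (@P1b_derivable _ _ k _ x _ (h _ kT i) Ex).
have [wC hwC] := P1_cgrad (hC.2 _ kT).
(* The integrand with the Laplacian removed and the gradient replaced by its constant value, a form
   whose measurability is plain. *)
pose res x := - dotv (u x) wC - 2^-1 * cdiv u x * C x - r0 P * C x + gh x.
have mres : measurable_fun E res.
  have mE' f : measurable_fun D f -> measurable_fun E f by exact: measurable_funS.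
  apply: measurable_funD => //; apply: measurable_funB; last by apply: measurable_funM => //; exact: mE'.
  apply: measurable_funB; last first.
    by apply: measurable_funM; [apply: measurable_funM|exact: mE'].
  apply: measurableT_comp => //; apply: measurable_dotv_fun => i; first exact: mE'.
  by rewrite (_ : component _ i = fun=> wC ord0 i) //; exact: measurable_cst.
have eres : Lp 2%:E E (fun x => alpha P * clap C x - dotv (u x) (cgrad C x)
     - 2^-1 * cdiv u x * C x - r0 P * C x + gh x) = Lp 2%:E E res.
  rewrite /Lp; congr Lnorm; apply/funext => x /=; rewrite /patch; case: ifPn => // /set_mem Ex.
  by rewrite (clap_P1 (hC.2 _ kT) Ex) hwC // mulr0 sub0r.
rewrite eres -(Lp2E mE lrE).
have m2 : measurable_fun E (g P \- gh) by apply: measurable_funB => //; exact: measurable_funS mg.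
have p1 : 1 <= 2 :> R by rewrite ler1n.
apply: le_trans (LpD mE p1 mres m2).
apply: (Lp_ae_le mE (lt_le_trans ltr01 p1)); [by case: lrE|exact: measurable_funD|].
have e1 := discrete_wgrad oD bD lD tT dC.
have e2 : {ae vol, forall x, forall i, D x -> wpd D i (component u i) x = pd i (component u i) x}.
  by apply: filter_forall => i; have [_ _ h] := discrete_wpd oD bD lD tT i (spXh_discrete i hu).
apply: filterS2 e1 e2 => x E1 E2 Ex; have Dx := ED _ Ex.
rewrite le_eqVlt; apply/orP; left; apply/eqP; congr `|_|.
rewrite /residual /res /= E1 // hwC //.
have -> : wdiv D u x = cdiv u x by apply: eq_bigr => i _; exact: E2.
by ring.
Qed.

Lemma indicator_cell k (gamma : R) gh u0 C0 u p C Cx : k \in T -> spXh D T u -> spYh D T C ->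
  piecewise_cst T gh ->
  ((diam (cell k) * N2 (cell k)° (residual P u C))%:E <=
   eta_D1 P T gh k u C + eta_D2 P gamma k u0 C0 u p + eta_D3 P T k u
   + eta_L1 k u0 u + eta_L2 k C0 C + (diam (cell k))%:E * Lp 2%:E (cell k)° (g P \- gh)%R
   + LpV 2%:E (cell k)° (fun x => fC P Cx x - mean_on k (fC P Cx))%R)%E.
Proof.
move=> kT hu hC hgh.
have h := Lp2_residual_cell kT hu hC hgh.
have d0 : (0 <= (diam (cell k))%:E)%E by rewrite lee_fin; exact: diam_ge0.
have dp (x e : R) : (0 <= (x `^ e)%:E)%E by rewrite lee_fin powR_ge0.
have facets (e q' : R) (Q : pred 'I_n.+2) (F : 'I_n.+2 -> pt -> R) : (0 <= \sum_(j < n.+2 | Q j) (diam (facet k j) `^ e)%:E * Lp_facet q' k j (F j))%E.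
  by apply: sume_ge0 => j _; apply: mule_ge0; [exact: dp|exact: poweR_ge0].
have t1 : ((diam (cell k))%:E * Lp 2%:E (cell k)° (fun x =>
       alpha P * clap C x - dotv (u x) (cgrad C x) - 2^-1 * cdiv u x * C x
       - r0 P * C x + gh x)%R <= eta_D1 P T gh k u C)%E.
  by rewrite /eta_D1 leeDl // mule_ge0 // lee_fin invr_ge0.
have t2 : (0 <= eta_D2 P gamma k u0 C0 u p)%E by exact: Lp_ge0.
have t3 : (0 <= eta_D3 P T k u)%E.
  by rewrite /eta_D3 adde_ge0 // mule_ge0 // Lp_ge0.
have t4 : (0 <= eta_L1 k u0 u)%E by exact: Lp_ge0.
have t5 : (0 <= eta_L2 k C0 C)%E by exact: poweR_ge0.
have t6 : (0 <= LpV 2%:E (cell k)° (fun x => fC P Cx x - mean_on k (fC P Cx))%R)%E by exact: Lp_ge0.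
rewrite EFinM; apply: le_trans (lee_wpmul2l d0 h) _.
rewrite ge0_muleDr ?Lp_ge0 //.
apply: le_trans (leeDl _ t6); rewrite leeD2r //.
do 4 (apply: le_trans (leeDl _ _); last by []).
exact: t1.
Qed.

Lemma indicators_lower_bound (beta0 gamma : R) gh u0 C0 u p C Cx : 0 < beta0 -> uniformly_regular beta0 T ->
  spXh D T u -> spYh D T C -> piecewise_cst T gh ->
  ((beta0 * hmesh T * N2 D (residual P u C))%:E <= \sum_(k <- T)
   (eta_D1 P T gh k u C + eta_D2 P gamma k u0 C0 u p + eta_D3 P T k u
   + eta_L1 k u0 u + eta_L2 k C0 C + (diam (cell k))%:E * Lp 2%:E (cell k)° (g P \- gh)%R
   + LpV 2%:E (cell k)° (fun x => fC P Cx x - mean_on k (fC P Cx))%R))%E.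
Proof.
move=> b0 ur hu hC hgh.
have hC1 : H1f D C by apply: (discrete_H1f oD bD lD tT); apply: P1h_discrete; case: hC.
have lr := residual_L2 hP tT hu hC1.
have h0 : 0 <= hmesh T by apply: ltW; apply: (hmesh_gt0 (D := D)) => //; exact: domain_neq0.
apply: (@le_trans _ _ (\sum_(k <- T) (diam (cell k) * N2 (cell k)° (residual P u C))%:E)%E); last first.
  by rewrite big_seq [leRHS]big_seq; apply: lee_sum => k kT; exact: indicator_cell.
rewrite sumEFin lee_fin; apply: (@le_trans _ _ (\sum_(k <- T) beta0 * hmesh T * N2 (cell k)° (residual P u C))).
  by rewrite -mulr_sumr ler_wpM2l ?mulr_ge0 ?(ltW b0) // (N2_cells oD bD lD tT lr).
rewrite big_seq [leRHS]big_seq; apply: ler_sum => k kT.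
by rewrite ler_wpM2r ?N2_ge0 // ur.
Qed.

End indicators.

Lemma energy_zero_arith (R : realFieldType) (al r0 N V t : R) : 0 < al -> 0 < r0 -> 0 <= N -> 0 <= V ->
  t + t = 0 -> al * V ^+ 2 + t + r0 * N ^+ 2 = 0 -> N = 0 /\ V = 0.
Proof.
move=> a0 r00 N0 V0 tt e; have t0 : t = 0 by lra.
have h1 : 0 <= al * V ^+ 2 by rewrite mulr_ge0 ?sqr_ge0 // ltW.
have h2 : 0 <= r0 * N ^+ 2 by rewrite mulr_ge0 ?sqr_ge0 // ltW.
have h3 : al * V ^+ 2 = 0 by lra.
have h4 : r0 * N ^+ 2 = 0 by lra.
move/eqP: h3; rewrite mulf_eq0 gt_eqF //= sqrf_eq0 => /eqP ->.
by move/eqP: h4; rewrite mulf_eq0 gt_eqF //= sqrf_eq0 => /eqP ->.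
Qed.

(** * Sources orthogonal to all test functions *)

Section degenerate.
Context {R : realType} {n : nat} (P : problem R n).
Local Notation pt := 'rV[R]_n.+1.
Local Notation vol := (leb R n.+1).
Local Notation D := (Omega P).
Implicit Types (u v w : pt -> pt) (p q C S : pt -> R).
Hypothesis hP : standing_assumptions P.
Let oD := domain_open hP.
Let bD := domain_bounded hP.
Let mD := domain_measurable hP.
Let fD := domain_finite hP.

Lemma inLpinf_bnd f : inLp +oo D f -> bnd D f.
Proof.
move=> [mf h]; split => //; exists (fine (Lp +oo D f)); apply: Lpinf_ae.
by rewrite fineK // ge0_fin_numE // Lp_ge0.
Qed.

(** The divergence equation is tested with [psi] minus its mean, whose gradient is that of [psi]. *)
Lemma solution_div_free u p C psi : inLpV +oo D u -> solves_Va P u p C -> test_fun D psi ->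
  \sum_i l2 D (component u i) (pd i psi) = 0.
Proof.
move=> hu [hx _ hy sol] t.
have bu i : bnd D (component u i) by exact: inLpinf_bnd.
have lu : L2v D u by exact: bnd_L2v.
have lpd i : L2f D (pd i psi) by apply: bnd_L2 => //; apply: test_bnd; exact: test_fun_pd.
have [st _ _] := t; have [M _ hM] := test_fun_bounded t.
have hb i : exists L : R, forall x, `|pd i psi x| <= L.
  by have [L _ h] := pd_bounded i t; exists L.
have [hq wq] := zero_mean_spM oD bD (domain_neq0 hP) st (ex_intro _ M hM) hb.
set q := (fun x => psi x - _) in hq wq.
have [_ e _] := sol u q C hx hq hy.
rewrite -[RHS]e /l2V; have h := wgrad_ae oD wq.
have lw : L2v D (wgrad D q).
  apply: H1f_L2v; apply: (H1f_intro oD _ wq lpd).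
  apply: (L2B mD); last by apply: bnd_L2 => //; exact: bnd_cst.
  by apply: bnd_L2 => //; exact: test_bnd.
have [I1 <-] := Rintegral_sum (index_enum _) mD fD (fun i => L2fM mD (bnd_L2 mD fD (bu i)) (lpd i)).
apply: (ae_eq_Rintegral mD).
- by apply/measurable_EFinP; exact: measurable_int I1.
- by apply: measurable_dotv_fun => i; [case: (lw i)|case: (bu i)].
- apply: filterS h => x ex Dx; rewrite ex // /dotv; apply: eq_bigr => i _.
  by rewrite mxE mulrC.
Qed.

(** By density [g] is also orthogonal to [C]. The convection tested with [C] vanishes by
    antisymmetry for a divergence-free velocity, so the energy identity has right-hand side 0. *)
Lemma degenerate_solution u p C : inLpV +oo D u -> solves_Va P u p C ->
  (forall phi, test_fun D phi -> l2 D (g P) phi = 0) ->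
  LpV 3%:E D (wgrad D C) = 0%E /\ Lp +oo D C = 0%E.
Proof.
move=> hu sol hg; have [hx hm hy sol3] := sol.
have bu i : bnd D (component u i) by exact: inLpinf_bnd.
have hC1 := sobolev_H1f oD hy.1; have lC : L2f D C by case: hC1.
have lgr := H1f_L2v hC1.
have b0 : bnd D (fun=> 0 : R) by exact: bnd_cst.
have l0 : L2f D (fun=> 0 : R) by exact: bnd_L2.
have z0 f : l2 D (fun=> 0) f = 0.
  by rewrite /l2; under eq_Rintegral do rewrite mul0r; rewrite Rintegral_cst // mul0r.
have df psi : test_fun D psi -> l2 D (fun=> 0) psi + \sum_i l2 D (component u i) (pd i psi) = 0.
  by move=> t; rewrite z0 add0r; exact: (solution_div_free hu sol t).
have := convection_antisym oD bD bu b0 df hy hy.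
have -> : (fun x => 0 * C x) = (fun=> 0) by apply/funext => x; rewrite mul0r.
rewrite z0 add0r => conv.
have gC : l2 D (g P) C = 0.
  have := H10_density oD bD (g_L2 hP) (fun _ : 'I_n.+1 => l0) _ hy.
  rewrite big1 ?addr0 => [h|i _]; last exact: z0.
  by apply: h => phi t; rewrite hg // big1 ?addr0 // => i _; exact: z0.
have [_ _ e] := sol3 u p C hx hm hy; rewrite gC -NV_sqr -N2_sqr in e.
have [N0 V0] : N2 D C = 0 /\ NV D (wgrad D C) = 0.
  exact: (energy_zero_arith (alpha_gt0 hP) (r0_gt0 hP) (N2_ge0 D C) (NV_ge0 D _) conv e).
split.
- apply/eqP; rewrite eq_le Lp_ge0 andbT.
  have p0 : 0 < 3 :> R by [].
  have mw i : measurable_fun D (component (wgrad D C) i) by case: (lgr i).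
  have := LpV_le_cst hP p0 mw (lexx 0); rewrite mul0r; apply.
  rewrite NVE in V0; have := N2_eq0 mD (L2v_norm mD fD lgr) V0.
  by apply: filterS => x h Dx; have /= -> := h Dx.
- apply/eqP; rewrite eq_le Lp_ge0 andbT; apply: ae_Lpinf => //.
  have := N2_eq0 mD lC N0.
  by apply: filterS => x h Dx; rewrite h // normr0.
Qed.

End degenerate.

(** * Constants and conclusion *)

Section constants.
Context {R : realType}.

(** The powers of [h] combine to d/3 - d/2 + 1 = (6 - d)/6, the inverse of the exponent in the mesh
    condition; raising that condition to the power (6 - d)/6 gives the bound. *)
Lemma inverse_mesh_bound (d h cI c1 c3 M S6 : R) : 0 < h -> d < 6 -> 0 < cI -> 0 < c1 -> 0 < S6 ->
  0 <= c3 -> 0 <= M ->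
  h <= ((1 / (2 * cI * c1)) * (c3 + M * S6^-1)) `^ (6 / (6 - d)) ->
  cI * h `^ (d / 3 - d / 2) * S6 * (c1 * h) <= (S6 * c3 + M) / 2.
Proof.
move=> h0 d6 I0 c0 S0 c30 M0; set Y := _ * _ => hY.
have Y0 : 0 <= Y.
  by rewrite mulr_ge0 ?divr_ge0 ?addr_ge0 ?mulr_ge0 ?invr_ge0 ?(ltW I0) ?(ltW c0) ?(ltW S0).
have d6' : 0 < 6 - d by rewrite subr_gt0.
have E : h `^ (d / 3 - d / 2) * h = h `^ ((6 - d) / 6).
  rewrite -{2}(powRr1 (ltW h0)) -powRD; last by rewrite (gt_eqF h0) implybT.
  by congr (_ `^ _); field.
have H : h `^ ((6 - d) / 6) <= Y.
  have -> : Y = (Y `^ (6 / (6 - d))) `^ ((6 - d) / 6).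
    have -> : Y = Y `^ 1 by rewrite powRr1.
    rewrite -!powRrM; congr (_ `^ _); field; by rewrite gt_eqF.
  by apply: ge0_ler_powR => //; rewrite ?divr_ge0 ?nnegrE ?powR_ge0 // ltW.
have -> : cI * h `^ (d / 3 - d / 2) * S6 * (c1 * h) = cI * c1 * S6 * (h `^ (d / 3 - d / 2) * h) by ring.
rewrite E; apply: (@le_trans _ _ (cI * c1 * S6 * Y)).
  by rewrite ler_pM2l // !mulr_gt0.
by rewrite le_eqVlt; apply/orP; left; apply/eqP; rewrite /Y; field; rewrite !gt_eqF.
Qed.

(** With m = (mu / rho) Km, the second summand of [gamma_star] is exactly 32 / (27 m) times the
    square of (beta / rho) K3^3 L1, because K3^6 = cI^6 h^-d. The first summand is nonnegative. *)
Lemma gamma_bound (d h cI be rh mu Km KM F L1 gamma : R) : 0 < h -> 0 < cI -> 0 < be -> 0 < rh ->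
  0 < mu -> 0 < Km -> 0 <= KM -> 0 <= F -> L1 = rh / (mu * Km) * F ->
  32 * be / (27 * rh) * cI ^+ 3 * h `^ (- d / 2) * (rh / (mu * Km) + rh * KM / (mu * Km ^+ 2)) * F
  + 32 * be ^+ 2 * rh / (27 * mu ^+ 3 * Km ^+ 3) * cI ^+ 6 * h `^ (- d) * F ^+ 2 < gamma ->
  32 * (be / rh * (cI * h `^ (d / 3 - d / 2)) ^+ 3 * L1) ^+ 2 <= 27 * (mu / rh * Km) * gamma.
Proof.
move=> h0 I0 b0 r0 m0 K0 KM0 F0 ->; set A1 := (X in X + _); set A2 := (X in _ + X) => hg.
have A10 : 0 <= A1.
  rewrite /A1; apply: mulr_ge0 => //; apply: mulr_ge0; last first.
    by rewrite addr_ge0 // divr_ge0 ?mulr_ge0 ?exprn_ge0 // ltW.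
  apply: mulr_ge0; last exact: powR_ge0.
  by rewrite mulr_ge0 ?exprn_ge0 ?divr_ge0 ?mulr_ge0 // ltW.
have hA2 : A2 <= gamma by apply: ltW; apply: le_lt_trans hg; rewrite lerDr.
have E6 : (h `^ (d / 3 - d / 2)) ^+ 6 = h `^ (- d).
  by rewrite -powR_mulrn ?powR_ge0 // -powRrM; congr (_ `^ _); field.
apply: (@le_trans _ _ (27 * (mu / rh * Km) * A2)); last first.
  by rewrite ler_pM2l // !mulr_gt0 // invr_gt0.
rewrite /A2 -E6 le_eqVlt; apply/orP; left; apply/eqP.
by set H := h `^ _; field; rewrite !gt_eqF.
Qed.

Lemma ereal_sum_bound (a : R) (x y : \bar R) (b : R) : 0 < a -> (0 <= x)%E -> (0 <= y)%E ->
  (a%:E * x + y <= b%:E)%E -> x \is a fin_num /\ y \is a fin_num.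
Proof.
by move=> a0; case: x => [x| |] //; case: y => [y| |] // _ _;
  rewrite ?gt0_muley ?lte_fin // ?addye ?addey // leye_eq.
Qed.

End constants.

(** From G <= K r follows 1 <= K r / G, the factor that turns the upper bound (c1 + 1) h into a
    multiple of the lower bound b h r. *)
Lemma final_arith (R : realFieldType) (c1 K b G h r : R) : 0 < c1 -> 0 < K -> 0 < b -> 0 < G -> 0 < h ->
  G <= K * r -> c1 * h + h <= (c1 + 1) * K / (b * G) * (b * h * r).
Proof.
move=> c0 K0 b0 G0 h0 H.
have -> : (c1 + 1) * K / (b * G) * (b * h * r) = (c1 + 1) * h * (K * r / G).
  by field; rewrite !gt_eqF.
rewrite -{2}[h]mul1r -mulrDl ler_peMr ?mulr_ge0 ?addr_ge0 ?(ltW c0) ?(ltW h0) //.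
by rewrite ler_pdivlMr // mul1r.
Qed.

Lemma eq_leq_ereal (R : realType) (x y : \bar R) : x = y -> (x <= y)%E.
Proof. by move=> ->. Qed.

Theorem theorem4p5 (R : realType) (n : nat) (dim : n.+1 = 2%N \/ n.+1 = 3%N)
  (P : problem R n) (hP : standing_assumptions P)
  (fam : set (mesh R n)) (sigma beta0 : R) (hbeta0 : 0 < beta0)
  (hfam : forall T, fam T -> [/\ triangulates (Omega P) T,
     regular_mesh sigma T & uniformly_regular beta0 T])
  (u : 'rV[R]_n.+1 -> 'rV[R]_n.+1) (p C : 'rV[R]_n.+1 -> R)
  (hsol : solves_Va P u p C)
  (hf0 : inLpV 2%:E (Omega P) (f0 P))
  (hC : sobolev 2 2%:E (Omega P) C)
  (hu : forall i, sobolev 1 3%:E (Omega P) (component u i))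
  (hu' : inLpV +oo (Omega P) u)
  (hp : sobolev 2 2%:E (Omega P) p)
  (S2 S6 cI c1 : R)
  (hS2 : sobolev_cst P 2 S2) (hS6 : sobolev_cst P 6 S6)
  (hcI : inverse_cst P fam cI) (hc1 : apriori_cst P fam u p C c1)
  (hsmall1 : (S6%:E * LpV 3%:E (Omega P) (wgrad (Omega P) C)
     + Lp +oo (Omega P) C
     <= (alpha P * mu P * Km P
         / (2 * Num.sqrt 2 * rho P * cf1 P * S2))%:E)%E)
  (hsmall2 : (S6%:E * LpV 3%:E (Omega P) (wgrad (Omega P) C)
     + Lp +oo (Omega P) C
     <= (alpha P * mu P * Km P / (8 * rho P * cf1 P ^+ 2 * S2))%:E)%E) :
  exists ct1 : R, 0 < ct1 /\
  forall (T : mesh R n) (uh : 'rV[R]_n.+1 -> 'rV[R]_n.+1)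
    (ph Ch : 'rV[R]_n.+1 -> R) (gamma : R)
    (us : nat -> 'rV[R]_n.+1 -> 'rV[R]_n.+1)
    (ps Cs : nat -> 'rV[R]_n.+1 -> R) (gh : 'rV[R]_n.+1 -> R),
  fam T -> solves_Vah P T uh ph Ch ->
  0 < gamma -> iterates P T gamma us ps Cs -> piecewise_cst T gh ->
  (LpV 2%:E (Omega P) (us 0%N) <= (L1cst P S2)%:E)%E ->
  Num.max (gamma_star P cI S2 (hmesh T)) (gamma_sstar P cI S2 (hmesh T))
    < gamma ->
  ((hmesh T)%:E <=
     ((1 / (2 * cI * c1))%:E *
      (LpV 3%:E (Omega P) (wgrad (Omega P) C)
       + Lp +oo (Omega P) C * (S6^-1)%:E))
     `^ (6 / (6 - n.+1%:R)))%E ->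
  exists i1 : nat, (0 < i1)%N /\ forall i : nat, (i1 <= i)%N ->
  (LpV (3 / 2)%:E (Omega P) (wgrad (Omega P) (p \- ps i.+1)%R) <=
   ct1%:E * \sum_(k <- T)
     (eta_D1 P T gh k (us i.+1) (Cs i.+1)
      + eta_D2 P gamma k (us i) (Cs i) (us i.+1) (ps i.+1)
      + eta_D3 P T k (us i.+1)
      + eta_L1 k (us i) (us i.+1)
      + eta_L2 k (Cs i) (Cs i.+1)
      + (diam (cell k))%:E * Lp 2%:E (cell k)° (g P \- gh)%R
      + LpV 2%:E (cell k)°
          (fun x => fC P C x - mean_on k (fC P C))%R))%E.
Proof.
have oD := domain_open hP; have bD := domain_bounded hP; have lD := domain_lipschitz hP.
have mD := domain_measurable hP; have fD := domain_finite hP; have D0 := domain_neq0 hP.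
have lf0 : L2v (Omega P) (f0 P) by exact: LpV2_fin_L2v hf0.
have [cI0 hcI'] := hcI; have [c10 hc1'] := hc1.
have S20 := S2_gt0 hS2; have S60 : 0 < S6 by case: hS6.
have [_ _ hC10 _] := hsol.
have hC1 := sobolev_H1f oD hC10.1.
have hp1 : H1f (Omega P) p.
  apply: (sobolev_H1f oD); case: hp => h1 h2; split; first exact: h1.
  by move=> i; have [g1 w1 [s1 _]] := h2 i; exists g1.
(* The smallness condition bounds a sum of extended reals, so both norms are finite and can be
   handled as reals. *)
have [fc3 fM] := ereal_sum_bound S60 (Lp_ge0 _ _ _) (Lp_ge0 _ _ _) hsmall1.
set c3 := fine (LpV 3%:E (Omega P) (wgrad (Omega P) C)).
set M := fine (Lp +oo (Omega P) C).
have c3E : LpV 3%:E (Omega P) (wgrad (Omega P) C) = c3%:E by rewrite fineK.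
have ME : Lp +oo (Omega P) C = M%:E by rewrite fineK.
have c30 : 0 <= c3 by rewrite fine_ge0 // Lp_ge0.
have M0 : 0 <= M by rewrite fine_ge0 // Lp_ge0.
have hM := Lpinf_ae (eq_leq_ereal ME).
have hA : S6 * c3 + M <= alpha P * mu P * Km P / (2 * Num.sqrt 2 * rho P * cf1 P * S2).
  by rewrite -lee_fin EFinD EFinM -c3E -ME.
(* The alternative concerns the data alone, so [phi] may enter a constant that is independent of the
   mesh. *)
have [|/existsNP[phi /not_implyP[tphi /eqP gphi]]] :=
    pselect (forall phi, test_fun (Omega P) phi -> l2 (Omega P) (g P) phi = 0).
  move=> g0; have [z1 z2] := degenerate_solution hP hu' hsol g0.
  exists 1; split => // T uh ph Ch gamma us ps Cs gh fT _ _ _ _ _ _.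
  (* With both norms of [C] equal to 0, the right-hand side of the mesh condition is a positive
     power of 0, against h > 0. *)
  have [tT _ _] := hfam _ fT; rewrite z1 z2 mul0e adde0 mule0 poweR0r; last first.
    by rewrite mulf_neq0 ?invr_eq0 ?subr_eq0 //; case: dim => ->; rewrite eqr_nat.
  by rewrite lee_fin leNgt (hmesh_gt0 bD tT D0).
(* A nonzero pairing with [phi] makes the norm of [g] positive, and with it [Fcst]. *)
have F0 : 0 < Fcst P S2.
  rewrite (FcstE hP lf0) ltr_wpDl ?NV_ge0 // mulr_gt0 //.
    by rewrite mulr_gt0 ?(cf1_gt0 hP) // divr_gt0 ?exprn_gt0 ?(alpha_gt0 hP).
  rewrite lt_neqAle N2_ge0 andbT eq_sym; apply: contra_neq gphi => z.
  have lphi : L2f (Omega P) phi by apply: bnd_L2 => //; exact: test_bnd.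
  by apply/eqP; rewrite -normr_le0 (le_trans (l2_CS mD (g_L2 hP) lphi)) // z mul0r.
have L1E : L1cst P S2 = rho P / (mu P * Km P) * Fcst P S2 by [].
have L10 : 0 < L1cst P S2.
  by rewrite L1E mulr_gt0 // divr_gt0 ?mulr_gt0 ?(rho_gt0 hP) ?(mu_gt0 hP) ?(Km_gt0 hP).
have V0 : 0 <= 8 / 7 * L1cst P S2 by rewrite mulr_ge0 ?divr_ge0 // ltW.
have [K K0 hK] := residual_test hP hS2 tphi V0.
have G0 : 0 < `|l2 (Omega P) (g P) phi| by rewrite normr_gt0.
exists ((c1 + 1) * K / (beta0 * `|l2 (Omega P) (g P) phi|)); split.
  by rewrite divr_gt0 ?mulr_gt0 // addr_gt0.
move=> T uh ph Ch gamma us ps Cs gh fT hlim g0 hit hgh _ hgam hh.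
have [tT _ ur] := hfam _ fT; have h0 := hmesh_gt0 bD tT D0.
set h := hmesh T in h0 hgam hh *.
set d := n.+1%:R : R in hgam hh *.
have d6 : d < 6 by rewrite /d; case: dim => ->; rewrite ltr_nat.
pose K3 := cI * h `^ (d / 3 - d / 2).
have K30 : 0 <= K3 by rewrite mulr_ge0 ?powR_ge0 // ltW.
have hK3 v : spXh (Omega P) T v -> (LpV 3%:E (Omega P) v <= (K3 * NV (Omega P) v)%:E)%E.
  move=> hv; rewrite EFinM -(LpV2E mD fD (spXh_L2v oD bD hv)).
  by apply: hcI' => //; left.
have [_ [hph _] [_ hCh] _] := hlim.
have hd := hc1' T uh ph Ch fT hlim.
have hCC := H10B oD bD hC10 hCh; have hCC1 := sobolev_H1f oD hCC.1.
have hd1 : NV (Omega P) (wgrad (Omega P) (C \- Ch)) <= c1 * h.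
  rewrite -lee_fin -(LpV2E mD fD (H1f_L2v hCC1)); apply: le_trans hd.
  by rewrite -addeA leeDl // adde_ge0 // Lp_ge0.
have hd2 : (LpV (3 / 2)%:E (Omega P) (wgrad (Omega P) (p \- ph)%R) <= (c1 * h)%:E)%E.
  by apply: le_trans hd; rewrite leeDr // adde_ge0 // Lp_ge0.
have hKd : K3 * S6 * (c1 * h) <= (S6 * c3 + M) / 2.
  apply: (inverse_mesh_bound h0 d6 cI0 c10 S60 c30 M0).
  by rewrite -lee_fin; move: hh; rewrite c3E ME.
have KM0 : 0 <= KM P by rewrite (le_trans (ltW (Km_gt0 hP))) // (Km_le_KM hP).
have hg' : 32 * (beta P / rho P * K3 ^+ 3 * L1cst P S2) ^+ 2 <= 27 * (mu P / rho P * Km P) * gamma.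
  apply: (gamma_bound h0 cI0 (beta_gt0 hP) (rho_gt0 hP) (mu_gt0 hP) (Km_gt0 hP) KM0 (ltW F0) L1E).
  by move: hgam; rewrite gt_max => /andP[].
have convu := velocity_converges hP lf0 tT hS2 hS6 K30 hK3 g0 hit hlim F0 hC10 c30 M0 (eq_leq_ereal c3E) hM hd1 hA hKd hg'.
have convC := conc_converges hP lf0 tT hS2 hS6 K30 hK3 g0 hit hlim F0 hC10 c30 M0 (eq_leq_ereal c3E) hM hd1 hA hKd hg'.
have bu := velocity_eventually hP lf0 tT hS2 g0 hit F0.
have [N1 hN1] := bu.
(* The precision asked of the iterates is the mesh size itself, positive by [h0]. *)
have [N2' hN2] := pressure_limit hP lf0 tT K30 hK3 g0 hit hlim convu convC bu hp1 h0.
exists (N1 + N2').+1; split => // i Ni.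
have i1 : (N1 <= i.+1)%N by rewrite (leq_trans _ (leqW Ni)) // leqW // leq_addr.
have i2 : (N2' <= i)%N by rewrite (leq_trans _ Ni) // leqW // leq_addl.
apply: le_trans (hN2 i i2) _; apply: le_trans (leeD2r h%:E hd2) _.
have hu1 := iterate_spXh hit i.+1; have hC' := iterate_spYh hit i.+1.
have low := indicators_lower_bound hP tT (gamma) (us i) (Cs i) (ps i.+1) C hbeta0 ur hu1 hC' hgh.
have res := hK T _ _ tT hu1 hC'.2 (iterate_conc hit i hC') (hN1 _ i1).
have ct0 : (0 <= ((c1 + 1) * K / (beta0 * `|l2 (Omega P) (g P) phi|))%:E)%E.
  by rewrite lee_fin divr_ge0 ?mulr_ge0 ?addr_ge0 // ltW.
apply: le_trans (lee_wpmul2l ct0 low).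
rewrite -EFinD -EFinM lee_fin -/h.
exact: (final_arith c10 K0 hbeta0 G0 h0 res).
Qed.
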